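(* Let $H$ be a finite-dimensional factorizable ribbon Hopf algebra over $\Bbbk$ and let $\mathcal C=H\text{-Bimod}$ be the ribbon category of finite-dimensional $H$-bimodules, with coregular bimodule Frobenius algebra $F$ and handle Hopf algebra $K$. Then for any pair of integers $g,n\ge 0$ the morphism $\mathrm{Cor}_{g;n}\in\mathrm{Hom}_{\mathcal C}(K^{\otimes g},F^{\otimes n})$ is invariant under the action $\pi^{F^{\otimes n}}_{g:n}$ of the mapping class group $\mathrm{Map}_{g:n}$; that is, $\pi^{F^{\otimes n}}_{g:n}(\gamma)(\mathrm{Cor}_{g;n})=\mathrm{Cor}_{g;n}$ for each of the generators $\gamma$ of $\mathrm{Map}_{g:n}$.
   Context: **Hopf algebra.** $\Bbbk$ is an algebraically closed field of characteristic zero. $H=(H,m,\eta,\Delta,\varepsilon,S)$ is a finite-dimensional Hopf algebra over $\Bbbk$ with antipode $S$; Sweedler notation $\Delta(h)=h_1\otimes h_2$. $H$ is quasitriangular with R-matrix $R\in H\otimes H$ (invertible, $R\,\Delta(h)\,R^{-1}=\Delta^{\rm op}(h)$, $(\Delta\otimes{\rm id})(R)=R_{13}R_{23}$, $({\rm id}\otimes\Delta)(R)=R_{13}R_{12}$), with monodromy matrix $Q=R_{21}R$; write $Q=\sum q_1\otimes q_2$, $Q^{-1}=\sum p_1\otimes p_2$. $H$ is ribbon: there is a central invertible $v\in H$ with $S(v)=v$, $\varepsilon(v)=1$, $\Delta(v)=(v\otimes v)Q^{-1}$. $H$ is factorizable: $Q=\sum_\ell h_\ell\otimes k_\ell$ with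 $\{h_\ell\}$, $\{k_\ell\}$ bases of $H$; equivalently $f_Q:H^*\to H$, $f_Q(f)=\sum f(q_1)q_2$, is invertible. Then $H$ is unimodular. $\Lambda\in H$ is the two-sided integral and $\lambda\in H^*$ the right cointegral ($\lambda(h_1)h_2=\lambda(h)1$), normalized by $\lambda(\Lambda)=1$ and $f_Q(\lambda)=\Lambda$ (unique up to a common sign). **Category.** $\mathcal C=H\text{-Bimod}$: finite-dimensional $H$-bimodules; on $X\otimes_\Bbbk Y$, $h(x\otimes y)h'=h_1xh'_1\otimes h_2yh'_2$; unit $\mathbf 1=\Bbbk$ with both actions by $\varepsilon$. Braiding $c_{X,Y}(x\otimes y)=R^{-1}\cdot(y\otimes x)\cdot R$. Twist $\theta_X(x)=v\,x\,v^{-1}$. Right dual $X^\vee=X^*$ with $(h\xi h')(x)=\xi(S(h)\,x\,S^{-1}(h'))$ and evaluation $X^\vee\otimes X\to\mathbf 1$, $\xi\otimes x\mapsto\xi(x)$; left dual ${}^\vee X=X^*$ with $(h\xi h')(x)=\xi(S^{-1}(h)\,x\,S(h'))$, with evaluation $\tilde d_X:X\otimes{}^\vee X\to\mathbf 1$, $x\otimes\xi\mapsto\xi(x)$, and coevaluation $\tilde b_X:\mathbf 1\to{}^\vee X\otimes X$ (the canonical element). **Frobenius algebra $F$.** $F=H^*$ with $(h f h')(x)=f(S(h)\,x\,S^{-1}(h'))$. It is a commutative symmetric Frobenius algebra in $\mathcal C$ with product $m_F(f\otimes g)(x)=f(x_2)g(x_1)$, unit $\eta_F=\varepsilon$, counit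 $\varepsilon_F(f)=f(\Lambda)$, and coproduct $\Delta_F(f)=\sum f'\otimes f''$ determined by $\sum f'(y)f''(x)=f(x_1)\,\lambda(S(x_2)y)$ for all $x,y\in H$. $\Delta_F^{(n)}:F\to F^{\otimes n}$ is the iterated coproduct, with $\Delta_F^{(1)}={\rm id}_F$, $\Delta_F^{(0)}=\varepsilon_F$. **Handle Hopf algebra $K$.** $K=\int^{X\in\mathcal C}X^\vee\otimes X$, realized as $K=H^*\otimes H^*$ with $h\cdot(f\otimes g)=f(S(h_1)\,?\,h_2)\otimes g$, $(f\otimes g)\cdot h=f\otimes g(h_2\,?\,S^{-1}(h_1))$ and dinatural family $\imath_X:X^\vee\otimes X\to K$, $\imath_X(\xi\otimes x)(y\otimes z)=\xi(y\,x\,z)$. Its counit is $\varepsilon_K(f\otimes g)=f(1)g(1)$ and its integral is $\Lambda_K=\lambda\otimes\lambda$. Define, for $Y\in\mathcal C$: - $\mathcal Q^K_Y\in{\rm End}(K\otimes Y)$ by $\mathcal Q^K_Y(\imath_X\otimes{\rm id}_Y)=(\imath_X\otimes{\rm id}_Y)({\rm id}_{X^\vee}\otimes c_{Y,X}c_{X,Y})$, i.e. $f\otimes g\otimes y\mapsto\sum f(?p_1)\otimes g(q_1?)\otimes p_2\,y\,q_2$; - $\mathcal O_K\in{\rm End}(K\otimes K)$ by $\mathcal O_K(\imath_X\otimes\imath_Y)=(\imath_X\otimes\imath_Y)({\rm id}_{X^\vee}\otimes c_{Y^\vee,X}c_{X,Y^\vee}\otimes{\rm id}_Y)$; - $T_K\in{\rm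 End}(K)$ by $T_K\imath_X=\imath_X(\theta_{X^\vee}\otimes{\rm id}_X)$; - $S_K=(\varepsilon_K\otimes{\rm id}_K)\,\mathcal O_K\,({\rm id}_K\otimes\Lambda_K)$, i.e. $S_K(f\otimes g)(y\otimes z)=\sum f(p_1)\lambda(S(p_2)y)\,g(q_1)\lambda(zS^{-1}(q_2))$ (this is invertible); - $\rho^K_Y=(\varepsilon_K\otimes{\rm id}_Y)\,\mathcal Q^K_Y:K\otimes Y\to Y$. **The morphisms $\mathrm{Cor}_{g;n}$.** Let $C_1=m_F\circ(\rho^K_F\otimes{\rm id}_F)\circ({\rm id}_K\otimes\Delta_F):K\otimes F\to F$, $C_0={\rm id}_F$, $C_g=C_1\circ({\rm id}_K\otimes C_{g-1}):K^{\otimes g}\otimes F\to F$. Then $\mathrm{Cor}_{g;n}=\Delta_F^{(n)}\circ C_g\circ({\rm id}_{K^{\otimes g}}\otimes\eta_F)$. **The action.** $\mathrm{Map}_{g:n}$ is the mapping class group of the closed oriented genus-$g$ surface with $n$ boundary components (boundary components may be permuted). It is generated by: braidings $\omega_i$ ($1\le i\le n-1$) exchanging the $i$th and $(i+1)$st boundary circles; Dehn twists $\vartheta_i$ ($1\le i\le n$) about the boundary circles; S-transformations $S_k$ ($1\le k\le g$) of a one-holed torus neighborhood of the $k$th handle; and inverse Dehn twists along certain simple closed curves $a_l,e_l$ ($2\le l\le g$), $b_k,d_k$ ($1\le k\le g$), $t_{j,k}$ ($1\le j\le n-1$, $1\le k\le g$). By a construction of Lyubashenko, a projective representation $\pi^{F^{\otimes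 n}}_{g:n}$ of $\mathrm{Map}_{g:n}$ on $V={\rm Hom}_{\mathcal C}(K^{\otimes g},F^{\otimes n})$ is generated by the following operators ($\phi\in V$): - $\pi(\omega_i)\phi=({\rm id}_{F^{\otimes i-1}}\otimes c_{F,F}\otimes{\rm id}_{F^{\otimes n-i-1}})\circ\phi$; $\pi(\vartheta_i)\phi=({\rm id}_{F^{\otimes i-1}}\otimes\theta_F\otimes{\rm id}_{F^{\otimes n-i}})\circ\phi$; - $\pi(\gamma)\phi=\phi\circ z_\gamma$ with $z_{S_k}={\rm id}_{K^{\otimes g-k}}\otimes S_K\otimes{\rm id}_{K^{\otimes k-1}}$, $z_{d_k}={\rm id}_{K^{\otimes g-k}}\otimes T_K\otimes{\rm id}_{K^{\otimes k-1}}$, $z_{b_k}={\rm id}_{K^{\otimes g-k}}\otimes(S_K^{-1}T_KS_K)\otimes{\rm id}_{K^{\otimes k-1}}$, $z_{a_l}={\rm id}_{K^{\otimes g-l}}\otimes[\mathcal O_K(T_K\otimes T_K)]\otimes{\rm id}_{K^{\otimes l-2}}$, $z_{e_l}={\rm id}_{K^{\otimes g-l}}\otimes[(T_K\otimes\theta_{K^{\otimes l-1}})\,\mathcal Q^K_{K^{\otimes l-1}}]$; - with $Y=F^{\otimes n-j}$, $\pi(t_{j,k})\phi=(\Psi\otimes{\rm id}_Y)\circ({\rm id}_{K^{\otimes g}}\otimes\tilde b_Y)$, where $\Psi=({\rm id}_{F^{\otimes j}}\otimes\tilde d_Y)\circ(\phi\otimes{\rm id}_{{}^\vee Y})\circ\big({\rm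 id}_{K^{\otimes g-k}}\otimes[\mathcal Q^K_{K^{\otimes k-1}\otimes{}^\vee Y}\circ(T_K\otimes\theta_{K^{\otimes k-1}\otimes{}^\vee Y})]\big)$. *)

(* Defs.v *)
From HB Require Import structures.
From mathcomp Require Import all_boot all_order all_algebra all_field.

Set Implicit Arguments.
Unset Strict Implicit.
Unset Printing Implicit Defensive.

Import GRing.Theory.
Local Open Scope ring_scope.
Local Open Scope lfun_scope.

Reserved Notation "u '\ox' v" (at level 40, left associativity).

Section Tensor.
Variable k : fieldType.
Implicit Types U V W X Y Z : vectType k.

Definition dual V : vectType k := 'Hom(V, k^o).

Definition tr U V (f : 'Hom(U, V)) : 'Hom(dual V, dual U) :=
  linfun (fun xi : dual V => xi \o f).

Definition eb V (i : 'I_(\dim {:V})) : V := (vbasis {:V})`_i.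
Definition ebd V (i : 'I_(\dim {:V})) : dual V := 
  linfun (fun x : V => coord (vbasis {:V}) i x : k^o).

(* U (x) V is realized by matrices of coordinates in the bases eb. *)
Definition tens U V : vectType k := 'M[k]_(\dim {:U}, \dim {:V}).

Definition tpure U V (u : U) (v : V) : tens U V :=
  \matrix_(i, j) (coord (vbasis {:U}) i u * coord (vbasis {:V}) j v).

Local Notation "u '\ox' v" := (tpure u v).

(* Sweedler-type sum: if t is the sum of the t1 (x) t2, then tsum t b is the
   sum of the b t1 t2.  This is meaningful for bilinear b only (see tsumE). *)
Definition tsum U V W (t : tens U V) (b : U -> V -> W) : W :=
  \sum_i \sum_j (t : 'M[k]_(\dim {:U}, \dim {:V})) i j *: b (eb i) (eb j).

Definition tlift U V W (b : U -> V -> W) : 'Hom(tens U V, W) :=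
  linfun (fun t : tens U V => tsum t b).

Definition tmap U V U' V' (f : 'Hom(U, U')) (g : 'Hom(V, V')) :
    'Hom(tens U V, tens U' V') :=
  tlift (fun u v => tpure (f u) (g v)).

Definition tflip U V : 'Hom(tens U V, tens V U) :=
  tlift (fun u v => tpure v u).
Definition assoc U V W : 'Hom(tens (tens U V) W, tens U (tens V W)) :=
  tlift (fun uv w => tsum uv (fun u v => tpure u (tpure v w))).
Definition assocV U V W : 'Hom(tens U (tens V W), tens (tens U V) W) :=
  tlift (fun u vw => tsum vw (fun v w => tpure (tpure u v) w)).
Definition unitl V : 'Hom(tens k^o V, V) :=
  tlift (fun (c : k^o) v => (c : k) *: v).
Definition unitlV V : 'Hom(V, tens k^o V) :=
  linfun (fun v : V => tpure (1 : k^o) v).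
Definition unitr V : 'Hom(tens V k^o, V) :=
  tlift (fun v (c : k^o) => (c : k) *: v).
Definition unitrV V : 'Hom(V, tens V k^o) :=
  linfun (fun v : V => tpure v (1 : k^o)).

(* The map k -> V, 1 |-> v. *)
Definition point V (v : V) : 'Hom(k^o, V) :=
  linfun (fun c : k^o => (c : k) *: v).

(* The identification of U* (x) V* with the bilinear forms on U x V:
   (f (x) g)(u, v) = f u * g v. *)
Definition teval U V (t : tens (dual U) (dual V)) (u : U) (v : V) : k^o :=
  tsum t (fun f g => (f u : k^o) * g v).
Definition tform U V (b : U -> V -> k^o) : tens (dual U) (dual V) :=
  \sum_i \sum_j (b (eb i) (eb j) : k) *: tpure (ebd i) (ebd j).

Lemma linfunE' U V (f : U -> V) : linear f -> linfun f =1 f.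
Proof.
move=> lf; pose ff : {linear U -> V} :=
  HB.pack f (GRing.isLinear.Build k U V *:%R f lf).
exact: (lfunE ff).
Qed.

Lemma linear_lfun U V (f : 'Hom(U, V)) : linear f.
Proof. exact: linearP. Qed.

Lemma lin_id U : linear (fun x : U => x). Proof. by []. Qed.
Lemma lin_hom U V W (f : 'Hom(V, W)) (h : U -> V) :
  linear h -> linear (fun x => f (h x)).
Proof. by move=> lh a u v; rewrite lh linearP. Qed.
Lemma lin_app U V W (F : U -> 'Hom(V, W)) (y : V) :
  linear F -> linear (fun x => F x y).
Proof. by move=> lF a u v; rewrite lF add_lfunE scale_lfunE. Qed.
Lemma lin_compl U V W Z (F : U -> 'Hom(V, W)) (h : 'Hom(W, Z)) :
  linear F -> linear (fun x => h \o F x).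
Proof. by move=> lF a u v; rewrite lF comp_lfunDr -comp_lfunZr. Qed.
Lemma lin_compr U V W Z (F : U -> 'Hom(V, W)) (h : 'Hom(Z, V)) :
  linear F -> linear (fun x => F x \o h).
Proof. by move=> lF a u v; rewrite lF comp_lfunDl -comp_lfunZl. Qed.
Lemma lin_scale U V (h : U -> k^o) (y : V) :
  linear h -> linear (fun x => (h x : k) *: y).
Proof. by move=> lh a u v; rewrite lh scalerDl scalerA. Qed.
Lemma lin_scaler U V (c : k) (h : U -> V) :
  linear h -> linear (fun x => c *: h x).
Proof. by move=> lh a u v; rewrite lh scalerDr !scalerA mulrC. Qed.
Lemma lin_mull (A : falgType k) U (h : U -> A) (y : A) :
  linear h -> linear (fun x => h x * y).
Proof. by move=> lh a u v; rewrite lh mulrDl scalerAl. Qed.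
Lemma lin_mulr (A : falgType k) U (h : U -> A) (y : A) :
  linear h -> linear (fun x => y * h x).
Proof. by move=> lh a u v; rewrite lh mulrDr scalerAr. Qed.
Lemma lin_kmull U (h : U -> k^o) (y : k^o) :
  linear h -> linear (fun x => (h x * y : k^o)).
Proof. by move=> lh a u v; rewrite lh mulrDl -!mulrA. Qed.
Lemma lin_kmulr U (h : U -> k^o) (y : k^o) :
  linear h -> linear (fun x => (y * h x : k^o)).
Proof. by move=> lh a u v; rewrite lh mulrDr mulrCA. Qed.

Lemma lin_purel U U' V (h : U -> U') (v : V) :
  linear h -> linear (fun x => tpure (h x) v).
Proof.
by move=> lh a u u'; apply/matrixP => i j; rewrite !mxE lh linearP mulrDl -mulrA.
Qed.
Lemma lin_purer U V V' (h : U -> V') (v : V) :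
  linear h -> linear (fun x => tpure v (h x)).
Proof.
by move=> lh a u u'; apply/matrixP => i j; rewrite !mxE lh linearP mulrDr mulrCA.
Qed.

Lemma lin_suml U V W (b : U -> V -> W) : linear (fun t => tsum t b).
Proof.
move=> a s t; rewrite /tsum scaler_sumr -big_split; apply: eq_bigr => i _ /=.
rewrite scaler_sumr -big_split; apply: eq_bigr => j _ /=.
by rewrite !mxE scalerDl scalerA.
Qed.
Lemma lin_tsuml X U V W (h : X -> tens U V) (b : U -> V -> W) :
  linear h -> linear (fun x => tsum (h x) b).
Proof. by move=> lh a u v; rewrite lh lin_suml. Qed.
Lemma lin_tsumr X U V W (t : tens U V) (b : X -> U -> V -> W) :
  (forall u v, linear (fun x => b x u v)) -> linear (fun x => tsum t (b x)).
Proof.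
move=> lb a x y; rewrite /tsum scaler_sumr -big_split; apply: eq_bigr => i _ /=.
rewrite scaler_sumr -big_split; apply: eq_bigr => j _ /=.
by rewrite lb scalerDr !scalerA mulrC.
Qed.

Lemma tliftE U V W (b : U -> V -> W) t : tlift b t = tsum t b.
Proof. exact: (linfunE' (lin_suml b)). Qed.

Lemma eb_sum V (x : V) : x = \sum_i coord (vbasis {:V}) i x *: eb i.
Proof. exact: coord_vbasis (memvf x). Qed.

Lemma coord_eb V (i j : 'I_(\dim {:V})) : coord (vbasis {:V}) i (eb j) = (i == j)%:R.
Proof. by rewrite coord_free ?(basis_free (vbasisP _)) // eq_sym. Qed.

Definition bilin U V W (b : U -> V -> W) : Prop :=
  (forall v, linear (fun u => b u v)) /\ (forall u, linear (b u)).

Lemma tsumE U V W (b : U -> V -> W) u v :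
  bilin b ->
  tsum (tpure u v) b = b u v.
Proof.
move=> [l1 l2]; rewrite /tsum.
rewrite [in RHS](eb_sum u) -(linfunE' (l1 v)) linear_sum; apply: eq_bigr => i _.
rewrite linearZ /= (linfunE' (l1 v)).
rewrite [in RHS](eb_sum v) -(linfunE' (l2 _)) linear_sum scaler_sumr.
apply: eq_bigr => j _; rewrite linearZ /= (linfunE' (l2 _)) scalerA.
by rewrite mxE.
Qed.

Lemma tpure_eb U V (i : 'I_(\dim {:U})) (j : 'I_(\dim {:V})) :
  tpure (eb i) (eb j) = delta_mx i j :> 'M[k]__.
Proof. by apply/matrixP => a b; rewrite !mxE !coord_eb mulr_natr -mulnb natrM mulr_natr. Qed.

Lemma tens_sum U V (t : tens U V) : tsum t (@tpure U V) = t.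
Proof.
rewrite /tsum [RHS](matrix_sum_delta (t : 'M[k]_(\dim {:U}, \dim {:V}))).
apply: eq_bigr => i _; apply: eq_bigr => j _.
by rewrite tpure_eb.
Qed.

Lemma hom_tsum U V W Z (f : 'Hom(W, Z)) (t : tens U V) (b : U -> V -> W) :
  f (tsum t b) = tsum t (fun u v => f (b u v)).
Proof.
rewrite /tsum linear_sum; apply: eq_bigr => i _.
by rewrite linear_sum; apply: eq_bigr => j _; rewrite linearZ.
Qed.

Lemma eq_tsum U V W (t : tens U V) (b b' : U -> V -> W) :
  (forall u v, b u v = b' u v) -> tsum t b = tsum t b'.
Proof.
by move=> e; apply: eq_bigr => i _; apply: eq_bigr => j _; rewrite e.
Qed.

(* Linear maps that agree on pure tensors agree. *)
Lemma tens_ext U V W (f g : tens U V -> W) : linear f -> linear g ->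
  (forall u v, f (tpure u v) = g (tpure u v)) -> forall t, f t = g t.
Proof.
move=> lf lg e t; rewrite -(linfunE' lf) -(linfunE' lg) -(tens_sum t) !hom_tsum.
by apply: eq_tsum => u v; rewrite !linfunE'.
Qed.
End Tensor.

Notation "u '\ox' v" := (tpure u v).

Ltac lin_step :=
  match goal with
  | |- forall _, _ => intro
  | |- bilin _ => split
  | |- linear (fun x => x) => exact: lin_id
  | |- linear (fun x => ?c *: _) => apply: lin_scaler
  | |- linear (fun x => _ *: ?y) => apply: lin_scale
  | |- linear (fun x => tpure _ ?v) => apply: lin_purel
  | |- linear (fun x => tpure ?u _) => apply: lin_purer
  | |- linear (fun x => tsum _ ?b) => apply: lin_tsuml
  | |- linear (fun x => tsum ?t _) => apply: lin_tsumr
  | |- linear (fun x => ?f \o _) => apply: lin_compl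
  | |- linear (fun x => _ \o ?f) => apply: lin_compr
  | |- linear (fun x => fun_of_lfun ?f _) => apply: lin_hom
  | |- linear (fun x => fun_of_lfun _ ?f) => apply: lin_app
  | |- linear (fun x => (_ * ?y)) => first [apply: lin_mull | apply: lin_kmull]
  | |- linear (fun x => (?y * _)) => first [apply: lin_mulr | apply: lin_kmulr]
  | |- linear (fun_of_lfun ?f) => exact: linear_lfun
  | |- linear ?f => lazymatch f with fun _ => _ => fail | _ => change (linear (fun x => f x)) end
  end.
Ltac lin := repeat lin_step.

Section Tensor2.
Variable k : fieldType.
Implicit Types U V W X Y Z : vectType k.

Lemma trE U V (f : 'Hom(U, V)) (xi : dual V) : tr f xi = xi \o f.
Proof. by rewrite /tr linfunE' //; lin. Qed.

Lemma trM U V W (f : 'Hom(U, V)) (g : 'Hom(V, W)) : tr (g \o f) = tr f \o tr g.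
Proof. by apply/lfunP => xi; rewrite comp_lfunE !trE comp_lfunA. Qed.

Lemma tr1 U : tr (\1 : 'End(U)) = \1.
Proof. by apply/lfunP => xi; rewrite trE id_lfunE comp_lfun1r. Qed.

Lemma lin_tr X U V (h : X -> 'Hom(U, V)) : linear h -> linear (fun x => tr (h x)).
Proof.
move=> lh a u v; apply/lfunP => xi.
by rewrite lh add_lfunE scale_lfunE !trE comp_lfunDr -comp_lfunZr.
Qed.

Lemma tmapE U V U' V' (f : 'Hom(U, U')) (g : 'Hom(V, V')) u v :
  tmap f g (tpure u v) = tpure (f u) (g v).
Proof. by rewrite tliftE tsumE //; split=> *; lin. Qed.

Lemma lin_tmapl X U V U' V' (h : X -> 'Hom(U, U')) (g : 'Hom(V, V')) :
  linear h -> linear (fun x => tmap (h x) g).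
Proof.
move=> lh a x y; apply/lfunP; apply: tens_ext; try by lin.
by move=> u v; rewrite lh add_lfunE scale_lfunE !tmapE
   -(lin_purel (g v) (lin_id (U := U'))) add_lfunE scale_lfunE.
Qed.
Lemma lin_tmapr X U V U' V' (f : 'Hom(U, U')) (h : X -> 'Hom(V, V')) :
  linear h -> linear (fun x => tmap f (h x)).
Proof.
move=> lh a x y; apply/lfunP; apply: tens_ext; try by lin.
by move=> u v; rewrite lh add_lfunE scale_lfunE !tmapE
   -(lin_purer (f u) (lin_id (U := V'))) add_lfunE scale_lfunE.
Qed.

Lemma lin_tlift X U V W (b : X -> U -> V -> W) :
  (forall u v, linear (fun x => b x u v)) -> linear (fun x => tlift (b x)).
Proof.
move=> lb a x y; apply/lfunP => t.
by rewrite add_lfunE scale_lfunE !tliftE (lin_tsumr _ lb).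
Qed.

Lemma tflipE U V (u : U) (v : V) : tflip U V (u \ox v) = v \ox u.
Proof. by rewrite tliftE tsumE //; split=> *; lin. Qed.

Lemma assocE U V W (u : U) (v : V) (w : W) :
  assoc U V W ((u \ox v) \ox w) = u \ox (v \ox w).
Proof. by rewrite tliftE tsumE ?tsumE //; lin. Qed.

Lemma assocVE U V W (u : U) (v : V) (w : W) :
  assocV U V W (u \ox (v \ox w)) = (u \ox v) \ox w.
Proof. by rewrite tliftE tsumE ?tsumE //; lin. Qed.

Lemma unitlE V (c : k^o) (v : V) : unitl V (c \ox v) = (c : k) *: v.
Proof. by rewrite tliftE tsumE //; lin. Qed.
Lemma unitlVE V (v : V) : unitlV V v = (1 : k^o) \ox v.
Proof. by rewrite /unitlV linfunE' //; lin. Qed.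
Lemma unitrE V (v : V) (c : k^o) : unitr V (v \ox c) = (c : k) *: v.
Proof. by rewrite tliftE tsumE //; lin. Qed.
Lemma unitrVE V (v : V) : unitrV V v = v \ox (1 : k^o).
Proof. by rewrite /unitrV linfunE' //; lin. Qed.

Lemma pointE V (v : V) (c : k^o) : point v c = (c : k) *: v.
Proof. by rewrite /point linfunE' //; lin. Qed.

Lemma ebdE V (i : 'I_(\dim {:V})) (x : V) : ebd i x = coord (vbasis {:V}) i x.
Proof. by rewrite /ebd linfunE' // => a u v; rewrite linearP. Qed.

Lemma tevalE U V (f : dual U) (g : dual V) u v : teval (f \ox g) u v = f u * g v.
Proof. by rewrite /teval tsumE //; lin. Qed.

Lemma tformE U V (b : U -> V -> k^o) : bilin b ->
  forall u v, teval (tform b) u v = b u v.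
Proof.
move=> bb u v; rewrite -[RHS](tsumE u v bb) /tsum.
have lt : linear (fun t : tens (dual U) (dual V) => teval t u v).
  by rewrite /teval; lin.
rewrite -(linfunE' lt) linear_sum; apply: eq_bigr => i _.
rewrite linear_sum; apply: eq_bigr => j _.
by rewrite linearZ /= (linfunE' lt) tevalE !ebdE mxE; apply: mulrC.
Qed.

Lemma teval_inj U V (s t : tens (dual U) (dual V)) :
  (forall u v, teval s u v = teval t u v) -> s = t.
Proof.
have tf (r : tens (dual U) (dual V)) : tform (teval r) = r.
  have lf : linear (fun r => tform (@teval k U V r)).
    move=> a x y; rewrite /tform scaler_sumr -big_split; apply: eq_bigr => i _.
    rewrite scaler_sumr -big_split; apply: eq_bigr => j _ /=.
    by rewrite {1}/teval lin_suml scalerDl scalerA.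
  apply: (tens_ext lf (@lin_id _ _)) => f g.
  have ed W (h : dual W) : h = \sum_i (h (eb i) : k) *: ebd i.
    apply/lfunP => x; rewrite sum_lfunE [in LHS](eb_sum x) linear_sum.
    by apply: eq_bigr => i _; rewrite linearZ scale_lfunE ebdE; apply: mulrC.
  have ls X Y (h : X -> Y) (lh : linear h) n (c : 'I_n -> k) (x : 'I_n -> X) :
    h (\sum_i c i *: x i) = \sum_i c i *: h (x i).
    rewrite -(linfunE' lh) linear_sum; apply: eq_bigr => i _.
    by rewrite linearZ /= linfunE'.
  rewrite [in RHS](ed _ f) (ls _ _ _ (lin_purel g (@lin_id _ _))).
  apply: eq_bigr => i _.
  rewrite [in RHS](ed _ g) (ls _ _ _ (lin_purer (ebd i) (@lin_id _ _))).
  by rewrite scaler_sumr; apply: eq_bigr => j _; rewrite tevalE scalerA.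
move=> e; rewrite -(tf s) -(tf t) /tform.
by apply: eq_bigr => i _; apply: eq_bigr => j _; rewrite e.
Qed.
End Tensor2.

Section TensorAlgebra.
Variables (k : fieldType) (A : falgType k).

Definition tmul (s t : tens A A) : tens A A :=
  tsum s (fun a b => tsum t (fun c d => (a * c) \ox (b * d))).

Lemma tmulE (a b c d : A) : tmul (a \ox b) (c \ox d) = (a * c) \ox (b * d).
Proof. by rewrite /tmul tsumE ?tsumE //; lin. Qed.
End TensorAlgebra.

Record hopfAlg (k : fieldType) := HopfAlg {
  hopf_car :> falgType k;
  copr : 'Hom(hopf_car, tens hopf_car hopf_car);
  cou : 'Hom(hopf_car, k^o);
  anti : 'End(hopf_car);
  coprA : forall h, assoc _ _ _ (tmap copr \1 (copr h)) = tmap \1 copr (copr h);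
  coul : forall h, tsum (copr h) (fun h1 h2 => (cou h1 : k) *: h2) = h;
  cour : forall h, tsum (copr h) (fun h1 h2 => (cou h2 : k) *: h1) = h;
  copr1 : copr 1 = 1 \ox 1;
  coprM : forall a b, copr (a * b) = tmul (copr a) (copr b);
  cou1 : cou 1 = 1;
  couM : forall a b, cou (a * b) = cou a * cou b;
  antil : forall h, tsum (copr h) (fun h1 h2 => anti h1 * h2) = (cou h : k) *: 1;
  antir : forall h, tsum (copr h) (fun h1 h2 => h1 * anti h2) = (cou h : k) *: 1
}.

(* In rmxDl and rmxDr, R_13 R_23 and R_13 R_12 are written out as the sums of
   r1 (x) s1 (x) r2 s2 and of r1 s1 (x) s2 (x) r2. *)
Record is_rmatrix (k : fieldType) (H : hopfAlg k) (R Ri : tens H H) : Prop := {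
  rmxK : tmul R Ri = 1 \ox 1;
  rmxVK : tmul Ri R = 1 \ox 1;
  rmxC : forall h : H, tmul (tmul R (copr H h)) Ri = tflip H H (copr H h);
  rmxDl : tmap (copr H) \1 R =
    tsum R (fun r1 r2 => tsum R (fun s1 s2 => (r1 \ox s1) \ox (r2 * s2)));
  rmxDr : tmap \1 (copr H) R =
    tsum R (fun r1 r2 => tsum R (fun s1 s2 => (r1 * s1) \ox (s2 \ox r2)))
}.

Definition monodromy (k : fieldType) (A : falgType k) (R : tens A A) : tens A A :=
  tmul (tflip A A R) R.
Definition monodromyV (k : fieldType) (A : falgType k) (Ri : tens A A) : tens A A :=
  tmul Ri (tflip A A Ri).

Record is_ribbon (k : fieldType) (H : hopfAlg k) (Ri : tens H H) (v : H) : Prop := {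
  ribU : v \is a GRing.unit;
  ribC : forall h, v * h = h * v;
  ribS : anti H v = v;
  rib_cou : cou H v = 1;
  rib_copr : copr H v = tmul (v \ox v) (monodromyV Ri)
}.

Definition factorizable (k : fieldType) (A : falgType k) (Q : tens A A) : Prop :=
  exists h l : (\dim {:A}).-tuple A,
    [/\ basis_of {:A} h, basis_of {:A} l & Q = \sum_(i < \dim {:A}) h`_i \ox l`_i].

Definition drinfeld_map (k : fieldType) (A : falgType k) (Q : tens A A) :
    'Hom(dual A, A) :=
  linfun (fun f : dual A => tsum Q (fun q1 q2 => (f q1 : k) *: q2)).

(* L is the two-sided integral, lam the right cointegral. *)
Record normalized_integrals (k : fieldType) (H : hopfAlg k) (Q : tens H H)
    (L : H) (lam : dual H) : Prop := {
  integral_l : forall h, h * L = (cou H h : k) *: L;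
  integral_r : forall h, L * h = (cou H h : k) *: L;
  cointr : forall h, tsum (copr H h) (fun h1 h2 => (lam h1 : k) *: h2) = (lam h : k) *: 1;
  coint_int : lam L = 1;
  drinfeld_coint : drinfeld_map Q lam = L
}.

(* A finite-dimensional factorizable ribbon Hopf algebra, with its R-matrix
   and the inverse of the latter, its ribbon element, and a choice of one of
   the two normalized pairs of an integral and a cointegral. *)
Record frHopf (k : fieldType) := FrHopf {
  fr_hopf :> hopfAlg k;
  rmx : tens fr_hopf fr_hopf;
  rmxV : tens fr_hopf fr_hopf;
  ribbon : fr_hopf;
  integral : fr_hopf;
  cointegral : dual fr_hopf;
  fr_rmx : is_rmatrix rmx rmxV;
  fr_ribbon : is_ribbon rmxV ribbon;
  fr_factorizable : factorizable (monodromy rmx);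
  fr_int : normalized_integrals (monodromy rmx) integral cointegral
}.

Section SumLemmas.
Variable k : fieldType.
Implicit Types U V W X Y Z : vectType k.

Lemma lin_of_tsum U V W Z (f : W -> Z) (t : tens U V) (b : U -> V -> W) :
  linear f -> f (tsum t b) = tsum t (fun u v => f (b u v)).
Proof.
move=> lf; rewrite -(linfunE' lf) hom_tsum.
by apply: eq_tsum => u v; rewrite linfunE'.
Qed.

Lemma exchange_tsum U V (U' V' : vectType k) W (s : tens U V) (t : tens U' V')
    (F : U -> V -> U' -> V' -> W) :
  tsum s (fun a b => tsum t (F a b)) =
  tsum t (fun c d => tsum s (fun a b => F a b c d)).
Proof.
rewrite /tsum.
transitivity (\sum_i \sum_j \sum_i' \sum_j'
    (s i j * t i' j') *: F (eb i) (eb j) (eb i') (eb j')).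
  apply: eq_bigr => i _; apply: eq_bigr => j _; rewrite scaler_sumr.
  apply: eq_bigr => i' _; rewrite scaler_sumr.
  by apply: eq_bigr => j' _; rewrite scalerA.
under eq_bigr => i _ do rewrite exchange_big /=.
rewrite exchange_big /=; apply: eq_bigr => i' _.
under eq_bigr => i _ do rewrite exchange_big /=.
rewrite exchange_big /=; apply: eq_bigr => j' _.
rewrite scaler_sumr; apply: eq_bigr => i _; rewrite scaler_sumr.
by apply: eq_bigr => j _; rewrite scalerA mulrC.
Qed.
End SumLemmas.

Section Hopf.
Variables (k : fieldType) (H : hopfAlg k).
Local Notation Delta := (copr H).
Local Notation eps := (cou H).
Local Notation S := (anti H).
Implicit Types (a b h x y : H) (W : vectType k).

Lemma coassoc_sum W (T : H -> H -> H -> W) h :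
  (forall y z, linear (fun x => T x y z)) ->
  (forall x z, linear (fun y => T x y z)) -> (forall x y, linear (T x y)) ->
  tsum (Delta h) (fun a b => tsum (Delta a) (fun a1 a2 => T a1 a2 b)) =
  tsum (Delta h) (fun a b => tsum (Delta b) (fun b1 b2 => T a b1 b2)).
Proof.
move=> l1 l2 l3.
have [L LE] : exists L : 'Hom(tens H (tens H H), W),
    forall x y z, L (x \ox (y \ox z)) = T x y z.
  exists (tlift (fun x yz => tsum yz (T x))) => x y z.
  rewrite tliftE !tsumE //; split=> *; try exact: lin_suml.
  by apply: lin_tsumr => *; apply: l1.
have mE (f : 'Hom(H, tens H H)) (t : tens H H) :
    (tmap f (\1 : 'End(H)) t = tsum t (fun u v => f u \ox v))
  * (tmap (\1 : 'End(H)) f t = tsum t (fun u v => u \ox f v)).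
  by rewrite !tliftE; split; apply: eq_tsum => u v; rewrite id_lfunE.
have := congr1 L (coprA h); rewrite !mE !hom_tsum => e.
transitivity (tsum (Delta h) (fun a b => L (assoc _ _ _ (Delta a \ox b)))).
  apply: eq_tsum => a b; rewrite /assoc tliftE tsumE; last by lin.
  by rewrite hom_tsum; apply: eq_tsum => u v; rewrite LE.
rewrite e; apply: eq_tsum => a b; rewrite -{1}(tens_sum (Delta b)).
rewrite (lin_of_tsum _ _ (lin_purer a (@lin_id _ _))) hom_tsum.
by apply: eq_tsum => u v; rewrite LE.
Qed.

Lemma coul_sum W (f : H -> W) h : linear f ->
  tsum (Delta h) (fun h1 h2 => (eps h1 : k) *: f h2) = f h.
Proof.
move=> lf; rewrite -[in RHS](coul h) lin_of_tsum //; apply: eq_tsum => u v.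
by rewrite -(linfunE' lf) -(linfunE' lf) linearZ.
Qed.

Lemma cour_sum W (f : H -> W) h : linear f ->
  tsum (Delta h) (fun h1 h2 => (eps h2 : k) *: f h1) = f h.
Proof.
move=> lf; rewrite -[in RHS](cour h) lin_of_tsum //; apply: eq_tsum => u v.
by rewrite -(linfunE' lf) -(linfunE' lf) linearZ.
Qed.

Lemma coprM_sum W (F : H -> H -> W) a b : bilin F ->
  tsum (Delta (a * b)) F =
  tsum (Delta a) (fun a1 a2 => tsum (Delta b) (fun b1 b2 => F (a1 * b1) (a2 * b2))).
Proof.
move=> bF; rewrite coprM /tmul (lin_of_tsum _ _ (lin_suml F)).
apply: eq_tsum => a1 a2; rewrite (lin_of_tsum _ _ (lin_suml F)).
by apply: eq_tsum => b1 b2; rewrite tsumE.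
Qed.

Lemma anti1 : S 1 = 1.
Proof.
have := antil (1 : H); rewrite copr1 tsumE; last by lin.
by rewrite mulr1 cou1 scale1r.
Qed.

Lemma antiM a b : S (a * b) = S b * S a.
Proof.
pose F a1 a2 a3 b1 b2 b3 := S (a1 * b1) * (a2 * (b2 * S b3) * S a3).
pose E := tsum (Delta a) (fun a1 a' => tsum (Delta a') (fun a2 a3 =>
  tsum (Delta b) (fun b1 b' => tsum (Delta b') (fun b2 b3 => F a1 a2 a3 b1 b2 b3)))).
transitivity E.
  rewrite -(cour_sum (f := fun x => S (x * b))); last by lin.
  apply: eq_tsum => a1 a'.
  transitivity (tsum (Delta a') (fun a2 a3 => S (a1 * b) * (a2 * S a3))).
    rewrite -(lin_of_tsum (f := fun x => S (a1 * b) * x)); last by lin.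
    by rewrite antir -scalerAr mulr1.
  apply: eq_tsum => a2 a3; rewrite -(cour_sum (f := fun x => S (a1 * x) * (a2 * S a3))); last by lin.
  apply: eq_tsum => b1 b'.
  rewrite -(lin_of_tsum (f := fun x => S (a1 * b1) * (a2 * x * S a3))); last by lin.
  by rewrite antir -scalerAr mulr1 -scalerAl -scalerAr.
rewrite /E -(coassoc_sum (T := fun a1 a2 a3 => tsum (Delta b) (fun b1 b' =>
  tsum (Delta b') (fun b2 b3 => F a1 a2 a3 b1 b2 b3)))); try by rewrite /F; lin.
transitivity (tsum (Delta a) (fun a' a3 => (eps a' : k) *: (S b * S a3))); last first.
  by apply: (coul_sum (f := fun x => S b * S x)); lin.
apply: eq_tsum => a' a3.
transitivity (tsum (Delta b) (fun b' b3 => tsum (Delta a') (fun a1 a2 =>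
    tsum (Delta b') (fun b1 b2 => F a1 a2 a3 b1 b2 b3)))).
  rewrite [RHS]exchange_tsum; apply: eq_tsum => a1 a2.
  by rewrite (coassoc_sum (T := F a1 a2 a3)) //; rewrite /F; lin.
rewrite -(coul_sum (f := fun x => (eps a' : k) *: (S x * S a3))); last by lin.
apply: eq_tsum => b' b3.
transitivity (tsum (Delta (a' * b')) (fun x y => S x * y * (S b3 * S a3))).
  rewrite coprM_sum; last by lin.
  by apply: eq_tsum => a1 a2; apply: eq_tsum => b1 b2; rewrite /F !mulrA.
rewrite -(lin_of_tsum (f := fun x => x * (S b3 * S a3))); last by lin.
by rewrite antil -scalerAl mul1r couM scalerA mulrC.
Qed.
End Hopf.

Section FrHopf.
Variables (k : fieldType) (A : frHopf k).
Local Notation Delta := (copr A).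
Local Notation eps := (cou A).
Local Notation S := (anti A).
Local Notation L := (integral A).
Local Notation lam := (cointegral A).

(* h = lam(S(h) L_1) L_2. *)
Lemma anti_inj : injective S.
Proof.
pose G z1 z2 : tens A A := tsum (Delta L) (fun l1 l2 => (z1 * l1) \ox (z2 * l2)).
have slide (x : A) : G 1 x = G (S x) 1.
  rewrite -(coul_sum (f := G 1)); last by rewrite /G; lin.
  rewrite -(cour_sum (f := fun x => G (S x) 1)); last by rewrite /G; lin.
  transitivity (tsum (Delta x) (fun x1 x2 => tsum (Delta x1) (fun y1 y2 =>
      G (S y1 * y2) x2))).
    apply: eq_tsum => x1 x2.
    have lG : linear (fun z => G z x2) by rewrite /G; lin.
    rewrite -(lin_of_tsum _ _ lG) antil -(linfunE' lG) -(linfunE' lG).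
    by rewrite linearZ.
  rewrite (@coassoc_sum _ _ _ (fun a b c => G (S a * b) c)); try by rewrite /G; lin.
  apply: eq_tsum => x1 x2.
  transitivity (tsum (Delta (x2 * L)) (fun u v => (S x1 * u) \ox v)).
    rewrite coprM_sum; last by lin.
    apply: eq_tsum => y z; apply: eq_tsum => l1 l2; by rewrite mulrA.
  rewrite (integral_l (fr_int A)) linearZ /= -tliftE linearZ /= tliftE /G.
  by congr (_ *: _); apply: eq_tsum => u v; rewrite mul1r.
have inv x : tlift (fun u v => (lam u : k) *: v) (G (S x) 1) = x.
  rewrite -slide /G hom_tsum.
  transitivity (tsum (Delta L) (fun l1 l2 => x * ((lam l1 : k) *: l2))).
    apply: eq_tsum => l1 l2; rewrite tliftE tsumE; last by lin.
    by rewrite mul1r scalerAr.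
  rewrite -(lin_of_tsum (f := fun z => x * z)); last by lin.
  by rewrite (cointr (fr_int A)) (coint_int (fr_int A)) scale1r mulr1.
by move=> x y e; rewrite -(inv x) e inv.
Qed.

Definition antiV : 'End(A) := (S^-1)%VF.

Lemma antiK : cancel S antiV.
Proof. by apply: lker0_lfunK; apply/lker0P; exact: anti_inj. Qed.
Lemma antiVK : cancel antiV S.
Proof. by apply: lker0_lfunVK; apply/lker0P; exact: anti_inj. Qed.
Lemma antiV1 : antiV 1 = 1.
Proof. by rewrite -{1}(anti1 A) antiK. Qed.
Lemma antiVM a b : antiV (a * b) = antiV b * antiV a.
Proof. by apply: anti_inj; rewrite antiM !antiVK. Qed.
End FrHopf.

Record bimod (k : fieldType) (A : falgType k) := Bimod {
  bcar :> vectType k;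
  lact : A -> 'End(bcar);
  ract : A -> 'End(bcar);
  lact_lin : linear lact;
  ract_lin : linear ract;
  lact1 : lact 1 = \1;
  ract1 : ract 1 = \1;
  lactM : forall a b, lact (a * b) = lact a \o lact b;
  ractM : forall a b, ract (a * b) = ract b \o ract a;
  lractC : forall a b, lact a \o ract b = ract b \o lact a
}.

Definition bimod_hom (k : fieldType) (A : falgType k) (X Y : bimod A)
    (f : 'Hom(X, Y)) : Prop :=
  forall a, f \o lact X a = lact Y a \o f /\ f \o ract X a = ract Y a \o f.

Section TmapLemmas.
Variable k : fieldType.
Implicit Types U V W : vectType k.

Lemma linZ U V (f : U -> V) c x : linear f -> f (c *: x) = c *: f x.
Proof. by move=> lf; rewrite -!(linfunE' lf) linearZ. Qed.

Lemma hom_tens_ext U V W (f g : 'Hom(tens U V, W)) :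
  (forall u v, f (u \ox v) = g (u \ox v)) -> f = g.
Proof. by move=> e; apply/lfunP; apply: tens_ext => //; apply: linear_lfun. Qed.

Lemma tmap1 U V : tmap \1 \1 = \1 :> 'End(tens U V).
Proof. by apply: hom_tens_ext => u v; rewrite tmapE !id_lfunE. Qed.

Lemma tmap_comp U V (U1 V1 U2 V2 : vectType k) (f : 'Hom(U, U1)) (g : 'Hom(V, V1))
    (f1 : 'Hom(U1, U2)) (g1 : 'Hom(V1, V2)) :
  tmap (f1 \o f) (g1 \o g) = tmap f1 g1 \o tmap f g.
Proof. by apply: hom_tens_ext => u v; rewrite comp_lfunE !tmapE !comp_lfunE. Qed.

Lemma tmapZl U V (U' V' : vectType k) (c : k) (f : 'Hom(U, U')) (g : 'Hom(V, V')) :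
  tmap (c *: f) g = c *: tmap f g.
Proof.
apply: hom_tens_ext => u v; rewrite scale_lfunE !tmapE scale_lfunE.
exact: (linZ c _ (lin_purel (g v) (@lin_id _ _))).
Qed.
End TmapLemmas.

Ltac lin2 := repeat first
  [ assumption | lin_step | apply: lin_tmapl | apply: lin_tmapr | apply: lin_tr
  | exact: lact_lin | exact: ract_lin ].

Section TensorAct.
Variables (k : fieldType) (A : falgType k).
Implicit Types X Y : bimod A.

(* Componentwise actions t.(x (x) y) and (x (x) y).t of t in A (x) A. *)
Definition lact2 X Y (t : tens A A) : 'End(tens X Y) :=
  tsum t (fun a b => tmap (lact X a) (lact Y b)).
Definition ract2 X Y (t : tens A A) : 'End(tens X Y) :=
  tsum t (fun a b => tmap (ract X a) (ract Y b)).

Lemma lact2_bilin X Y : bilin (fun a b => tmap (lact X a) (lact Y b)).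
Proof. by lin2. Qed.
Lemma ract2_bilin X Y : bilin (fun a b => tmap (ract X a) (ract Y b)).
Proof. by lin2. Qed.
Lemma lact2_lin X Y : linear (@lact2 X Y). Proof. by rewrite /lact2; lin. Qed.
Lemma ract2_lin X Y : linear (@ract2 X Y). Proof. by rewrite /ract2; lin. Qed.
Lemma lact2E X Y a b : lact2 X Y (a \ox b) = tmap (lact X a) (lact Y b).
Proof. exact: (tsumE _ _ (lact2_bilin X Y)). Qed.
Lemma ract2E X Y a b : ract2 X Y (a \ox b) = tmap (ract X a) (ract Y b).
Proof. exact: (tsumE _ _ (ract2_bilin X Y)). Qed.

Lemma tmul_linl (t : tens A A) : linear (fun s => tmul s t).
Proof. by rewrite /tmul; lin. Qed.
Lemma tmul_linr (s : tens A A) : linear (tmul s).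
Proof. by rewrite /tmul; lin. Qed.

Lemma lact2M X Y s t : lact2 X Y (tmul s t) = lact2 X Y s \o lact2 X Y t.
Proof.
apply: (tens_ext (f := fun s => lact2 X Y (tmul s t))
  (g := fun s => lact2 X Y s \o lact2 X Y t)) s => [c x y||a b].
- by rewrite tmul_linl lact2_lin.
- by apply: lin_compr; apply: lact2_lin.
apply: (tens_ext (f := fun t => lact2 X Y (tmul (a \ox b) t))
  (g := fun t => lact2 X Y (a \ox b) \o lact2 X Y t)) t => [e x y||c d].
- by rewrite tmul_linr lact2_lin.
- by apply: lin_compl; apply: lact2_lin.
by rewrite tmulE !lact2E !lactM tmap_comp.
Qed.
Lemma ract2M X Y s t : ract2 X Y (tmul s t) = ract2 X Y t \o ract2 X Y s.
Proof.
apply: (tens_ext (f := fun s => ract2 X Y (tmul s t))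
  (g := fun s => ract2 X Y t \o ract2 X Y s)) s => [c x y||a b].
- by rewrite tmul_linl ract2_lin.
- by apply: lin_compl; apply: ract2_lin.
apply: (tens_ext (f := fun t => ract2 X Y (tmul (a \ox b) t))
  (g := fun t => ract2 X Y t \o ract2 X Y (a \ox b))) t => [e x y||c d].
- by rewrite tmul_linr ract2_lin.
- by apply: lin_compr; apply: ract2_lin.
by rewrite tmulE !ract2E !ractM tmap_comp.
Qed.
Lemma lract2C X Y s t : lact2 X Y s \o ract2 X Y t = ract2 X Y t \o lact2 X Y s.
Proof.
apply: (tens_ext (f := fun s => lact2 X Y s \o ract2 X Y t)
  (g := fun s => ract2 X Y t \o lact2 X Y s)) s => [||a b].
- by apply: lin_compr; apply: lact2_lin.
- by apply: lin_compl; apply: lact2_lin.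
apply: (tens_ext (f := fun t => lact2 X Y (a \ox b) \o ract2 X Y t)
  (g := fun t => ract2 X Y t \o lact2 X Y (a \ox b))) t => [||c d].
- by apply: lin_compl; apply: ract2_lin.
- by apply: lin_compr; apply: ract2_lin.
by rewrite lact2E ract2E -!tmap_comp !lractC.
Qed.

Lemma amullE (a x : A) : amull a x = a * x. Proof. exact: lfunE. Qed.
Lemma amulrE (a x : A) : amulr a x = x * a. Proof. exact: lfunE. Qed.

Fact regular1 : amull (1 : A) = \1 /\ amulr (1 : A) = \1.
Proof.
by split; apply/lfunP => x; rewrite (amullE, amulrE) id_lfunE (mul1r, mulr1).
Qed.
Fact amullM' (a b : A) : amull (a * b) = amull a \o amull b.
Proof. by apply/lfunP => x; rewrite !(comp_lfunE, amullE) mulrA. Qed.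
Fact amulrM' (a b : A) : amulr (a * b) = amulr b \o amulr a.
Proof. by apply/lfunP => x; rewrite !(comp_lfunE, amulrE) mulrA. Qed.
Fact amullrC (a b : A) : amull a \o amulr b = amulr b \o amull a.
Proof. by apply/lfunP => x; rewrite !(comp_lfunE, amullE, amulrE) mulrA. Qed.

Definition regular : bimod A :=
  @Bimod k A A (@amull k A) (@amulr k A) (@linearP _ _ _ _ _) (@linearP _ _ _ _ _)
    (proj1 regular1) (proj2 regular1) amullM' amulrM' amullrC.
End TensorAct.

Section Category.
Variables (k : fieldType) (A : frHopf k).
Local Notation Delta := (copr A).
Local Notation eps := (cou A).
Local Notation S := (anti A).
Local Notation Si := (antiV A).
Local Notation R := (rmx A).
Local Notation Ri := (rmxV A).
Local Notation Q := (monodromy R).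
Local Notation Qi := (monodromyV Ri).
Local Notation v := (ribbon A).
Local Notation L := (integral A).
Local Notation lam := (cointegral A).
Implicit Types (X Y : bimod A) (a b : A).

Definition eps_act a : 'End(k^o) := (eps a : k) *: \1.

Fact eps_act_lin : linear eps_act.
Proof. by move=> c x y; rewrite /eps_act linearP scalerDl scalerA. Qed.
Fact eps_act1 : eps_act 1 = \1.
Proof. by rewrite /eps_act cou1 scale1r. Qed.
Fact eps_actM a b : eps_act (a * b) = eps_act a \o eps_act b.
Proof.
by rewrite /eps_act couM -comp_lfunZl -comp_lfunZr comp_lfun1l scalerA.
Qed.
Fact eps_actMr a b : eps_act (a * b) = eps_act b \o eps_act a.
Proof.
by rewrite /eps_act couM -comp_lfunZl -comp_lfunZr comp_lfun1l scalerA mulrC.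
Qed.
Fact eps_actC a b : eps_act a \o eps_act b = eps_act b \o eps_act a.
Proof. by rewrite -eps_actM eps_actMr. Qed.

Definition bunit : bimod A :=
  Bimod eps_act_lin eps_act_lin eps_act1 eps_act1 eps_actM eps_actMr eps_actC.

Fact lact2_copr_lin X Y : linear (fun a => lact2 X Y (Delta a)).
Proof. by move=> c x y; rewrite linearP lact2_lin. Qed.
Fact ract2_copr_lin X Y : linear (fun a => ract2 X Y (Delta a)).
Proof. by move=> c x y; rewrite linearP ract2_lin. Qed.
Fact lact2_copr1 X Y : lact2 X Y (Delta 1) = \1.
Proof. by rewrite copr1 lact2E !lact1 tmap1. Qed.
Fact ract2_copr1 X Y : ract2 X Y (Delta 1) = \1.
Proof. by rewrite copr1 ract2E !ract1 tmap1. Qed.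
Fact lact2_coprM X Y a b :
  lact2 X Y (Delta (a * b)) = lact2 X Y (Delta a) \o lact2 X Y (Delta b).
Proof. by rewrite coprM lact2M. Qed.
Fact ract2_coprM X Y a b :
  ract2 X Y (Delta (a * b)) = ract2 X Y (Delta b) \o ract2 X Y (Delta a).
Proof. by rewrite coprM ract2M. Qed.

Definition btens X Y : bimod A :=
  Bimod (@lact2_copr_lin X Y) (@ract2_copr_lin X Y) (lact2_copr1 X Y)
    (ract2_copr1 X Y) (@lact2_coprM X Y) (@ract2_coprM X Y)
    (fun a b => lract2C X Y (Delta a) (Delta b)).

Section Duals.
Variables (X : bimod A) (f g : 'End(A)).
Hypotheses (f1 : f 1 = 1) (fM : forall a b, f (a * b) = f b * f a).
Hypotheses (g1 : g 1 = 1) (gM : forall a b, g (a * b) = g b * g a).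

Fact dual_lact_lin : linear (fun a => tr (lact X (f a))).
Proof. by apply: lin_tr => c x y; rewrite linearP lact_lin. Qed.
Fact dual_ract_lin : linear (fun a => tr (ract X (g a))).
Proof. by apply: lin_tr => c x y; rewrite linearP ract_lin. Qed.
Fact dual_lact1 : tr (lact X (f 1)) = \1.
Proof. by rewrite f1 lact1 tr1. Qed.
Fact dual_ract1 : tr (ract X (g 1)) = \1.
Proof. by rewrite g1 ract1 tr1. Qed.
Fact dual_lactM a b : tr (lact X (f (a * b))) = tr (lact X (f a)) \o tr (lact X (f b)).
Proof. by rewrite fM lactM trM. Qed.
Fact dual_ractM a b : tr (ract X (g (a * b))) = tr (ract X (g b)) \o tr (ract X (g a)).
Proof. by rewrite gM ractM trM. Qed.
Fact dual_lractC a b :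
  tr (lact X (f a)) \o tr (ract X (g b)) = tr (ract X (g b)) \o tr (lact X (f a)).
Proof. by rewrite -!trM lractC. Qed.

(* The dual space of X, with (a xi b)(x) = xi (f(a) x g(b)). *)
Definition bdual : bimod A :=
  Bimod dual_lact_lin dual_ract_lin dual_lact1 dual_ract1 dual_lactM dual_ractM
    dual_lractC.
End Duals.

Definition rdual X : bimod A :=
  bdual X (anti1 A) (@antiM _ A) (antiV1 A) (@antiVM _ A).
Definition ldual X : bimod A :=
  bdual X (antiV1 A) (@antiVM _ A) (anti1 A) (@antiM _ A).

Definition lev X : 'Hom(tens X (ldual X), k^o) :=
  tlift (fun x (xi : dual X) => xi x).
Definition lcoev X : 'Hom(k^o, tens (ldual X) X) :=
  point (\sum_i ebd i \ox eb i).

Definition braid X Y : 'Hom(btens X Y, btens Y X) :=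
  lact2 Y X Ri \o ract2 Y X R \o tflip X Y.
Definition twist X : 'End(X) := lact X v \o ract X (v^-1)%R.

Fixpoint tpow X n : bimod A := if n is m.+1 then btens X (tpow X m) else bunit.

Definition F : bimod A := rdual (regular A).

Definition mF : 'Hom(btens F F, F) :=
  tlift (fun f g : dual A =>
    linfun (fun x : A => tsum (Delta x) (fun x1 x2 => (f x2 : k^o) * g x1)) : dual A).
Definition etaF : 'Hom(bunit, F) := point (eps : dual A).
Definition epsF : 'Hom(F, bunit) := linfun (fun f : dual A => f L).
Definition DeltaF : 'Hom(F, btens F F) :=
  linfun (fun f : dual A =>
    tform (fun y x : A => tsum (Delta x) (fun x1 x2 => (f x1 : k^o) * lam (S x2 * y)))
      : tens (dual A) (dual A)).

(* The iterated coproducts F -> F^n. *)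
Fixpoint DeltaFn n : 'Hom(F, tpow F n) :=
  match n with
  | 0 => epsF
  | n'.+1 =>
      match n' return 'Hom(F, tpow F n') -> 'Hom(F, tpow F n'.+1) with
      | 0 => fun=> unitrV F
      | _.+1 => fun D => tmap \1 D \o DeltaF
      end (DeltaFn n')
  end.

Lemma mFE (f g : dual A) x :
  (mF (f \ox g) : dual A) x = tsum (Delta x) (fun x1 x2 => (f x2 : k^o) * g x1).
Proof.
have l (f' g' : dual A) : linear (fun x : A =>
    tsum (Delta x) (fun x1 x2 => (f' x2 : k^o) * g' x1)) by lin.
rewrite /mF tliftE tsumE; first by rewrite linfunE'.
split=> [g'|f'] c f1 f2; apply/lfunP => z.
  rewrite add_lfunE scale_lfunE !linfunE' //.
  by apply: (@lin_tsumr k (dual A) A A k^o (Delta z)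
    (fun f x1 x2 => (f x2 : k^o) * g' x1)); lin.
rewrite add_lfunE scale_lfunE !linfunE' //.
by apply: (@lin_tsumr k (dual A) A A k^o (Delta z)
  (fun g x1 x2 => (f' x2 : k^o) * g x1)); lin.
Qed.

Lemma DeltaFE (f : dual A) y x :
  teval (DeltaF f : tens (dual A) (dual A)) y x =
  tsum (Delta x) (fun x1 x2 => (f x1 : k^o) * lam (S x2 * y)).
Proof.
pose b (f : dual A) (y x : A) : k^o :=
  tsum (Delta x) (fun x1 x2 => (f x1 : k^o) * lam (S x2 * y)).
have bb f' : bilin (b f') by rewrite /b; lin.
rewrite /DeltaF linfunE'; first exact: (tformE (bb f)).
move=> c f1 f2; apply: teval_inj => z w; rewrite (tformE (bb _)).
rewrite /teval lin_suml -!/(teval _ _ _) !(tformE (bb _)) /b.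
by apply: (@lin_tsumr k (dual A) A A k^o (Delta w)
  (fun f x1 x2 => (f x1 : k^o) * lam (S x2 * z))); lin.
Qed.

Definition adl a : 'End(A) := tsum (Delta a) (fun a1 a2 => amull (S a1) \o amulr a2).
Definition adr a : 'End(A) := tsum (Delta a) (fun a1 a2 => amull a2 \o amulr (Si a1)).

Lemma adlE a x : adl a x = tsum (Delta a) (fun a1 a2 => S a1 * x * a2).
Proof.
have l : linear (fun f : 'End(A) => f x) by lin.
rewrite /adl (lin_of_tsum _ _ l); apply: eq_tsum => a1 a2.
by rewrite comp_lfunE amullE amulrE mulrA.
Qed.
Lemma adrE a x : adr a x = tsum (Delta a) (fun a1 a2 => a2 * x * Si a1).
Proof.
have l : linear (fun f : 'End(A) => f x) by lin.
rewrite /adr (lin_of_tsum _ _ l); apply: eq_tsum => a1 a2.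
by rewrite comp_lfunE amullE amulrE mulrA.
Qed.

Fact adl_lin : linear adl. Proof. by rewrite /adl; lin. Qed.
Fact adr_lin : linear adr. Proof. by rewrite /adr; lin. Qed.
Fact adl1 : adl 1 = \1.
Proof.
apply/lfunP => x; rewrite adlE copr1 tsumE; last by lin.
by rewrite anti1 mul1r mulr1 id_lfunE.
Qed.
Fact adr1 : adr 1 = \1.
Proof.
apply/lfunP => x; rewrite adrE copr1 tsumE; last by lin.
by rewrite antiV1 mul1r mulr1 id_lfunE.
Qed.
Fact adlM a b : adl (a * b) = adl b \o adl a.
Proof.
apply/lfunP => x; rewrite comp_lfunE !adlE coprM_sum; last by lin.
rewrite exchange_tsum; apply: eq_tsum => b1 b2.
rewrite (lin_of_tsum (f := fun z => S b1 * z * b2)); last by lin.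
by apply: eq_tsum => a1 a2; rewrite antiM !mulrA.
Qed.
Fact adrM a b : adr (a * b) = adr a \o adr b.
Proof.
apply/lfunP => x; rewrite comp_lfunE !adrE coprM_sum; last by lin.
apply: eq_tsum => a1 a2.
rewrite (lin_of_tsum (f := fun z => a2 * z * Si a1)); last by lin.
by apply: eq_tsum => b1 b2; rewrite antiVM !mulrA.
Qed.

Definition K_lact a : 'End(tens (dual A) (dual A)) := tmap (tr (adl a)) \1.
Definition K_ract a : 'End(tens (dual A) (dual A)) := tmap \1 (tr (adr a)).

Fact K_lact_lin : linear K_lact.
Proof. by apply: lin_tmapl; apply: lin_tr; apply: adl_lin. Qed.
Fact K_ract_lin : linear K_ract.
Proof. by apply: lin_tmapr; apply: lin_tr; apply: adr_lin. Qed.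
Fact K_lact1 : K_lact 1 = \1. Proof. by rewrite /K_lact adl1 tr1 tmap1. Qed.
Fact K_ract1 : K_ract 1 = \1. Proof. by rewrite /K_ract adr1 tr1 tmap1. Qed.
Fact K_lactM a b : K_lact (a * b) = K_lact a \o K_lact b.
Proof. by rewrite /K_lact -tmap_comp adlM trM comp_lfun1l. Qed.
Fact K_ractM a b : K_ract (a * b) = K_ract b \o K_ract a.
Proof. by rewrite /K_ract -tmap_comp adrM trM comp_lfun1l. Qed.
Fact K_lractC a b : K_lact a \o K_ract b = K_ract b \o K_lact a.
Proof. by rewrite /K_lact /K_ract -!tmap_comp !comp_lfun1l !comp_lfun1r. Qed.

Definition K : bimod A :=
  Bimod K_lact_lin K_ract_lin K_lact1 K_ract1 K_lactM K_ractM K_lractC.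

Definition iota X : 'Hom(btens (rdual X) X, K) :=
  tlift (fun (xi : dual X) x =>
    tform (fun y z : A => xi (lact X y (ract X z x))) : tens (dual A) (dual A)).

Definition epsK : 'Hom(K, bunit) :=
  tlift (fun f g : dual A => (f 1 : k^o) * g 1).
Definition LambdaK : 'Hom(bunit, K) := point (lam \ox lam : tens (dual A) (dual A)).

(* Precomposition with translations: pml x f = f(x ?) and pmr x f = f(? x). *)
Definition pml (x : A) : 'End(dual A) := tr (amull x).
Definition pmr (x : A) : 'End(dual A) := tr (amulr x).

Definition QK Y : 'End(btens K Y) :=
  tsum Qi (fun p1 p2 => tmap (tmap (pmr p1) \1) (lact Y p2)) \o
  tsum Q (fun q1 q2 => tmap (tmap \1 (pml q1)) (ract Y q2)).

Definition TK : 'End(K) := tmap (pml v) (pmr (v^-1)%R).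

Definition OK : 'End(btens K K) :=
  tsum Qi (fun p1 p2 => tmap (tmap (pmr p1) \1) (tmap (pml (S p2)) \1)) \o
  tsum Q (fun q1 q2 => tmap (tmap \1 (pml q1)) (tmap \1 (pmr (Si q2)))).

Definition SK : 'End(K) :=
  unitl K \o tmap epsK \1 \o OK \o tmap \1 LambdaK \o unitrV K.

Definition rhoK Y : 'Hom(btens K Y, Y) := unitl Y \o tmap epsK \1 \o QK Y.

Definition handle : 'Hom(btens K F, F) :=
  mF \o tmap (rhoK F) \1 \o assocV K F F \o tmap \1 DeltaF.

Fixpoint handles g : 'Hom(btens (tpow K g) F, F) :=
  if g is g'.+1 then
    handle \o tmap \1 (handles g') \o assoc K (tpow K g') F
  else unitl F.

Definition Cor g n : 'Hom(tpow K g, tpow F n) :=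
  DeltaFn n \o handles g \o tmap \1 etaF \o unitrV (tpow K g).

(* id_{X^m} (x) z on X^{m+r} and on X^{m+r} (x) W. *)
Fixpoint padl X m r (z : 'End(tpow X r)) : 'End(tpow X (m + r)) :=
  if m is m'.+1 return 'End(tpow X (m + r)) then tmap \1 (padl m' z) else z.
Fixpoint padlr X W m r (z : 'End(btens (tpow X r) W)) :
    'End(btens (tpow X (m + r)) W) :=
  if m is m'.+1 return 'End(btens (tpow X (m + r)) W) then
    assocV X (tpow X (m' + r)) W \o tmap \1 (padlr m' z) \o
      assoc X (tpow X (m' + r)) W
  else z.

Fixpoint tsplit X j r : 'Hom(tpow X (j + r), btens (tpow X j) (tpow X r)) :=
  if j is j'.+1 return 'Hom(tpow X (j + r), btens (tpow X j) (tpow X r)) then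
    assocV X (tpow X j') (tpow X r) \o tmap \1 (tsplit X j' r)
  else unitlV (tpow X r).
Fixpoint tjoin X j r : 'Hom(btens (tpow X j) (tpow X r), tpow X (j + r)) :=
  if j is j'.+1 return 'Hom(btens (tpow X j) (tpow X r), tpow X (j + r)) then
    tmap \1 (tjoin X j' r) \o assoc X (tpow X j') (tpow X r)
  else unitl (tpow X r).

(* z on the first two factors of X^{r+2}. *)
Definition first2 X r (z : 'End(btens X X)) : 'End(tpow X r.+2) :=
  assoc X X (tpow X r) \o tmap z \1 \o assocV X X (tpow X r).

Definition z_t k' (W : bimod A) : 'End(btens (tpow K k'.+1) W) :=
  assocV K (tpow K k') W \o
  (QK (btens (tpow K k') W) \o tmap TK (twist (btens (tpow K k') W))) \o
  assoc K (tpow K k') W.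

Definition Psi g j r (phi : 'Hom(tpow K g, tpow F (j + r)))
    (z : 'End(btens (tpow K g) (ldual (tpow F r)))) :
    'Hom(btens (tpow K g) (ldual (tpow F r)), tpow F j) :=
  unitr (tpow F j) \o tmap \1 (lev (tpow F r)) \o
  assoc (tpow F j) (tpow F r) (ldual (tpow F r)) \o
  tmap (tsplit F j r \o phi) \1 \o z.

Definition act_t g j r (phi : 'Hom(tpow K g, tpow F (j + r)))
    (z : 'End(btens (tpow K g) (ldual (tpow F r)))) :
    'Hom(tpow K g, tpow F (j + r)) :=
  tjoin F j r \o tmap (Psi phi z) \1 \o
  assocV (tpow K g) (ldual (tpow F r)) (tpow F r) \o
  tmap \1 (lcoev (tpow F r)) \o unitrV (tpow K g).

(* The generators of the mapping class group of the surface of genus g with n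
   boundary circles.  The ranges of the positions are encoded in the indices:
   - omega_{i+1} and theta_{i+1} exist for n = i + r + 2 and n = i + r + 1;
   - S_{l+1}, d_{l+1}, b_{l+1} exist for g = m + l + 1;
   - a_{l+2}, e_{l+2} exist for g = m + l + 2;
   - t_{j+1,l+1} exists for g = m + l + 1 and n = (j + 1) + (r + 1). *)
Inductive mcg_gen : nat -> nat -> Type :=
| gen_omega g i r : mcg_gen g (i + r.+2)
| gen_theta g i r : mcg_gen g (i + r.+1)
| gen_S n m l : mcg_gen (m + l.+1) n
| gen_d n m l : mcg_gen (m + l.+1) n
| gen_b n m l : mcg_gen (m + l.+1) n
| gen_a n m l : mcg_gen (m + l.+2) n
| gen_e n m l : mcg_gen (m + l.+2) n
| gen_t m l j r : mcg_gen (m + l.+1) (j.+1 + r.+1).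

Definition mcg_act g n (gamma : mcg_gen g n) :
    'Hom(tpow K g, tpow F n) -> 'Hom(tpow K g, tpow F n) :=
  match gamma with
  | gen_omega g i r => fun phi => padl i (first2 r (braid F F)) \o phi
  | gen_theta g i r => fun phi =>
      padl i (tmap (twist F) \1 : 'End(tpow F r.+1)) \o phi
  | gen_S n m l => fun phi => phi \o padl m (tmap SK \1 : 'End(tpow K l.+1))
  | gen_d n m l => fun phi => phi \o padl m (tmap TK \1 : 'End(tpow K l.+1))
  | gen_b n m l => fun phi =>
      phi \o padl m (tmap ((SK^-1)%VF \o TK \o SK) \1 : 'End(tpow K l.+1))
  | gen_a n m l => fun phi => phi \o padl m (first2 l (OK \o tmap TK TK))
  | gen_e n m l => fun phi =>
      phi \o padl m (tmap TK (twist (tpow K l.+1)) \o QK (tpow K l.+1)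
                       : 'End(tpow K l.+2))
  | gen_t m l j r => fun phi =>
      act_t phi (padlr m (z_t l (ldual (tpow F r.+1))))
  end.

(* The definitions of K, Q^K, T_K and O_K agree with their characterizations
   through the dinatural family iota, which is jointly epimorphic. *)

Lemma iotaE X (xi : dual X) (x : X) (y z : A) :
  teval (iota X (xi \ox x) : tens (dual A) (dual A)) y z = xi (lact X y (ract X z x)).
Proof.
pose b (xi : dual X) (x : X) (y z : A) : k^o := xi (lact X y (ract X z x)).
have bb xi' x' : bilin (b xi' x').
  split=> w c w1 w2; rewrite /b.
    by rewrite lact_lin add_lfunE scale_lfunE linearP.
  by rewrite ract_lin add_lfunE scale_lfunE linearP linearP.
rewrite /iota tliftE tsumE; first exact: (tformE (bb xi x)).
split=> [x'|xi'] c u1 u2; apply: teval_inj => y' z'.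
  rewrite (tformE (bb _ _)) /teval lin_suml -!/(teval _ _ _) !(tformE (bb _ _)).
  by rewrite /b add_lfunE scale_lfunE.
rewrite (tformE (bb _ _)) /teval lin_suml -!/(teval _ _ _) !(tformE (bb _ _)).
by rewrite /b !linearP.
Qed.

Lemma teval_tr (f g : 'End(A)) (t : tens (dual A) (dual A)) y z :
  teval (tmap (tr f) (tr g) t) y z = teval t (f y) (g z).
Proof.
have lt y' z' : linear (fun t : tens (dual A) (dual A) => teval t y' z').
  by rewrite /teval; lin.
apply: (tens_ext (f := fun t => teval (tmap (tr f) (tr g) t) y z)
  (g := fun t => teval t (f y) (g z))) t => [||xi zeta] //.
  by move=> c s t; rewrite linearP lt.
by rewrite tmapE !tevalE !trE !comp_lfunE.
Qed.

Lemma lractCE X a b (x : X) : lact X a (ract X b x) = ract X b (lact X a x).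
Proof. by rewrite -comp_lfunE lractC comp_lfunE. Qed.

Lemma iota_act X (xi : dual X) (x : X) a b :
  tmap (pmr a) (pml b) (iota X (xi \ox x)) = iota X (xi \ox lact X a (ract X b x)).
Proof.
apply: teval_inj => y z; rewrite teval_tr !iotaE amulrE amullE lactM ractM.
by rewrite !comp_lfunE !lractCE.
Qed.

Lemma flip_lact2 X Y t :
  tflip Y X \o lact2 Y X t = lact2 X Y (tflip A A t) \o tflip Y X.
Proof.
apply: (tens_ext (f := fun t => tflip Y X \o lact2 Y X t)
  (g := fun t => lact2 X Y (tflip A A t) \o tflip Y X)) t => [||a b].
- by apply: lin_compl; apply: lact2_lin.
- by move=> c s t; rewrite linearP lact2_lin comp_lfunDl -comp_lfunZl.
apply: hom_tens_ext => y x.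
by rewrite !comp_lfunE !tflipE !lact2E !tmapE tflipE.
Qed.
Lemma flip_ract2 X Y t :
  tflip Y X \o ract2 Y X t = ract2 X Y (tflip A A t) \o tflip Y X.
Proof.
apply: (tens_ext (f := fun t => tflip Y X \o ract2 Y X t)
  (g := fun t => ract2 X Y (tflip A A t) \o tflip Y X)) t => [||a b].
- by apply: lin_compl; apply: ract2_lin.
- by move=> c s t; rewrite linearP ract2_lin comp_lfunDl -comp_lfunZl.
apply: hom_tens_ext => y x.
by rewrite !comp_lfunE !tflipE !ract2E !tmapE tflipE.
Qed.

Lemma braid_braid X Y :
  braid Y X \o braid X Y = lact2 X Y Qi \o ract2 X Y Q.
Proof.
rewrite /braid lact2M ract2M; apply/lfunP => t; rewrite !comp_lfunE.
rewrite -[tflip Y X _]comp_lfunE flip_lact2 comp_lfunE.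
rewrite -[tflip Y X _]comp_lfunE flip_ract2 comp_lfunE.
rewrite -[ract2 X Y R _]comp_lfunE -lract2C comp_lfunE.
congr (lact2 X Y _ (lact2 X Y _ (ract2 X Y _ (ract2 X Y _ _)))).
have -> : tflip Y X (tflip X Y t) = (tflip Y X \o tflip X Y) t by rewrite comp_lfunE.
suff -> : tflip Y X \o tflip X Y = \1 by rewrite id_lfunE.
by apply: hom_tens_ext => x y; rewrite comp_lfunE !tflipE id_lfunE.
Qed.

Lemma QK_iota X Y :
  QK Y \o tmap (iota X) \1 =
  tmap (iota X) \1 \o assocV (rdual X) X Y \o
    tmap \1 (braid Y X \o braid X Y) \o assoc (rdual X) X Y.
Proof.
rewrite braid_braid /QK.
pose l t : 'End(tens K Y) := tsum t (fun p1 p2 => tmap (tmap (pmr p1) \1) (lact Y p2)).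
pose r t : 'End(tens K Y) := tsum t (fun q1 q2 => tmap (tmap \1 (pml q1)) (ract Y q2)).
suff H s t : (l s \o r t) \o tmap (iota X) \1 =
    tmap (iota X) \1 \o assocV (rdual X) X Y \o
      tmap \1 (lact2 X Y s \o ract2 X Y t) \o assoc (rdual X) X Y by exact: H.
have lin_pmr : linear pmr by apply: lin_tr => c x y; rewrite linearP.
have lin_pml : linear pml by apply: lin_tr => c x y; rewrite linearP.
have bl : bilin (fun p1 p2 => tmap (tmap (pmr p1) \1) (lact Y p2)).
  by split=> *; lin2.
have br : bilin (fun q1 q2 => tmap (tmap \1 (pml q1)) (ract Y q2)).
  by split=> *; lin2.
apply: (tens_ext (f := fun s => (l s \o r t) \o tmap (iota X) \1)
  (g := fun s => tmap (iota X) \1 \o assocV (rdual X) X Y \o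
      tmap \1 (lact2 X Y s \o ract2 X Y t) \o assoc (rdual X) X Y)) s => [||a b].
- by do 2!apply: lin_compr; exact: lin_suml.
- by apply: lin_compr; apply: lin_compl; apply: lin_tmapr; apply: lin_compr; apply: lact2_lin.
apply: (tens_ext (f := fun t => (l (a \ox b) \o r t) \o tmap (iota X) \1)
  (g := fun t => tmap (iota X) \1 \o assocV (rdual X) X Y \o
      tmap \1 (lact2 X Y (a \ox b) \o ract2 X Y t) \o assoc (rdual X) X Y)) t => [||c d].
- by apply: lin_compr; apply: lin_compl; exact: lin_suml.
- by apply: lin_compr; apply: lin_compl; apply: lin_tmapr; apply: lin_compl; apply: ract2_lin.
rewrite /l /r !tsumE // lact2E ract2E -tmap_comp -[in LHS]tmap_comp.
apply: hom_tens_ext => xx y; move: xx.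
apply: tens_ext; try by lin.
move=> xi x; rewrite !comp_lfunE assocE !tmapE assocVE tmapE.
by rewrite !id_lfunE -tmap_comp comp_lfun1l comp_lfun1r iota_act !comp_lfunE.
Qed.

Lemma antiVv : Si (v^-1)%R = (v^-1)%R.
Proof.
have [vU _ Sv _ _] := fr_ribbon A.
have e : S (v^-1)%R = (v^-1)%R.
  apply: (mulIr vU); rewrite mulVr // -{2}Sv -antiM mulrV //; exact: anti1.
by rewrite -{1}e antiK.
Qed.

Lemma TK_iota X : TK \o iota X = iota X \o tmap (twist (rdual X)) \1.
Proof.
have [_ vC Sv _ _] := fr_ribbon A.
apply: hom_tens_ext => xi x; rewrite !comp_lfunE tmapE.
apply: teval_inj => y z; rewrite teval_tr !iotaE amulrE amullE id_lfunE.
rewrite /twist comp_lfunE !trE !comp_lfunE antiVv Sv lactM ractM !comp_lfunE.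
by rewrite !lractCE.
Qed.

(* id (x) m (x) id on (U (x) V) (x) (W (x) Z). *)
Definition mid4 (U V W Z : vectType k) (m : 'End(tens V W)) :
    'End(tens (tens U V) (tens W Z)) :=
  assocV U V (tens W Z) \o
  tmap \1 (assoc V W Z \o tmap m \1 \o assocV V W Z) \o
  assoc U V (tens W Z).

Lemma OK_iota X Y :
  OK \o tmap (iota X) (iota Y) =
  tmap (iota X) (iota Y) \o
    mid4 (rdual X) Y (braid (rdual Y) X \o braid X (rdual Y)).
Proof.
rewrite braid_braid /OK.
pose Kt : vectType k := tens (dual A) (dual A).
pose fl p1 p2 : 'End(tens Kt Kt) := tmap (tmap (pmr p1) \1) (tmap (pml (S p2)) \1).
pose fr q1 q2 : 'End(tens Kt Kt) := tmap (tmap \1 (pml q1)) (tmap \1 (pmr (Si q2))).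
pose m4 s t := mid4 (rdual X) Y (lact2 X (rdual Y) s \o ract2 X (rdual Y) t).
suff H s t : (tsum s fl \o tsum t fr) \o tmap (iota X) (iota Y) =
    tmap (iota X) (iota Y) \o m4 s t by exact: H.
have lin_pmr (U : vectType k) (h : U -> A) : linear h -> linear (fun x => pmr (h x)).
  by move=> lh; apply: lin_tr => c x y; rewrite lh linearP.
have lin_pml (U : vectType k) (h : U -> A) : linear h -> linear (fun x => pml (h x)).
  by move=> lh; apply: lin_tr => c x y; rewrite lh linearP.
have bl : bilin fl.
  by split=> w; do ?[apply: lin_tmapl | apply: lin_tmapr]; do ?[apply: lin_pmr|apply: lin_pml]; lin.
have br : bilin fr.
  by split=> w; do ?[apply: lin_tmapl | apply: lin_tmapr]; do ?[apply: lin_pmr|apply: lin_pml]; lin.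
have lm (h : tens A A -> 'End(tens X (rdual Y))) :
    linear h -> linear (fun s => mid4 (rdual X) Y (h s)).
  move=> lh; rewrite /mid4; apply: lin_compr; apply: lin_compl.
  by apply: lin_tmapr; apply: lin_compr; apply: lin_compl; apply: lin_tmapl.
apply: (tens_ext (f := fun s => (tsum s fl \o tsum t fr) \o tmap (iota X) (iota Y))
  (g := fun s => tmap (iota X) (iota Y) \o m4 s t)) s => [||a b].
- by do 2!apply: lin_compr; exact: lin_suml.
- by apply: lin_compl; apply: lm; apply: lin_compr; apply: lact2_lin.
apply: (tens_ext
  (f := fun t => (tsum (a \ox b) fl \o tsum t fr) \o tmap (iota X) (iota Y))
  (g := fun t => tmap (iota X) (iota Y) \o m4 (a \ox b) t)) t => [||c d].
- by apply: lin_compr; apply: lin_compl; exact: lin_suml.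
- by apply: lin_compl; apply: lm; apply: lin_compl; apply: ract2_lin.
rewrite /m4 !tsumE // lact2E ract2E /fl /fr -!tmap_comp.
rewrite !comp_lfun1l !comp_lfun1r.
apply: hom_tens_ext => xx yy; move: xx.
apply: tens_ext; try by lin.
move=> xi x; move: yy; apply: tens_ext; try by lin.
move=> zeta y; rewrite /mid4 !comp_lfunE assocE !tmapE.
rewrite !comp_lfunE assocVE !tmapE assocE assocVE !tmapE.
rewrite !id_lfunE iota_act !comp_lfunE; congr (_ \ox _).
apply: teval_inj => y' z'; rewrite teval_tr !iotaE amulrE amullE lactM ractM.
rewrite !comp_lfunE !trE !comp_lfunE.
by rewrite !lractCE.
Qed.

Fact free1 (f : A -> 'End(A)) : f 1 = \1 ->
  tmap (f 1) \1 = \1 :> 'End(tens A A) /\ tmap \1 (f 1) = \1 :> 'End(tens A A).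
Proof. by move=> ->; rewrite tmap1. Qed.
Fact free_lactM a b :
  tmap (amull (a * b)) \1 = tmap (amull a) \1 \o tmap (amull b) \1 :> 'End(tens A A).
Proof. by rewrite -tmap_comp amullM' comp_lfun1l. Qed.
Fact free_ractM a b :
  tmap \1 (amulr (a * b)) = tmap \1 (amulr b) \o tmap \1 (amulr a) :> 'End(tens A A).
Proof. by rewrite -tmap_comp amulrM' comp_lfun1l. Qed.
Fact free_lractC a b :
  tmap (amull a) \1 \o tmap \1 (amulr b) =
  tmap \1 (amulr b) \o tmap (amull a) \1 :> 'End(tens A A).
Proof. by rewrite -!tmap_comp !comp_lfun1l !comp_lfun1r. Qed.

(* The free bimodule of rank one. *)
Definition bfree : bimod A :=
  Bimod (lin_tmapl _ (@linearP _ _ _ _ (@amull k A)))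
    (lin_tmapr _ (@linearP _ _ _ _ (@amulr k A)))
    (proj1 (free1 (proj1 (regular1 A)))) (proj2 (free1 (proj2 (regular1 A))))
    free_lactM free_ractM free_lractC.

Lemma iota_epi W (f g : 'Hom(K, W)) :
  (forall X, f \o iota X = g \o iota X) -> f = g.
Proof.
move=> e; apply/lfunP => t.
pose xi : dual bfree := linfun (fun s : tens A A => tsum s (teval t)).
suff <- : iota bfree (xi \ox (1 \ox 1 : tens A A)) = t.
  by rewrite -!comp_lfunE e.
apply: teval_inj => y z; rewrite iotaE !tmapE amullE amulrE !id_lfunE mulr1 mul1r.
rewrite /xi linfunE'; last by lin.
by rewrite tsumE // /teval; lin.
Qed.

Lemma SKE (f g : dual A) (y z : A) :
  teval (SK (f \ox g) : tens (dual A) (dual A)) y z =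
  tsum Qi (fun p1 p2 => (f p1 : k^o) * lam (S p2 * y)) *
  tsum Q (fun q1 q2 => (g q1 : k^o) * lam (z * Si q2)).
Proof.
have app (U V : vectType k) t (b : A -> A -> 'Hom(U, V)) (x : U) :
    tsum t b x = tsum t (fun p q => b p q x).
  by apply: (lin_of_tsum (f := fun h : 'Hom(U, V) => h x)); lin.
have lt : linear (fun t : tens (dual A) (dual A) => teval t y z).
  by rewrite /teval; lin.
rewrite /SK !comp_lfunE unitrVE tmapE id_lfunE /LambdaK pointE scale1r.
rewrite !app !hom_tsum (lin_of_tsum _ _ lt).
rewrite (lin_of_tsum (f := fun c : k^o => c * _)); last by lin.
apply: eq_tsum => p1 p2; rewrite !hom_tsum (lin_of_tsum _ _ lt).
rewrite (lin_of_tsum (f := fun c : k^o => f p1 * lam (S p2 * y) * c)); last by lin.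
apply: eq_tsum => q1 q2; rewrite !tmapE !id_lfunE unitlE.
rewrite (linZ _ _ lt) tevalE !trE !comp_lfunE !amullE !amulrE.
rewrite /epsK tliftE tsumE; last by lin.
rewrite !comp_lfunE amullE amulrE mul1r mulr1.
by rewrite [LHS]mulrACA.
Qed.
End Category.

(* Main.v *)
(* The handle morphism multiplies by chi : K -> F, so that Cor_{g;n} is Delta_F^(n)
   applied to the g-fold product of chi with itself.  By the quantum trace property
   lam(yz) = lam(z S^-2(y)), both f_Q and f_{Q^-1} send lam to the integral L; expanding
   the coproduct of L = f_{Q^-1}(lam) with the hexagon axioms then gives
     chi(f (x) g)(x) = f(L_1 S^-1(x_1)) g(S(L_2) x_2),
   which amounts to chi S_K = chi.  In this form every remaining generator acts by
   moving elements through L_1 (x) L_2: the ribbon element cancels for T_K, and Q cancels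
   against Q^-1 for Q^K and O_K.  For t_{j,k} the Frobenius form first turns the last
   outputs into one more F-valued input, which reduces the claim to Q^K.  The braiding
   is absorbed because F is cocommutative; this comes down to
   L_1 lam(L_2) = S(u)^-1 u for the Drinfeld element u.  The twist of F is trivial. *)
Require Import Defs.
From mathcomp Require Import all_boot all_order all_algebra all_field.

Set Implicit Arguments.
Unset Strict Implicit.
Unset Printing Implicit Defensive.

Import GRing.Theory.
Local Open Scope ring_scope.
Local Open Scope lfun_scope.

(** The invariance under S_K comes from two expressions of one functional. Unfolding the handle
    morphism gives chi(f (x) g)(x) = lam(S(x_1) S(p_2) x_2 S^-1(q_2)) f(p_1) g(q_1). On the other
    hand Delta(L) is the copairing of the form lam(S(x) y), so inserting S_K into the L-form of chi
    contracts L against a cointegral of S_K and returns this same expression. The bridge is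
    [monodromy_pairing], which writes L_1 (x) S(L_2) through Q^-1 and Q; it also yields an explicit
    left inverse of S_K, needed because b_k involves S_K^-1. The operators for e_l and t_{j,k}
    contain Q^K_Y and theta_Y for large Y and are not computed on elements. Everything that follows
    the encircled handle is gathered into one bimodule morphism from Y to F, and naturality reduces
    the claim to Y = F. This is why chi, m_F and Delta_F are shown to be bimodule morphisms. For a_l
    the operator O_K reaches into both legs of the second handle, which takes a computation of its
    own. *)

Notation "'\tsum_' ( a , b '<-' t ) e" := (tsum t (fun a b => e))
  (at level 41, a name, b name, t at level 40, e at level 41).

(** * Linearity in each argument of generic functions *)

Section Multilinear.
Variable k : fieldType.
Implicit Types U V W X Y Z : vectType k.

Definition trilin U V W X (T : U -> V -> W -> X) : Prop :=
  [/\ forall v w, linear (fun u => T u v w),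
      forall u w, linear (fun v => T u v w) & forall u v, linear (T u v)].

Lemma lin_bilinl U V W Z (F : U -> V -> W) (h : Z -> U) v :
  bilin F -> linear h -> linear (fun z => F (h z) v).
Proof. by move=> [lF _] lh a x y; rewrite lh lF. Qed.

Lemma lin_bilinr U V W Z (F : U -> V -> W) (h : Z -> V) u :
  bilin F -> linear h -> linear (fun z => F u (h z)).
Proof. by move=> [_ lF] lh a x y; rewrite lh lF. Qed.

Lemma lin_trilin1 U V W X Z (T : U -> V -> W -> X) (h : Z -> U) v w :
  trilin T -> linear h -> linear (fun z => T (h z) v w).
Proof. by move=> [lT _ _] lh a x y; rewrite lh lT. Qed.

Lemma lin_trilin2 U V W X Z (T : U -> V -> W -> X) (h : Z -> V) u w :
  trilin T -> linear h -> linear (fun z => T u (h z) w).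
Proof. by move=> [_ lT _] lh a x y; rewrite lh lT. Qed.

Lemma lin_trilin3 U V W X Z (T : U -> V -> W -> X) (h : Z -> W) u v :
  trilin T -> linear h -> linear (fun z => T u v (h z)).
Proof. by move=> [_ _ lT] lh a x y; rewrite lh lT. Qed.

Lemma lin_comp U V W (f : V -> W) (h : U -> V) :
  linear f -> linear h -> linear (fun x => f (h x)).
Proof. by move=> lf lh a x y; rewrite lh lf. Qed.
End Multilinear.

Lemma lin_tmull (k : fieldType) (A : falgType k) (U : vectType k) (f : U -> tens A A) t :
  linear f -> linear (fun x => tmul (f x) t).
Proof. exact: (lin_comp (tmul_linl t)). Qed.
Lemma lin_tmulr (k : fieldType) (A : falgType k) (U : vectType k) (f : U -> tens A A) t :
  linear f -> linear (fun x => tmul t (f x)).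
Proof. exact: (lin_comp (tmul_linr t)). Qed.

(** A [tsum] is meaningful only for a bilinear summand, so almost every rewriting leaves linearity
    goals. Besides the concrete operations known to [lin_step], hypotheses on generic bilinear or
    trilinear summands are used here. *)
Ltac mlin_step :=
  match goal with
  | |- trilin _ => split
  | H : bilin ?F |- linear (fun z => ?F _ ?v) => apply: (lin_bilinl v H)
  | H : bilin ?F |- linear (fun z => ?F ?u _) => apply: (lin_bilinr u H)
  | H : trilin ?F |- linear (fun z => ?F _ ?v ?w) => apply: (lin_trilin1 v w H)
  | H : trilin ?F |- linear (fun z => ?F ?u _ ?w) => apply: (lin_trilin2 u w H)
  | H : trilin ?F |- linear (fun z => ?F ?u ?v _) => apply: (lin_trilin3 u v H)
  | H : linear ?f |- linear (fun z => ?f _) => apply: (lin_comp H)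
  | H : linear ?f |- linear ?f => exact: H
  | |- linear (fun z => tmul _ ?t) => apply: lin_tmull
  | |- linear (fun z => tmul ?t _) => apply: lin_tmulr
  | H : bilin ?F |- bilin ?F => exact: H
  | H : trilin ?F |- trilin ?F => exact: H
  end.
Ltac mlin := repeat first [mlin_step | lin_step].

(** * The componentwise product on A (x) A and sums over it *)

Section TensorAlgebra.
Variables (k : fieldType) (A : falgType k).
Implicit Types (r s t : tens A A) (W : vectType k).

Lemma tmulA r s t : tmul r (tmul s t) = tmul (tmul r s) t.
Proof.
apply: (tens_ext (f := fun r => tmul r (tmul s t))
  (g := fun r => tmul (tmul r s) t)) r => [||a b].
- exact: tmul_linl.
- by do 2!apply: lin_tmull.
apply: (tens_ext (f := fun s => tmul _ (tmul s t))
  (g := fun s => tmul (tmul _ s) t)) s => [||c d].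
- by apply: lin_tmulr; apply: lin_tmull.
- by apply: lin_tmull; apply: lin_tmulr.
apply: (tens_ext (f := fun t => tmul _ (tmul _ t))
  (g := fun t => tmul (tmul _ _) t)) t => [||e f].
- by do 2!apply: lin_tmulr.
- exact: tmul_linr.
by rewrite !tmulE !mulrA.
Qed.

Lemma tmul1l t : tmul (1 \ox 1) t = t.
Proof.
apply: (tens_ext (f := tmul (1 \ox 1)) (g := id)) t => [||a b] //.
- exact: tmul_linr.
- by rewrite tmulE !mul1r.
Qed.

Lemma tmul1r t : tmul t (1 \ox 1) = t.
Proof.
apply: (tens_ext (f := fun t => tmul t (1 \ox 1)) (g := id)) t => [||a b] //.
- exact: tmul_linl.
- by rewrite tmulE !mulr1.
Qed.

Lemma tflip_tmul s t : tflip A A (tmul s t) = tmul (tflip A A s) (tflip A A t).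
Proof.
apply: (tens_ext (f := fun s => tflip A A (tmul s t))
  (g := fun s => tmul (tflip A A s) (tflip A A t))) s => [||a b].
- by apply: lin_hom; apply: lin_tmull.
- by apply: lin_tmull; lin.
apply: (tens_ext (f := fun t => tflip A A (tmul _ t))
  (g := fun t => tmul _ (tflip A A t))) t => [||c d].
- by apply: lin_hom; apply: lin_tmulr.
- by apply: lin_tmulr; lin.
by rewrite tmulE !tflipE tmulE.
Qed.

Lemma tsum_tflip (U V : vectType k) W (t : tens U V) (F : V -> U -> W) : bilin F ->
  tsum (tflip U V t) F = \tsum_(a, b <- t) F b a.
Proof.
move=> bF; rewrite tliftE (lin_of_tsum _ _ (lin_suml F)); apply: eq_tsum => a b.
exact: tsumE.
Qed.

Lemma tsum_tmul W s t (F : A -> A -> W) : bilin F ->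
  tsum (tmul s t) F = \tsum_(a, b <- s) \tsum_(c, d <- t) F (a * c) (b * d).
Proof.
move=> bF; rewrite /tmul (lin_of_tsum _ _ (lin_suml F)); apply: eq_tsum => a b.
rewrite (lin_of_tsum _ _ (lin_suml F)); apply: eq_tsum => c d; exact: tsumE.
Qed.

Lemma tsum_tmap (U V U' V' : vectType k) W (f : 'Hom(U, U')) (g : 'Hom(V, V'))
    (t : tens U V) (F : U' -> V' -> W) : bilin F ->
  tsum (tmap f g t) F = \tsum_(a, b <- t) F (f a) (g b).
Proof.
move=> bF; rewrite tliftE (lin_of_tsum _ _ (lin_suml F)); apply: eq_tsum => a b.
exact: tsumE.
Qed.
End TensorAlgebra.

(** * The antipode against the counit and the coproduct *)

Section Hopf.
Variables (k : fieldType) (H : hopfAlg k).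
Local Notation Delta := (copr H).
Local Notation eps := (cou H).
Local Notation S := (anti H).
Implicit Types (a b h x y : H) (W : vectType k).

Lemma coassoc3 W (T : H -> H -> H -> W) h : trilin T ->
  \tsum_(a, b <- Delta h) \tsum_(a1, a2 <- Delta a) T a1 a2 b =
  \tsum_(a, b <- Delta h) \tsum_(b1, b2 <- Delta b) T a b1 b2.
Proof. by move=> [l1 l2 l3]; apply: coassoc_sum. Qed.

Lemma antil_sum W (f : H -> W) h : linear f ->
  \tsum_(h1, h2 <- Delta h) f (S h1 * h2) = (eps h : k) *: f 1.
Proof. by move=> lf; rewrite -(lin_of_tsum _ _ lf) antil (linZ _ _ lf). Qed.

Lemma antir_sum W (f : H -> W) h : linear f ->
  \tsum_(h1, h2 <- Delta h) f (h1 * S h2) = (eps h : k) *: f 1.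
Proof. by move=> lf; rewrite -(lin_of_tsum _ _ lf) antir (linZ _ _ lf). Qed.

(** The counit, being multiplicative, is applied to S(h_1) h_2 = eps(h) 1. *)
Lemma cou_anti h : eps (S h) = eps h.
Proof.
have <- : \tsum_(h1, h2 <- Delta h) eps (S h1 * h2) = eps h.
  rewrite (antil_sum (f := fun x => eps x)); last by lin.
  by rewrite cou1; apply: mulr1.
rewrite -{1}(cour h) !hom_tsum; apply: eq_tsum => h1 h2.
by rewrite !linearZ couM mulrC.
Qed.

(* [Delta o S] and [x |-> S x_2 (x) S x_1] are both convolution inverse to Delta. *)
Lemma copr_anti h : Delta (S h) = \tsum_(a, b <- Delta h) (S b \ox S a).
Proof.
pose G x : tens H H := \tsum_(a, b <- Delta x) (S b \ox S a).
have lG : linear G by rewrite /G; lin.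
have inv x : \tsum_(a, b <- Delta x) tmul (Delta a) (G b) = (eps x : k) *: (1 \ox 1).
  transitivity (\tsum_(a, d <- Delta x) \tsum_(b, c <- Delta a)
      \tsum_(d1, d2 <- Delta d) ((b * S d2) \ox (c * S d1))).
    apply: eq_tsum => a d; rewrite /G.
    rewrite -{1}(tens_sum (Delta a)) (lin_of_tsum _ _ (tmul_linl _)).
    apply: eq_tsum => b c; rewrite (lin_of_tsum _ _ (tmul_linr _)).
    by apply: eq_tsum => d1 d2; rewrite tmulE.
  rewrite (coassoc3 (T := fun b c d =>
    \tsum_(d1, d2 <- Delta d) ((b * S d2) \ox (c * S d1)))); last by mlin.
  transitivity (\tsum_(b, d <- Delta x) ((b * S d) \ox (1 : H))); last first.
    by rewrite (antir_sum (f := fun y : H => y \ox (1 : H))) //; lin.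
  apply: eq_tsum => b d.
  rewrite -(coassoc3 (T := fun c d1 d2 => (b * S d2) \ox (c * S d1))); last by mlin.
  rewrite -[RHS](coul_sum (f := fun y => (b * S y) \ox (1 : H))); last by lin.
  apply: eq_tsum => c d2.
  by rewrite (antir_sum (f := fun y : H => (b * S d2) \ox y)) //; lin.
(* The counit in S(h) = S(h_1) eps(h_2) is expanded by [inv], which gives Delta(S(h_1)) Delta(h_2)
   G(h_3); the first two factors then collapse. *)
transitivity (\tsum_(a, b <- Delta h) tmul (Delta (S a))
   (\tsum_(c, d <- Delta b) tmul (Delta c) (G d))).
  rewrite -[LHS](cour_sum (f := fun y => Delta (S y))); last by lin.
  apply: eq_tsum => a b; rewrite inv (linZ _ _ (tmul_linr _)).
  by rewrite tmul1r.
transitivity (\tsum_(a, b <- Delta h) \tsum_(c, d <- Delta b)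
   tmul (Delta (S a * c)) (G d)).
  apply: eq_tsum => a b; rewrite (lin_of_tsum _ _ (tmul_linr _)).
  by apply: eq_tsum => c d; rewrite tmulA coprM.
rewrite -(coassoc3 (T := fun a c d => tmul (Delta (S a * c)) (G d))); last by mlin.
rewrite -[RHS](coul_sum (f := G)) //; apply: eq_tsum => a d.
rewrite (antil_sum (f := fun y : H => tmul (Delta y) (G d))); last first.
  by apply: lin_tmull; lin.
by rewrite copr1 tmul1l.
Qed.

Lemma tsum_copr_anti W (F : H -> H -> W) h : bilin F ->
  tsum (Delta (S h)) F = \tsum_(a, b <- Delta h) F (S b) (S a).
Proof.
move=> bF; rewrite copr_anti (lin_of_tsum _ _ (lin_suml F)).
by apply: eq_tsum => a b; rewrite tsumE.
Qed.
End Hopf.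

(** * Integral, cointegral and the Frobenius form lam(S(x) y) *)

Section Integrals.
Variables (k : fieldType) (A : frHopf k).
Local Notation Delta := (copr A).
Local Notation eps := (cou A).
Local Notation S := (anti A).
Local Notation Si := (antiV A).
Local Notation L := (integral A).
Local Notation lam := (cointegral A).
Implicit Types (a b h x y z : A) (W : vectType k).

Lemma tsum_copr_antiV W (F : A -> A -> W) h : bilin F ->
  tsum (Delta (Si h)) F = \tsum_(a, b <- Delta h) F (Si b) (Si a).
Proof.
move=> bF; rewrite -{2}(antiVK h) tsum_copr_anti; last by mlin.
by apply: eq_tsum => a b; rewrite !antiK.
Qed.

Lemma antiVl_sum W (f : A -> W) h : linear f ->
  \tsum_(h1, h2 <- Delta h) f (Si h2 * h1) = (eps h : k) *: f 1.
Proof.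
move=> lf; rewrite -(antiV1 A) -(antil_sum (f := fun x => f (Si x))); last by mlin.
by apply: eq_tsum => a b; rewrite antiVM antiK.
Qed.

Lemma antiVr_sum W (f : A -> W) h : linear f ->
  \tsum_(h1, h2 <- Delta h) f (h2 * Si h1) = (eps h : k) *: f 1.
Proof.
move=> lf; rewrite -(antiV1 A) -(antir_sum (f := fun x => f (Si x))); last by mlin.
by apply: eq_tsum => a b; rewrite antiVM antiK.
Qed.

Lemma cou_antiV h : eps (Si h) = eps h.
Proof. by rewrite -[in RHS](antiVK h) cou_anti. Qed.

Lemma integral_copr_l W (F : A -> A -> W) h : bilin F ->
  \tsum_(a, b <- Delta h) \tsum_(l1, l2 <- Delta L) F (a * l1) (b * l2) =
  (eps h : k) *: tsum (Delta L) F.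
Proof.
move=> bF; rewrite -coprM_sum // (integral_l (fr_int A)) linearZ.
exact: (linZ _ _ (lin_suml F)).
Qed.

Lemma integral_copr_r W (F : A -> A -> W) h : bilin F ->
  \tsum_(a, b <- Delta h) \tsum_(l1, l2 <- Delta L) F (l1 * a) (l2 * b) =
  (eps h : k) *: tsum (Delta L) F.
Proof.
move=> bF; rewrite exchange_tsum -coprM_sum // (integral_r (fr_int A)) linearZ.
exact: (linZ _ _ (lin_suml F)).
Qed.

(** Inserting S^-1(h_3) h_2 before L_2 makes h act on Delta(L) through its coproduct, and h L =
    eps(h) L absorbs it. *)
Lemma integral_slidel W (F : A -> A -> W) h : bilin F ->
  \tsum_(l1, l2 <- Delta L) F (h * l1) l2 =
  \tsum_(l1, l2 <- Delta L) F l1 (Si h * l2).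
Proof.
move=> bF.
rewrite -[RHS](coul_sum (f := fun x => \tsum_(l1, l2 <- Delta L) F l1 (Si x * l2)));
  last by mlin.
rewrite -[LHS](cour_sum (f := fun x => \tsum_(l1, l2 <- Delta L) F (x * l1) l2));
  last by mlin.
transitivity (\tsum_(a, b <- Delta h) \tsum_(a1, a2 <- Delta a)
    \tsum_(l1, l2 <- Delta L) F (a1 * l1) (Si b * (a2 * l2))); last first.
  by apply: eq_tsum => a b; apply: (integral_copr_l (F := fun x y => F x (Si b * y))); mlin.
rewrite (coassoc3 (T := fun a1 a2 b => \tsum_(l1, l2 <- Delta L)
    F (a1 * l1) (Si b * (a2 * l2)))); last by mlin.
apply: eq_tsum => a b; rewrite exchange_tsum (lin_of_tsum _ _ (@lin_scaler _ _ _ _ id _)) //.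
apply: eq_tsum => l1 l2.
rewrite -[in LHS](mul1r l2) -(antiVl_sum (f := fun x => F (a * l1) (x * l2))); last by mlin.
by apply: eq_tsum => b1 b2; rewrite mulrA.
Qed.

Lemma integral_slider W (F : A -> A -> W) h : bilin F ->
  \tsum_(l1, l2 <- Delta L) F (l1 * h) l2 =
  \tsum_(l1, l2 <- Delta L) F l1 (l2 * S h).
Proof.
move=> bF.
rewrite -[RHS](coul_sum (f := fun x => \tsum_(l1, l2 <- Delta L) F l1 (l2 * S x)));
  last by mlin.
rewrite -[LHS](cour_sum (f := fun x => \tsum_(l1, l2 <- Delta L) F (l1 * x) l2));
  last by mlin.
transitivity (\tsum_(a, b <- Delta h) \tsum_(a1, a2 <- Delta a)
    \tsum_(l1, l2 <- Delta L) F (l1 * a1) (l2 * a2 * S b)); last first.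
  by apply: eq_tsum => a b; apply: (integral_copr_r (F := fun x y => F x (y * S b))); mlin.
rewrite (coassoc3 (T := fun a1 a2 b => \tsum_(l1, l2 <- Delta L)
    F (l1 * a1) (l2 * a2 * S b))); last by mlin.
apply: eq_tsum => a b; rewrite exchange_tsum (lin_of_tsum _ _ (@lin_scaler _ _ _ _ id _)) //.
apply: eq_tsum => l1 l2.
rewrite -[in LHS](mulr1 l2) -(antir_sum (f := fun x => F (l1 * a) (l2 * x))); last by mlin.
by apply: eq_tsum => b1 b2; rewrite mulrA.
Qed.

Lemma integral_slidelV W (F : A -> A -> W) h : bilin F ->
  \tsum_(l1, l2 <- Delta L) F l1 (h * l2) =
  \tsum_(l1, l2 <- Delta L) F (S h * l1) l2.
Proof. by move=> bF; rewrite integral_slidel // antiK. Qed.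

Lemma integral_sliderV W (F : A -> A -> W) h : bilin F ->
  \tsum_(l1, l2 <- Delta L) F l1 (l2 * h) =
  \tsum_(l1, l2 <- Delta L) F (l1 * Si h) l2.
Proof. by move=> bF; rewrite integral_slider // antiVK. Qed.

Lemma cointegral_integral : \tsum_(l1, l2 <- Delta L) ((lam l1 : k) *: l2) = 1.
Proof. by rewrite (cointr (fr_int A)) (coint_int (fr_int A)) scale1r. Qed.

(** L_1 and L_2 are dual bases for the form lam(S(x) y): S(h) slides onto L_2 as h, and lam(L_1) L_2
    = 1 remains. *)
Lemma integral_dual h : \tsum_(l1, l2 <- Delta L) ((lam (S h * l1) : k) *: l2) = h.
Proof.
rewrite (integral_slidel (F := fun x y => (lam x : k) *: y)); last by mlin.
rewrite antiK -[RHS]mulr1 -cointegral_integral (lin_of_tsum (f := fun x => h * x)).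
  by apply: eq_tsum => l1 l2; rewrite scalerAr.
by lin.
Qed.

(** In the dual-basis expansion of S^-1(L) the coefficients are lam(L L_1) = eps(L_1). *)
Lemma antiV_integral : Si L = L.
Proof.
rewrite -[LHS]integral_dual antiVK.
transitivity (\tsum_(l1, l2 <- Delta L) ((eps l1 : k) *: l2)); last exact: coul.
apply: eq_tsum => l1 l2; rewrite (integral_r (fr_int A)) linearZ. rewrite /=.
by rewrite (coint_int (fr_int A)); congr (_ *: _); apply: mulr1.
Qed.

Lemma integral_dual_slide h : \tsum_(l1, l2 <- Delta L) ((lam (l1 * h) : k) *: l2) = S h.
Proof.
rewrite (integral_slider (F := fun x y => (lam x : k) *: y)); last by mlin.
rewrite -[RHS]mul1r -cointegral_integral (lin_of_tsum (f := fun x => x * S h)).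
  by apply: eq_tsum => l1 l2; rewrite scalerAl.
by lin.
Qed.

Lemma tsum_integral_antiV W (F : A -> A -> W) : bilin F ->
  \tsum_(l1, l2 <- Delta L) F l1 l2 = \tsum_(l1, l2 <- Delta L) F (Si l2) (Si l1).
Proof. by move=> bF; rewrite -{1}antiV_integral tsum_copr_antiV. Qed.

Lemma integral_dualr z : \tsum_(l1, l2 <- Delta L) ((lam (S l2 * z) : k) *: l1) = z.
Proof.
rewrite (tsum_integral_antiV (F := fun x y => (lam (S y * z) : k) *: x)); last by mlin.
rewrite -[RHS](antiK z) -integral_dual_slide hom_tsum.
by apply: eq_tsum => l1 l2; rewrite antiVK linearZ /=.
Qed.

(** A functional f is recovered from the element f(L_1) L_2 by inserting the latter into lam(S(_)
    x). *)
Lemma integral_nondegl (f g : A -> k^o) : linear f -> linear g ->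
  \tsum_(l1, l2 <- Delta L) ((f l1 : k) *: l2) =
  \tsum_(l1, l2 <- Delta L) ((g l1 : k) *: l2) -> f =1 g.
Proof.
have E (h : A -> k^o) : linear h -> forall x : A, h x =
    lam (S (\tsum_(l1, l2 <- Delta L) ((h l1 : k) *: l2)) * x).
  move=> lh x; rewrite -{1}(integral_dualr x) (lin_of_tsum _ _ lh).
  rewrite (lin_of_tsum (f := fun y => lam (S y * x))); last by lin.
  apply: eq_tsum => l1 l2.
  by rewrite (linZ _ _ lh) linearZ -scalerAl linearZ /=; apply: mulrC.
by move=> lf lg e x; rewrite (E f) // (E g) // e.
Qed.

Lemma integral_nondegr (f g : A -> k^o) : linear f -> linear g ->
  \tsum_(l1, l2 <- Delta L) ((f l2 : k) *: l1) =
  \tsum_(l1, l2 <- Delta L) ((g l2 : k) *: l1) -> f =1 g.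
Proof.
have E (h : A -> k^o) : linear h -> forall x : A, h x =
    lam (S x * (\tsum_(l1, l2 <- Delta L) ((h l2 : k) *: l1))).
  move=> lh x; rewrite -{1}(integral_dual x) (lin_of_tsum _ _ lh).
  rewrite (lin_of_tsum (f := fun y => lam (S x * y))); last by lin.
  apply: eq_tsum => l1 l2.
  by rewrite (linZ _ _ lh) -scalerAr linearZ /=; apply: mulrC.
by move=> lf lg e x; rewrite (E f) // (E g) // e.
Qed.

(** The quantum trace property. As functionals of [z], evaluated on L_1 with L_2 kept, both sides
    give S(y): one by dual bases, the other by sliding y through L. *)
Lemma cointegral_cyc y z : lam (S (S y) * z) = lam (z * y).
Proof.
apply: (integral_nondegl (f := fun z => lam (S (S y) * z))
  (g := fun z => lam (z * y))); try by lin.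
by rewrite integral_dual integral_dual_slide.
Qed.

Lemma cointegral_cycV y z : lam (y * z) = lam (z * Si (Si y)).
Proof. by rewrite -[RHS]cointegral_cyc !antiVK. Qed.

(** The cointegral identity for S(x_2) y is multiplied by x_1 from the left, and the antipode axiom
    then frees y_2. Trading the coproduct of y for that of x is the source of both the
    coassociativity of [DeltaF] and the Frobenius relation. *)
Lemma cointegral_slide x y :
  \tsum_(y1, y2 <- Delta y) ((lam (S x * y1) : k) *: y2) =
  \tsum_(x1, x2 <- Delta x) ((lam (S x2 * y) : k) *: x1).
Proof.
rewrite -[LHS](coul_sum (f := fun x =>
  \tsum_(y1, y2 <- Delta y) ((lam (S x * y1) : k) *: y2))); last by mlin.
transitivity (\tsum_(x1, x' <- Delta x) \tsum_(x2, x3 <- Delta x')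
  \tsum_(y1, y2 <- Delta y) ((lam (S x3 * y1) : k) *: (x1 * (S x2 * y2)))).
  rewrite -(coassoc3 (T := fun x1 x2 x3 => \tsum_(y1, y2 <- Delta y)
     ((lam (S x3 * y1) : k) *: (x1 * (S x2 * y2))))); last by mlin.
  apply: eq_tsum => x' x3; rewrite exchange_tsum.
  rewrite (lin_of_tsum _ _ (@lin_scaler _ _ _ _ id _)) //.
  apply: eq_tsum => y1 y2.
  rewrite -[in LHS](mul1r y2) -(antir_sum (f := fun z => lam (S x3 * y1) *: (z * y2)));
    last by mlin.
  by apply: eq_tsum => x1 x2; rewrite mulrA.
apply: eq_tsum => x1 x'.
transitivity (x1 * \tsum_(a, b <- Delta (S x' * y)) ((lam a : k) *: b)).
  rewrite coprM_sum; last by mlin.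
  rewrite tsum_copr_anti; last by mlin.
  rewrite (lin_of_tsum (f := fun z => x1 * z)); last by mlin.
  apply: eq_tsum => x2 x3; rewrite (lin_of_tsum (f := fun z => x1 * z)); last by mlin.
  by apply: eq_tsum => y1 y2; rewrite scalerAr.
by rewrite (cointr (fr_int A)) -scalerAr mulr1.
Qed.
End Integrals.

(** * The R-matrix, its inverse and the monodromy *)

Section RMatrix.
Variables (k : fieldType) (A : frHopf k).
Local Notation Delta := (copr A).
Local Notation eps := (cou A).
Local Notation S := (anti A).
Local Notation Si := (antiV A).
Local Notation R := (rmx A).
Local Notation Ri := (rmxV A).
Local Notation Q := (monodromy R).
Local Notation Qi := (monodromyV Ri).
Implicit Types (a b h x y z : A) (W : vectType k).

Lemma rmxDl_sum W (T : A -> A -> A -> W) : trilin T ->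
  \tsum_(r1, r2 <- R) \tsum_(a, b <- Delta r1) T a b r2 =
  \tsum_(r1, r2 <- R) \tsum_(s1, s2 <- R) T r1 s1 (r2 * s2).
Proof.
move=> tT; pose G (ab : tens A A) c := \tsum_(a, b <- ab) T a b c.
have bG : bilin G by rewrite /G; mlin.
transitivity (tsum (tmap Delta \1 R) G).
  by rewrite tsum_tmap //; apply: eq_tsum => r1 r2; rewrite id_lfunE.
rewrite (rmxDl (fr_rmx A)) (lin_of_tsum _ _ (lin_suml G)); apply: eq_tsum => r1 r2.
rewrite (lin_of_tsum _ _ (lin_suml G)); apply: eq_tsum => s1 s2.
by rewrite tsumE // /G tsumE //; mlin.
Qed.

Lemma rmxDr_sum W (T : A -> A -> A -> W) : trilin T ->
  \tsum_(r1, r2 <- R) \tsum_(a, b <- Delta r2) T r1 a b =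
  \tsum_(r1, r2 <- R) \tsum_(s1, s2 <- R) T (r1 * s1) s2 r2.
Proof.
move=> tT; pose G c (ab : tens A A) := \tsum_(a, b <- ab) T c a b.
have bG : bilin G by rewrite /G; mlin.
transitivity (tsum (tmap \1 Delta R) G).
  by rewrite tsum_tmap //; apply: eq_tsum => r1 r2; rewrite id_lfunE.
rewrite (rmxDr (fr_rmx A)) (lin_of_tsum _ _ (lin_suml G)); apply: eq_tsum => r1 r2.
rewrite (lin_of_tsum _ _ (lin_suml G)); apply: eq_tsum => s1 s2.
by rewrite tsumE // /G tsumE //; mlin.
Qed.

Lemma tmul_rmxI (t : tens A A) : tmul t R = R -> t = 1 \ox 1.
Proof.
by move=> e; rewrite -(tmul1r t) -(rmxK (fr_rmx A)) tmulA e.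
Qed.

(** The counit on the first leg of the hexagon identity gives (1 (x) e) R = R, where R can be
    cancelled. *)
Lemma rmx_cou_l : \tsum_(s, t <- R) ((eps s : k) *: t) = 1.
Proof.
set e := tsum _ _.
have /tmul_rmxI E : tmul (1 \ox e) R = R.
  rewrite -[RHS]tens_sum.
  transitivity (\tsum_(r1, r2 <- R) \tsum_(s1, s2 <- R)
      ((eps r1 : k) *: (s1 \ox (r2 * s2)))).
    rewrite /e (lin_of_tsum (f := fun e => tmul (1 \ox e) R)); last by mlin.
    apply: eq_tsum => r1 r2; rewrite -{1}(tens_sum R) (lin_of_tsum _ _ (tmul_linr _)).
    apply: eq_tsum => s1 s2.
    rewrite tmulE mul1r -scalerAl.
    exact: (linZ _ _ (lin_purer s1 (@lin_id _ _))).
  rewrite -(rmxDl_sum (T := fun a b c => (eps a : k) *: (b \ox c))); last by mlin.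
  by apply: eq_tsum => r1 r2; apply: (coul_sum (f := fun y => y \ox r2)); lin.
have := congr1 (fun t => \tsum_(a, b <- t) ((eps a : k) *: b)) E.
by rewrite !tsumE ?cou1 ?scale1r //; mlin.
Qed.

Lemma rmx_cou_r : \tsum_(s, t <- R) ((eps t : k) *: s) = 1.
Proof.
set e := tsum _ _.
have /tmul_rmxI E : tmul (e \ox 1) R = R.
  rewrite -[RHS]tens_sum.
  transitivity (\tsum_(r1, r2 <- R) \tsum_(s1, s2 <- R)
      ((eps r2 : k) *: ((r1 * s1) \ox s2))).
    rewrite /e (lin_of_tsum (f := fun e => tmul (e \ox 1) R)); last by mlin.
    apply: eq_tsum => r1 r2; rewrite -{1}(tens_sum R) (lin_of_tsum _ _ (tmul_linr _)).
    apply: eq_tsum => s1 s2.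
    rewrite tmulE mul1r -scalerAl.
    exact: (linZ _ _ (lin_purel s2 (@lin_id _ _))).
  rewrite -(rmxDr_sum (T := fun c a b => (eps b : k) *: (c \ox a))); last by mlin.
  by apply: eq_tsum => r1 r2; apply: (cour_sum (f := fun y => r1 \ox y)); lin.
have := congr1 (fun t => \tsum_(a, b <- t) ((eps b : k) *: a)) E.
by rewrite !tsumE ?cou1 ?scale1r //; mlin.
Qed.

Lemma rmxV_unique (t : tens A A) : tmul t R = 1 \ox 1 -> Ri = t.
Proof. by move=> e; rewrite -(tmul1l Ri) -e -tmulA (rmxK (fr_rmx A)) tmul1r. Qed.

(** By the hexagon identity the product with R is a sum over the coproduct of r_1 with S on its
    first component; the antipode axiom leaves eps(r_1), and [rmx_cou_l] finishes. *)
Lemma rmxV_antil : Ri = \tsum_(s, t <- R) (S s \ox t).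
Proof.
apply: rmxV_unique; rewrite (lin_of_tsum (f := fun r => tmul r R)); last by mlin.
transitivity (\tsum_(r1, r2 <- R) \tsum_(s1, s2 <- R) ((S r1 * s1) \ox (r2 * s2))).
  apply: eq_tsum => r1 r2; rewrite -{1}(tens_sum R) (lin_of_tsum _ _ (tmul_linr _)).
  by apply: eq_tsum => s1 s2; rewrite tmulE.
rewrite -(rmxDl_sum (T := fun a b c => (S a * b) \ox c)); last by mlin.
rewrite -{2}rmx_cou_l (lin_of_tsum (f := fun y : A => (1 : A) \ox y)); last by mlin.
apply: eq_tsum => r1 r2; rewrite (antil_sum (f := fun y => y \ox r2)); last by lin.
by rewrite (linZ _ _ (lin_purer 1 (@lin_id _ _))).
Qed.

Lemma rmxV_antir : Ri = \tsum_(s, t <- R) (s \ox Si t).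
Proof.
apply: rmxV_unique; rewrite (lin_of_tsum (f := fun r => tmul r R)); last by mlin.
transitivity (\tsum_(r1, r2 <- R) \tsum_(s1, s2 <- R) ((r1 * s1) \ox (Si r2 * s2))).
  apply: eq_tsum => r1 r2; rewrite -{1}(tens_sum R) (lin_of_tsum _ _ (tmul_linr _)).
  by apply: eq_tsum => s1 s2; rewrite tmulE.
rewrite -(rmxDr_sum (T := fun c a b => c \ox (Si b * a))); last by mlin.
rewrite -{1}rmx_cou_r (lin_of_tsum (f := fun y : A => y \ox (1 : A))); last by mlin.
apply: eq_tsum => r1 r2; rewrite (antiVl_sum (f := fun y => r1 \ox y)); last by lin.
by rewrite (linZ _ _ (lin_purel 1 (@lin_id _ _))).
Qed.

Section Sums.
Variables (W : vectType k) (F : A -> A -> W).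
Hypothesis bF : bilin F.

Lemma tsum_rmxV_l : tsum Ri F = \tsum_(s, t <- R) F (S s) t.
Proof.
rewrite rmxV_antil (lin_of_tsum _ _ (lin_suml F)).
by apply: eq_tsum => s t; rewrite tsumE.
Qed.

Lemma tsum_rmxV_r : tsum Ri F = \tsum_(s, t <- R) F s (Si t).
Proof.
rewrite rmxV_antir (lin_of_tsum _ _ (lin_suml F)).
by apply: eq_tsum => s t; rewrite tsumE.
Qed.

Lemma tsum_rmx_antil : \tsum_(s, t <- R) F (S s) t = \tsum_(s, t <- R) F s (Si t).
Proof. by rewrite -tsum_rmxV_l tsum_rmxV_r. Qed.
End Sums.

(** Both (S (x) id)(R) and (id (x) S^-1)(R) equal R^-1. *)
Lemma tsum_rmx_anti W (F : A -> A -> W) : bilin F ->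
  \tsum_(s, t <- R) F (S s) (S t) = tsum R F.
Proof.
move=> bF; rewrite (tsum_rmx_antil (F := fun s t => F s (S t))); last by mlin.
by apply: eq_tsum => s t; rewrite antiVK.
Qed.

Lemma tsum_rmx_antiV W (F : A -> A -> W) : bilin F ->
  \tsum_(s, t <- R) F (Si s) (Si t) = tsum R F.
Proof.
move=> bF; rewrite -(tsum_rmx_anti (F := fun s t => F (Si s) (Si t))); last by mlin.
by apply: eq_tsum => s t; rewrite !antiK.
Qed.

Lemma rmx_mulVr W (F : A -> A -> W) : bilin F ->
  \tsum_(s, t <- R) \tsum_(s', t' <- R) F (s * S s') (t * t') = F 1 1.
Proof.
move=> bF; rewrite -[RHS]tsumE // -(rmxK (fr_rmx A)) tsum_tmul //.
by apply: eq_tsum => s t; rewrite tsum_rmxV_l //; mlin.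
Qed.

Lemma tmul_rmx_copr h : tmul R (Delta h) = tmul (tflip A A (Delta h)) R.
Proof.
rewrite -(rmxC (fr_rmx A)) -tmulA (rmxVK (fr_rmx A)) tmul1r //.
Qed.

Lemma copr_conj h : Delta h = tmul (tmul Ri (tflip A A (Delta h))) R.
Proof.
by rewrite -tmulA -tmul_rmx_copr tmulA (rmxVK (fr_rmx A)) tmul1l.
Qed.

Lemma rmx_copr_sum W (F : A -> A -> W) h : bilin F ->
  \tsum_(s, t <- R) \tsum_(h1, h2 <- Delta h) F (s * h1) (t * h2) =
  \tsum_(h1, h2 <- Delta h) \tsum_(s, t <- R) F (h2 * s) (h1 * t).
Proof.
move=> bF; rewrite -tsum_tmul // tmul_rmx_copr tsum_tmul // tsum_tflip //.
by mlin.
Qed.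

Lemma tflipK (t : tens A A) : tflip A A (tflip A A t) = t.
Proof.
rewrite -{1}(tens_sum t) !hom_tsum -[RHS]tens_sum.
by apply: eq_tsum => u v; rewrite !tflipE.
Qed.

Lemma monodromy_copr h : tmul Q (Delta h) = tmul (Delta h) Q.
Proof.
rewrite /monodromy -tmulA tmul_rmx_copr tmulA -tflip_tmul tmul_rmx_copr.
by rewrite tflip_tmul tflipK tmulA.
Qed.

Lemma monodromyK : tmul Q Qi = 1 \ox 1.
Proof.
rewrite /monodromy /monodromyV -tmulA (tmulA R) (rmxK (fr_rmx A)) tmul1l.
by rewrite -tflip_tmul (rmxK (fr_rmx A)) tflipE.
Qed.

Lemma monodromyVK : tmul Qi Q = 1 \ox 1.
Proof.
rewrite /monodromy /monodromyV -tmulA (tmulA (tflip _ _ Ri)) -tflip_tmul.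
by rewrite (rmxVK (fr_rmx A)) tflipE tmul1l (rmxVK (fr_rmx A)).
Qed.

Lemma monodromyV_copr h : tmul Qi (Delta h) = tmul (Delta h) Qi.
Proof.
rewrite -[LHS]tmul1r -monodromyK tmulA -(tmulA Qi) -monodromy_copr.
by rewrite (tmulA Qi) monodromyVK tmul1l.
Qed.

Lemma tsum_monodromy W (F : A -> A -> W) : bilin F ->
  tsum Q F = \tsum_(s, t <- R) \tsum_(s', t' <- R) F (t * s') (s * t').
Proof.
by move=> bF; rewrite tsum_tmul // tsum_tflip //; mlin.
Qed.

Lemma tsum_monodromyV W (F : A -> A -> W) : bilin F ->
  tsum Qi F = \tsum_(s, t <- R) \tsum_(s', t' <- R) F (S s * t') (t * S s').
Proof.
move=> bF; rewrite tsum_tmul // tsum_rmxV_l; last by mlin.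
apply: eq_tsum => s t; rewrite tsum_tflip; last by mlin.
by rewrite tsum_rmxV_l //; mlin.
Qed.

Lemma tsum_monodromy_antiV2 W (F : A -> A -> W) : bilin F ->
  \tsum_(q1, q2 <- Q) F (Si (Si q1)) (Si (Si q2)) = tsum Q F.
Proof.
move=> bF; rewrite !tsum_monodromy //; last by mlin.
transitivity (\tsum_(s, t <- R) \tsum_(s', t' <- R)
   F (Si (Si t) * s') (Si (Si s) * t')).
  apply: eq_tsum => s t.
  rewrite -[RHS](tsum_rmx_antiV); last by mlin.
  rewrite -[RHS](tsum_rmx_antiV (F := fun s' t' => F (Si (Si t) * Si s') (Si (Si s) * Si t'))); last by mlin.
  by apply: eq_tsum => s' t'; rewrite !antiVM.
rewrite (tsum_rmx_antiV (F := fun s t => \tsum_(s', t' <- R) F (Si t * s') (Si s * t'))); last by mlin.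
by rewrite (tsum_rmx_antiV (F := fun s t => \tsum_(s', t' <- R) F (t * s') (s * t'))) //; mlin.
Qed.

Lemma monodromy_copr_sum W (F : A -> A -> W) h : bilin F ->
  \tsum_(q1, q2 <- Q) \tsum_(h1, h2 <- Delta h) F (q1 * h1) (q2 * h2) =
  \tsum_(h1, h2 <- Delta h) \tsum_(q1, q2 <- Q) F (h1 * q1) (h2 * q2).
Proof. by move=> bF; rewrite -!tsum_tmul // monodromy_copr. Qed.

Lemma monodromyV_copr_sum W (F : A -> A -> W) h : bilin F ->
  \tsum_(q1, q2 <- Qi) \tsum_(h1, h2 <- Delta h) F (q1 * h1) (q2 * h2) =
  \tsum_(h1, h2 <- Delta h) \tsum_(q1, q2 <- Qi) F (h1 * q1) (h2 * q2).
Proof. by move=> bF; rewrite -!tsum_tmul // monodromyV_copr. Qed.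
End RMatrix.

(** * The cointegral against Q and Q^-1, and the cancellation of Q *)

Section Handle.
Variables (k : fieldType) (A : frHopf k).
Local Notation Delta := (copr A).
Local Notation S := (anti A).
Local Notation Si := (antiV A).
Local Notation R := (rmx A).
Local Notation Ri := (rmxV A).
Local Notation Q := (monodromy R).
Local Notation Qi := (monodromyV Ri).
Local Notation L := (integral A).
Local Notation lam := (cointegral A).
Implicit Types (a b h x y z : A) (W : vectType k).

Lemma cointegral_monodromy : \tsum_(q1, q2 <- Q) ((lam q1 : k) *: q2) = L.
Proof.
by rewrite -(drinfeld_coint (fr_int A)) /drinfeld_map linfunE' //; lin.
Qed.

(** Cyclicity of lam and the invariance of R under S (x) S identify the sum with S^-1(f_Q(lam)), and
    S^-1(L) = L. *)
Lemma cointegral_monodromyV : \tsum_(p1, p2 <- Qi) ((lam p1 : k) *: p2) = L.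
Proof.
rewrite -antiV_integral -cointegral_monodromy hom_tsum tsum_monodromyV; last by mlin.
rewrite tsum_monodromy; last by mlin.
rewrite (tsum_rmx_antil (F := fun s t =>
  \tsum_(s', t' <- R) ((lam (s * t') : k) *: (t * S s')))); last by mlin.
rewrite [RHS]exchange_tsum; apply: eq_tsum => s t.
transitivity (\tsum_(s', t' <- R) ((lam (S (S t') * s) : k) *: (Si t * S s'))).
  by apply: eq_tsum => s' t'; rewrite cointegral_cyc.
rewrite (tsum_rmx_anti (F := fun s' t' => lam (S t' * s) *: (Si t * s'))); last by mlin.
rewrite -(tsum_rmx_antiV (F := fun s' t' => lam (S t' * s) *: (Si t * s'))); last by mlin.
by apply: eq_tsum => s' t'; rewrite antiVK linearZ /= antiVM.
Qed.

(** S (x) S maps Q^-1 to its flip, so the sum is S^-1 of the one in [cointegral_monodromyV]. *)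
Lemma cointegral_monodromyV_r : \tsum_(p1, p2 <- Qi) ((lam (S p2) : k) *: p1) = L.
Proof.
rewrite -antiV_integral -cointegral_monodromyV hom_tsum !tsum_monodromyV; try by mlin.
rewrite -(tsum_rmx_antiV (F := fun s t =>
  \tsum_(s', t' <- R) (lam (S (t * S s')) *: (S s * t')))); last by mlin.
rewrite -(tsum_rmx_anti (F := fun s t =>
  \tsum_(s', t' <- R) (Si (lam (S s * t') *: (t * S s'))))); last by mlin.
rewrite exchange_tsum; apply: eq_tsum => s t; apply: eq_tsum => s' t'.
by rewrite linearZ /= antiM !antiVM !antiK !antiVK.
Qed.

(** Delta is applied to L = lam(S(p_2)) p_1. The hexagon identities split the two R-matrices of Q^-1
    into four; two of them reassemble to Q^-1, and cyclicity of lam lets the other two form Q. *)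
Lemma monodromy_pairing W (F : A -> A -> W) : bilin F ->
  \tsum_(p1, p2 <- Qi) \tsum_(q1, q2 <- Q) ((lam (S p2 * Si q2) : k) *: F p1 q1) =
  \tsum_(l1, l2 <- Delta L) F l1 (S l2).
Proof.
move=> bF.
(* Here [s] and [w] form Q^-1, with p_1 = S(s_1) w_2 and p_2 = s_2 S(w_1), while [r] and [u] will
   form Q. *)
transitivity (\tsum_(r1, r2 <- R) \tsum_(s1, s2 <- R)
  \tsum_(u1, u2 <- R) \tsum_(w1, w2 <- R)
   ((lam (S (r2 * s2 * S (u1 * w1))) : k) *: F (S s1 * w2) (S (S r1 * u2)))); last first.
  rewrite -[in RHS]cointegral_monodromyV_r.
  rewrite (lin_of_tsum (f := fun x => \tsum_(l1, l2 <- Delta x) F l1 (S l2)));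
    last by mlin.
  transitivity (\tsum_(p1, p2 <- Qi) ((lam (S p2) : k) *:
      \tsum_(l1, l2 <- Delta p1) F l1 (S l2))); last first.
    apply: eq_tsum => p1 p2; rewrite linearZ /=.
    by rewrite (linZ _ _ (lin_suml _)).
  rewrite tsum_monodromyV; last by mlin.
  rewrite -(rmxDl_sum (T := fun r1 s1 r => \tsum_(u1, u2 <- R) \tsum_(w1, w2 <- R)
   ((lam (S (r * S (u1 * w1))) : k) *: F (S s1 * w2) (S (S r1 * u2))))); last by mlin.
  apply: eq_tsum => s t.
  transitivity (\tsum_(a, b <- Delta s) \tsum_(s', t' <- R) \tsum_(c, d <- Delta t')
     ((lam (S (t * S s')) : k) *: F (S b * c) (S (S a * d)))).
    apply: eq_tsum => a b.
    by rewrite (rmxDr_sum (T := fun s' c d =>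
      (lam (S (t * S s')) : k) *: F (S b * c) (S (S a * d)))) //; mlin.
  rewrite exchange_tsum; apply: eq_tsum => s' t'.
  rewrite coprM_sum; last by mlin.
  rewrite tsum_copr_anti; last by mlin.
  rewrite (lin_of_tsum (f := fun y : W => (lam (S (t * S s')) : k) *: y)); last by mlin.
  apply: eq_tsum => a b.
  by rewrite (lin_of_tsum (f := fun y : W => (lam (S (t * S s')) : k) *: y)) //; mlin.
rewrite tsum_monodromyV; last by mlin.
rewrite [RHS]exchange_tsum; apply: eq_tsum => s1 s2.
transitivity (\tsum_(w1, w2 <- R) \tsum_(u1, u2 <- R) \tsum_(r1, r2 <- R)
   ((lam (S (S u1) * S (s2 * S w1) * S r2) : k) *: F (S s1 * w2) (S u2 * S (S r1))));
   last first.
  transitivity (\tsum_(w1, w2 <- R) \tsum_(r1, r2 <- R) \tsum_(u1, u2 <- R)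
   ((lam (S (S u1) * S (s2 * S w1) * S r2) : k) *: F (S s1 * w2) (S u2 * S (S r1)))).
    by apply: eq_tsum => w1 w2; rewrite exchange_tsum.
  rewrite exchange_tsum; apply: eq_tsum => r1 r2.
  rewrite exchange_tsum; apply: eq_tsum => u1 u2.
  by apply: eq_tsum => w1 w2; rewrite !antiM !mulrA.
apply: eq_tsum => w1 w2; rewrite tsum_monodromy; last by mlin.
rewrite (tsum_rmx_anti (F := fun u1 u2 => \tsum_(r1, r2 <- R)
   ((lam (S u1 * S (s2 * S w1) * S r2) : k) *: F (S s1 * w2) (u2 * S (S r1)))));
   last by mlin.
apply: eq_tsum => u1 u2.
rewrite (tsum_rmx_anti (F := fun r1 r2 =>
   ((lam (S u1 * S (s2 * S w1) * r2) : k) *: F (S s1 * w2) (u2 * S r1))));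
   last by mlin.
rewrite (tsum_rmx_antil (F := fun r1 r2 =>
   ((lam (S u1 * S (s2 * S w1) * r2) : k) *: F (S s1 * w2) (u2 * r1))));
   last by mlin.
apply: eq_tsum => r1 r2; congr (_ *: _).
by rewrite -mulrA [RHS]cointegral_cycV antiK antiVM !mulrA.
Qed.

(** S(x_1) x_2 = eps is inserted on the first leg, so that x acts through its coproduct, which
    commutes with Q. *)
Lemma monodromy_slide W (F : A -> A -> W) x : bilin F ->
  \tsum_(q1, q2 <- Q) F q1 (x * q2) =
  \tsum_(x1, x' <- Delta x) \tsum_(x2, x3 <- Delta x') \tsum_(q1, q2 <- Q)
    F (S x1 * (q1 * x2)) (q2 * x3).
Proof.
move=> bF.
transitivity (\tsum_(x1, x' <- Delta x) \tsum_(x2, x3 <- Delta x') \tsum_(q1, q2 <- Q)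
    F (S x1 * x2 * q1) (x3 * q2)); last first.
  apply: eq_tsum => x1 x'.
  rewrite [RHS]exchange_tsum (monodromy_copr_sum (F := fun a b => F (S x1 * a) b));
    last by mlin.
  by do 2!apply: eq_tsum => ? ?; rewrite mulrA.
rewrite -(coassoc3 (T := fun x1 x2 x3 => \tsum_(q1, q2 <- Q)
    F (S x1 * x2 * q1) (x3 * q2))); last by mlin.
rewrite -[LHS](coul_sum (f := fun y => \tsum_(q1, q2 <- Q) F q1 (y * q2)));
  last by mlin.
apply: eq_tsum => x' x3.
rewrite (antil_sum (f := fun y => \tsum_(q1, q2 <- Q) F (y * q1) (x3 * q2)));
  last by mlin.
by congr (_ *: _); apply: eq_tsum => q1 q2; rewrite mul1r.
Qed.

(* Pairing both sides with [lam (h _)] and [lam (_ k)] turns this identity into the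
   invariance of [chi] under the S-transformation. *)
Lemma handle_pairing W (F : A -> A -> W) x : bilin F ->
  \tsum_(x1, x2 <- Delta x) \tsum_(p1, p2 <- Qi) \tsum_(q1, q2 <- Q)
    ((lam (S x1 * (S p2 * (x2 * Si q2))) : k) *: F p1 q1) =
  \tsum_(x1, x2 <- Delta x) \tsum_(l1, l2 <- Delta L)
    F l1 (S x1 * (S l2 * x2)).
Proof.
move=> bF.
transitivity (\tsum_(p1, p2 <- Qi) \tsum_(x1, x2 <- Delta x) \tsum_(q1, q2 <- Q)
    ((lam (S p2 * Si q2) : k) *: F p1 (S x1 * (q1 * x2)))); last first.
  rewrite exchange_tsum; apply: eq_tsum => x1 x2.
  by rewrite (monodromy_pairing (F := fun a b => F a (S x1 * (b * x2)))) //; mlin.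
rewrite exchange_tsum; apply: eq_tsum => p1 p2.
(* Cyclicity carries S(x_1) to the right end as S^-1(x_1), where it joins S^-1(q_2) to S^-1(x_1
   q_2), ready for [monodromy_slide]. *)
transitivity (\tsum_(y, z <- Delta x) \tsum_(q1, q2 <- Q)
    ((lam (S p2 * (z * Si (y * q2))) : k) *: F p1 q1)).
  apply: eq_tsum => y z; apply: eq_tsum => q1 q2; congr (_ *: _).
  by rewrite cointegral_cycV antiK antiVM !mulrA.
transitivity (\tsum_(y, z <- Delta x) \tsum_(a, y' <- Delta y) \tsum_(b, c <- Delta y')
  \tsum_(q1, q2 <- Q)
    ((lam (S p2 * (z * Si (q2 * c))) : k) *: F p1 (S a * (q1 * b)))).
  apply: eq_tsum => y z.
  by rewrite (monodromy_slide (F := fun q1 u =>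
    ((lam (S p2 * (z * Si u)) : k) *: F p1 q1))) //; mlin.
rewrite (coassoc3 (T := fun a y' z => \tsum_(b, c <- Delta y')
  \tsum_(q1, q2 <- Q)
    ((lam (S p2 * (z * Si (q2 * c))) : k) *: F p1 (S a * (q1 * b))))); last by mlin.
apply: eq_tsum => a w.
rewrite (coassoc3 (T := fun b c z => \tsum_(q1, q2 <- Q)
    ((lam (S p2 * (z * Si (q2 * c))) : k) *: F p1 (S a * (q1 * b))))); last by mlin.
rewrite -[RHS](cour_sum (f := fun b => \tsum_(q1, q2 <- Q)
    ((lam (S p2 * Si q2) : k) *: F p1 (S a * (q1 * b))))); last by mlin.
apply: eq_tsum => b w'; rewrite exchange_tsum.
rewrite (lin_of_tsum _ _ (@lin_scaler _ _ _ _ id _)) //; apply: eq_tsum => q1 q2.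
rewrite -[in RHS](mul1r (Si q2)) -(antiVr_sum (f := fun y =>
  (lam (S p2 * (y * Si q2)) : k) *: F p1 (S a * (q1 * b)))); last by mlin.
by apply: eq_tsum => c z; rewrite antiVM !mulrA.
Qed.

(** Q^-1 commutes with the coproduct of S^-1(x); S is then applied to the second leg. *)
Lemma monodromyV_swap W (F : A -> A -> W) x : bilin F ->
  \tsum_(x1, x2 <- Delta x) \tsum_(p1, p2 <- Qi) F (Si x2 * p1) (S p2 * x1) =
  \tsum_(x1, x2 <- Delta x) \tsum_(p1, p2 <- Qi) F (p1 * Si x2) (x1 * S p2).
Proof.
move=> bF; have := monodromyV_copr_sum (F := fun a b => F a (S b)) (Si x).
rewrite exchange_tsum !tsum_copr_antiV; try by mlin.
move=> e; transitivity (\tsum_(a, b <- Delta x) \tsum_(p1, p2 <- Qi)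
    F (Si b * p1) (S (Si a * p2))).
  by do 2!apply: eq_tsum => ? ?; rewrite antiM antiVK.
rewrite -e; last by mlin.
by do 2!apply: eq_tsum => ? ?; rewrite antiM antiVK.
Qed.

(** After [monodromyV_swap] the factors from Q and Q^-1 are adjacent. As S^-1(q_2) = S(S^-2(q_2)),
    they form (S^-2 (x) S^-2)(Q) = Q times Q^-1, with S on the second leg. *)
Lemma monodromy_cancel W (F : A -> A -> W) x : bilin F ->
  \tsum_(x1, x2 <- Delta x) \tsum_(p1, p2 <- Qi) \tsum_(q1, q2 <- Q)
     F (Si (Si q1) * (Si x2 * p1)) (S p2 * x1 * Si q2) =
  \tsum_(x1, x2 <- Delta x) F (Si x2) x1.
Proof.
move=> bF; rewrite (monodromyV_swap (F := fun a b => \tsum_(q1, q2 <- Q)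
     F (Si (Si q1) * a) (b * Si q2))); last by mlin.
apply: eq_tsum => x1 x2; rewrite exchange_tsum.
pose G a b := F (a * Si x2) (x1 * S b).
have bG : bilin G by rewrite /G; mlin.
transitivity (G 1 1); last by rewrite /G anti1 mul1r mulr1.
rewrite -[RHS]tsumE // /G {bG}.
rewrite -(monodromyK A) [RHS]tsum_tmul; last by mlin.
rewrite -[RHS](tsum_monodromy_antiV2); last by mlin.
by do 2!apply: eq_tsum => ? ?; rewrite antiM antiVK !mulrA.
Qed.
End Handle.

(** * The Drinfeld element and the braided symmetry of the Frobenius form *)

Section Drinfeld.
Variables (k : fieldType) (A : frHopf k).
Local Notation Delta := (copr A).
Local Notation eps := (cou A).
Local Notation S := (anti A).
Local Notation Si := (antiV A).
Local Notation R := (rmx A).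
Local Notation L := (integral A).
Local Notation lam := (cointegral A).
Implicit Types (a b h x y z : A) (W : vectType k).

Definition drinfeld_elt : A := \tsum_(s, t <- R) (S t * s).
(* The inverse of [S drinfeld_elt]. *)
Definition drinfeld_eltV : A := \tsum_(s, t <- R) (S (S s) * t).
Local Notation u := drinfeld_elt.
Local Notation w := drinfeld_eltV.

(** S^2(y_3) S(t y_2) s y_1, summed over R = s (x) t, is evaluated in two ways: S^2(y_3) S(y_2)
    collapses and leaves u y, while exchanging R with the coproduct of y leaves S^2(y) u. *)
Lemma drinfeld_conj y : S (S y) * u = u * y.
Proof.
transitivity (\tsum_(y1, y' <- Delta y) \tsum_(y2, y3 <- Delta y') \tsum_(s, t <- R)
  (S (S y3) * (S (t * y2) * (s * y1)))).
  rewrite -(coassoc3 (T := fun y1 y2 y3 => \tsum_(s, t <- R)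
    (S (S y3) * (S (t * y2) * (s * y1))))); last by mlin.
  rewrite -[LHS](coul_sum (f := fun z => S (S z) * u)); last by mlin.
  apply: eq_tsum => y' y3; rewrite exchange_tsum.
  rewrite (rmx_copr_sum (F := fun a b => S (S y3) * (S b * a))); last by mlin.
  rewrite exchange_tsum /u (lin_of_tsum (f := fun z => (eps y' : k) *: (S (S y3) * z)));
    last by mlin.
  apply: eq_tsum => s t.
  rewrite -[in LHS](mulr1 (S t)) -(antil_sum (f := fun z => S (S y3) * (S t * z * s)));
    last by mlin.
  by apply: eq_tsum => y1 y2; rewrite antiM !mulrA.
rewrite -[RHS](cour_sum (f := fun z => u * z)); last by mlin.
apply: eq_tsum => y1 y'.
rewrite exchange_tsum /u (lin_of_tsum (f := fun z => (eps y' : k) *: (z * y1)));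
  last by mlin.
apply: eq_tsum => s t.
rewrite -[in RHS](mul1r (S t * s)) -(anti1 A).
rewrite -(antir_sum (f := fun z => S z * (S t * s) * y1)); last by mlin.
by apply: eq_tsum => y2 y3; rewrite !antiM !mulrA.
Qed.

(** The factor of S(w) next to u is moved across u by [drinfeld_conj]; the R-matrix inside u then
    multiplies (S (x) id)(R) = R^-1. *)
Lemma mul_drinfeld_elt : u * S w = 1.
Proof.
rewrite /w !hom_tsum.
rewrite (lin_of_tsum (f := fun z => u * z)); last by mlin.
transitivity (\tsum_(s, t <- R) \tsum_(s', t' <- R) (S (t' * S t) * (s' * S (S s)))).
  rewrite -(tsum_rmx_anti (F := fun s t => \tsum_(s', t' <- R)
    (S (t' * S t) * (s' * S (S s))))); last by mlin.
  apply: eq_tsum => s t.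
  rewrite antiM mulrA -drinfeld_conj /u.
  rewrite (lin_of_tsum (f := fun z => S (S (S t)) * z * S (S (S s)))); last by mlin.
  by apply: eq_tsum => s' t'; rewrite antiM !mulrA.
rewrite (tsum_rmx_anti (F := fun s t => \tsum_(s', t' <- R)
    (S (t' * t) * (s' * S s)))); last by mlin.
rewrite exchange_tsum (rmx_mulVr (F := fun a b => S b * a)); last by mlin.
by rewrite anti1 mulr1.
Qed.

(** By [drinfeld_conj] the right inverse S(w) of u yields the left inverse S^3(w), and the two
    agree. *)
Lemma drinfeld_elt_mul : S w * u = 1.
Proof.
have e := drinfeld_conj (S w); rewrite mul_drinfeld_elt in e.
have f : S w = S (S (S w)) by rewrite -[LHS]mul1r -e -mulrA mul_drinfeld_elt mulr1.
by rewrite f.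
Qed.

Lemma anti_drinfeld_elt_mul : S u * w = 1.
Proof.
have uu : S (S u) = u.
  by rewrite -[LHS]mulr1 -mul_drinfeld_elt mulrA drinfeld_conj -mulrA mul_drinfeld_elt mulr1.
have -> : S u = Si u by rewrite -[in RHS]uu antiK.
by apply: anti_inj; rewrite antiM antiVK anti1 drinfeld_elt_mul.
Qed.

(** Writing Delta(L) as R^-1 Delta^op(L) R brings L_1 under lam. The legs of R^-1 and R are slid out
    of lam through L, lam(L_1) L_2 = 1 removes L, and the legs left over form w and u. *)
Lemma integral_cointegral_r : \tsum_(l1, l2 <- Delta L) ((lam l2 : k) *: l1) = w * u.
Proof.
rewrite (copr_conj L) tsum_tmul; last by mlin.
rewrite tsum_tmul; last by mlin.
rewrite tsum_rmxV_l; last by mlin.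
rewrite /w (tsum_rmx_antil (F := fun s t => S s * t)); last by mlin.
rewrite (lin_of_tsum (f := fun z => z * u)); last by mlin.
apply: eq_tsum => s t.
rewrite (tsum_tflip _ (F := fun a b => \tsum_(s', t' <- R)
  ((lam (t * b * t') : k) *: (S s * a * s')))); last by mlin.
rewrite (integral_slidel (F := fun a b => \tsum_(s', t' <- R)
  ((lam (a * t') : k) *: (S s * b * s')))); last by mlin.
rewrite exchange_tsum /u (lin_of_tsum (f := fun z => S s * Si t * z)); last by mlin.
apply: eq_tsum => s' t'.
rewrite (integral_slider (F := fun a b =>
  ((lam a : k) *: (S s * (Si t * b) * s')))); last by mlin.
transitivity (S s * (Si t * S t') * s'); last by rewrite !mulrA.
rewrite -[in RHS](mul1r (S t')) -cointegral_integral.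
rewrite (lin_of_tsum (f := fun z => S s * (Si t * (z * S t')) * s')); last by mlin.
by apply: eq_tsum => l1 l2; rewrite -scalerAl -!scalerAr -scalerAl.
Qed.

(* Braided symmetry of the Frobenius form. *)
Lemma cointegral_braided_sym x y :
  \tsum_(s, t <- R) \tsum_(s', t' <- R)
    (lam (S (S s * y * s') * (t * x * t')) : k^o) = lam (S x * y).
Proof.
(* Cyclicity collects the first R-matrix into w and the second into u. *)
transitivity (lam (u * S y * w * x)).
  rewrite /w (lin_of_tsum (f := fun z => lam (u * S y * z * x))); last by mlin.
  apply: eq_tsum => s t.
  rewrite /u (lin_of_tsum (f := fun z => lam (z * S y * (S (S s) * t) * x))); last by mlin.
  rewrite -[RHS](tsum_rmx_anti (F := fun s' t' =>
    (lam (S t' * s' * S y * (S (S s) * t) * x)))); last by mlin.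
  apply: eq_tsum => s' t'.
  by rewrite !mulrA -[LHS]cointegral_cyc !antiM !mulrA.
(* Both functionals of x are compared on L_2 with L_1 kept. By L_1 lam(L_2) = w u the left one gives
   S(w) S^2(y) S(u) w u = S(w) S^2(y) u = S(w) u y = y. *)
apply: (integral_nondegr (f := fun x => lam (u * S y * w * x))
  (g := fun x => lam (S x * y))); try by lin.
rewrite integral_dualr.
rewrite (integral_slidelV (F := fun a b => (lam b : k) *: a)); last by mlin.
transitivity (S (u * S y * w) * \tsum_(l1, l2 <- Delta L) ((lam l2 : k) *: l1)).
  rewrite (lin_of_tsum (f := fun z => S (u * S y * w) * z)); last by mlin.
  by apply: eq_tsum => l1 l2; rewrite scalerAr.
rewrite integral_cointegral_r !antiM !mulrA -(mulrA _ (S u)) anti_drinfeld_elt_mul mulr1.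
by rewrite -(mulrA _ (S (S y))) drinfeld_conj mulrA drinfeld_elt_mul mul1r.
Qed.

(** The cocommutativity of [DeltaF] on elements. [cointegral_slide] moves the coproduct onto t x t',
    the hexagon identity doubles both R-matrices, [cointegral_braided_sym] removes the inner ones,
    and the outer ones cancel after passing Delta(x). *)
Lemma cointegral_cocomm x y :
  \tsum_(s, t <- R) \tsum_(s', t' <- R)
    \tsum_(y1, y2 <- Delta (S s * y * s')) ((lam (S y2 * (t * x * t')) : k) *: y1) =
  \tsum_(x1, x2 <- Delta x) ((lam (S x2 * y) : k) *: x1).
Proof.
transitivity (\tsum_(x1, x2 <- Delta x) \tsum_(r1, r2 <- R) \tsum_(r1', r2' <- R)
  ((\tsum_(s, t <- R) \tsum_(s', t' <- R)
    (lam (S (S s * (S r1 * y * r1') * s') * (t * x1 * t')) : k^o) : k) *: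
    (r2 * x2 * r2'))).
  transitivity (\tsum_(s, t <- R) \tsum_(a, b <- Delta t)
    \tsum_(x1, x2 <- Delta x) \tsum_(s', t' <- R) \tsum_(a', b' <- Delta t')
    ((lam (S (S s * y * s') * (a * x1 * a')) : k) *: (b * x2 * b'))).
    apply: eq_tsum => s t.
    transitivity (\tsum_(s', t' <- R) \tsum_(X1, X2 <- Delta (t * x * t'))
        ((lam (S (S s * y * s') * X1) : k) *: X2)).
      by apply: eq_tsum => s' t'; rewrite cointegral_slide.
    transitivity (\tsum_(s', t' <- R) \tsum_(a, b <- Delta t) \tsum_(x1, x2 <- Delta x)
        \tsum_(a', b' <- Delta t')
        ((lam (S (S s * y * s') * (a * x1 * a')) : k) *: (b * x2 * b'))).
      apply: eq_tsum => s' t'; rewrite coprM_sum; last by mlin.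
      by rewrite coprM_sum //; mlin.
    rewrite exchange_tsum; apply: eq_tsum => a b.
    by rewrite exchange_tsum; apply: eq_tsum => x1 x2.
  rewrite (rmxDr_sum (T := fun s a b => \tsum_(x1, x2 <- Delta x)
    \tsum_(s', t' <- R) \tsum_(a', b' <- Delta t')
    ((lam (S (S s * y * s') * (a * x1 * a')) : k) *: (b * x2 * b')))); last by mlin.
  rewrite [RHS]exchange_tsum; apply: eq_tsum => r1 r2.
  transitivity (\tsum_(x1, x2 <- Delta x) \tsum_(s, t <- R) \tsum_(r1', r2' <- R)
    \tsum_(s', t' <- R)
    ((lam (S (S s * (S r1 * y * r1') * s') * (t * x1 * t')) : k) *: (r2 * x2 * r2'))).
    rewrite exchange_tsum; apply: eq_tsum => x1 x2; apply: eq_tsum => s t.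
    rewrite (rmxDr_sum (T := fun s' a' b' =>
      ((lam (S (S (r1 * s) * y * s') * (t * x1 * a')) : k) *: (r2 * x2 * b'))));
      last by mlin.
    by do 2!apply: eq_tsum => ? ?; rewrite antiM !mulrA.
  apply: eq_tsum => x1 x2; rewrite exchange_tsum; apply: eq_tsum => r1' r2'.
  rewrite (lin_of_tsum (f := fun c : k^o => (c : k) *: (r2 * x2 * r2'))); last by mlin.
  apply: eq_tsum => s t.
  by rewrite (lin_of_tsum (f := fun c : k^o => (c : k) *: (r2 * x2 * r2'))) //; mlin.
transitivity (\tsum_(x1, x2 <- Delta x) \tsum_(r1, r2 <- R) \tsum_(r1', r2' <- R)
  ((lam (S (r1 * x1) * (y * r1')) : k) *: (r2 * x2 * r2'))).
  apply: eq_tsum => x1 x2; do 2!apply: eq_tsum => ? ?.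
  by rewrite cointegral_braided_sym antiM !mulrA.
rewrite exchange_tsum (rmx_copr_sum (F := fun a b => \tsum_(r1', r2' <- R)
  ((lam (S a * (y * r1')) : k) *: (b * r2')))); last by mlin.
apply: eq_tsum => x1 x2.
transitivity (\tsum_(r1, r2 <- R) \tsum_(r1', r2' <- R)
  ((lam (S x2 * y * Si (r1 * S r1')) : k) *: (x1 * (r2 * r2')))).
  do 2!apply: eq_tsum => ? ?.
  by rewrite antiM -mulrA cointegral_cycV antiK antiVM antiK !mulrA.
rewrite (rmx_mulVr (F := fun a b => (lam (S x2 * y * Si a) : k) *: (x1 * b)));
  last by mlin.
by rewrite antiV1 !mulr1.
Qed.
End Drinfeld.

(** * Contraction of one leg of a tensor *)

Section Contraction.
Variable k : fieldType.
Implicit Types U V W X : vectType k.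

(** Unlike in [teval], the second factor is an arbitrary space, as needed for nested tensors such as
    F (x) (F (x) F). *)
Definition contr U W (t : tens (dual U) W) (u : U) : W :=
  \tsum_(f, w <- t) ((f u : k) *: w).

Lemma contrE U W (f : dual U) (w : W) u : contr (f \ox w) u = (f u : k) *: w.
Proof. by rewrite /contr tsumE //; mlin. Qed.

Lemma lin_contr U W X (h : X -> tens (dual U) W) u :
  linear h -> linear (fun x => contr (h x) u).
Proof. by move=> lh; rewrite /contr; mlin. Qed.

Lemma lin_contrr U W (t : tens (dual U) W) : linear (contr t).
Proof. by rewrite /contr; mlin. Qed.

Lemma lin_teval U V X (h : X -> tens (dual U) (dual V)) u v :
  linear h -> linear (fun x => teval (h x) u v).
Proof. by move=> lh; rewrite /teval; mlin. Qed.

Lemma teval_bilin U V (t : tens (dual U) (dual V)) : bilin (teval t).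
Proof. by rewrite /teval; mlin. Qed.

Lemma tevalC U V (t : tens (dual U) (dual V)) u v : teval t u v = (contr t u : dual V) v.
Proof.
rewrite /teval /contr (lin_of_tsum (f := fun h : dual V => h v)); last by mlin.
by apply: eq_tsum => f g; rewrite scale_lfunE.
Qed.

Lemma contr_inj U W (s t : tens (dual U) W) : (forall u, contr s u = contr t u) -> s = t.
Proof.
have E (r : tens (dual U) W) : r = \sum_i ebd i \ox contr r (eb i).
  apply: (tens_ext (f := id) (g := fun r => \sum_i ebd i \ox contr r (eb i))) r
    => [||f w] //.
    move=> a x y; rewrite scaler_sumr -big_split; apply: eq_bigr => i _ /=.
    by rewrite (lin_contr _ (@lin_id _ _)) (lin_purer _ (@lin_id _ _)).
  have ef : f = \sum_i (f (eb i) : k) *: ebd i.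
    apply/lfunP => x; rewrite sum_lfunE [in LHS](eb_sum x) linear_sum.
    by apply: eq_bigr => i _; rewrite linearZ scale_lfunE ebdE; apply: mulrC.
  rewrite [in LHS]ef -(linfunE' (lin_purel w (@lin_id _ _))) linear_sum.
  apply: eq_bigr => i _; rewrite contrE linearZ /= linfunE'; last by mlin.
  by rewrite (linZ _ _ (lin_purer _ (@lin_id _ _))).
by move=> e; rewrite (E s) (E t); apply: eq_bigr => i _; rewrite e.
Qed.
End Contraction.

Ltac flin_step :=
  match goal with
  | |- linear (fun x => contr _ ?u) => apply: lin_contr
  | |- linear (fun x => teval _ ?u ?v) => apply: lin_teval
  | |- linear (fun x => teval ?t _ ?v) => apply: (lin_bilinl v (teval_bilin t))
  | |- linear (fun x => teval ?t ?u _) => apply: (lin_bilinr u (teval_bilin t))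
  | |- linear (fun x => contr ?t _) => apply: (lin_comp (lin_contrr t))
  end.
Ltac flin := repeat first [flin_step | mlin_step | lin_step].

(** * Associativity, coassociativity and counit laws of F *)

Section Frobenius.
Variables (k : fieldType) (A : frHopf k).
Local Notation Delta := (copr A).
Local Notation S := (anti A).
Local Notation L := (integral A).
Local Notation lam := (cointegral A).
Local Notation F := (F A).
Local Notation K := (K A).
Local Notation tdual := (tens (dual A) (dual A)).
Implicit Types (a b h x y z : A) (W : vectType k).

Lemma mF_teval (t : btens F F) x :
  (mF A t : dual A) x = \tsum_(x1, x2 <- Delta x) teval (t : tdual) x2 x1.
Proof.
apply: (tens_ext (f := fun t => (mF A t : dual A) x)
  (g := fun t : tdual => \tsum_(x1, x2 <- Delta x) teval t x2 x1)) t => [||f g].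
- by flin.
- by flin.
by rewrite mFE; apply: eq_tsum => x1 x2; rewrite tevalE.
Qed.

Lemma DeltaF_contr (f : F) y x : (contr (DeltaF A f : tdual) y : dual A) x =
  \tsum_(x1, x2 <- Delta x) (((f : dual A) x1 : k^o) * lam (S x2 * y)).
Proof. by rewrite -tevalC DeltaFE. Qed.

Lemma mF_assoc : mF A \o tmap (mF A) \1 = mF A \o tmap \1 (mF A) \o assoc F F F.
Proof.
apply: hom_tens_ext => fg h; move: fg; apply: tens_ext; try by flin.
move=> f g; rewrite !comp_lfunE assocE !tmapE !id_lfunE; apply/lfunP => x.
rewrite !mFE.
transitivity (\tsum_(x3, y <- Delta x) \tsum_(x2, x1 <- Delta y)
  ((f x1 * (g : dual A) x2) * (h : dual A) x3 : k^o)).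
  apply: eq_tsum => x3 y; rewrite mFE.
  by rewrite (lin_of_tsum (f := fun c : k^o => c * h x3)); last by flin.
rewrite -(coassoc3 (T := fun x3 x2 x1 => ((f x1 * (g : dual A) x2) * (h : dual A) x3 : k^o)));
  last by flin.
apply: eq_tsum => y x1; rewrite mFE.
rewrite (lin_of_tsum (f := fun c : k^o => f x1 * c)); last by flin.
by apply: eq_tsum => x3 x2; rewrite mulrA.
Qed.

(** On elements both sides are f(x_1) times two values of lam, in one case with the coproduct of
    [y], in the other with a further coproduct of [x]; [cointegral_slide] exchanges them. *)
Lemma DeltaF_coassoc :
  assoc F F F \o tmap (DeltaF A) \1 \o DeltaF A = tmap \1 (DeltaF A) \o DeltaF A.
Proof.
apply/lfunP => f; rewrite !comp_lfunE; apply: contr_inj => z; apply: teval_inj => y x.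
have E1 (T : tdual) : teval (contr (assoc F F F (tmap (DeltaF A) \1 T)) z : tdual) y x =
    \tsum_(y1, y2 <- Delta y) (teval T y1 x * lam (S y2 * z) : k^o).
  apply: (tens_ext (f := fun T : tdual =>
      teval (contr (assoc F F F (tmap (DeltaF A) \1 T)) z : tdual) y x)
    (g := fun T : tdual => \tsum_(y1, y2 <- Delta y) (teval T y1 x * lam (S y2 * z) : k^o)))
    T => [||g h].
  - by flin.
  - by flin.
  rewrite tmapE id_lfunE.
  have E2 (U : tdual) : teval (contr (assoc F F F (U \ox h)) z : tdual) y x =
      (teval U z y * (h : dual A) x : k^o).
    apply: (tens_ext (f := fun U : tdual => teval (contr (assoc F F F (U \ox h)) z : tdual) y x)
      (g := fun U : tdual => teval U z y * (h : dual A) x : k^o)) U => [||g1 g2].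
    - by flin.
    - by flin.
    by rewrite assocE contrE (linZ _ _ (lin_teval _ _ (@lin_id _ _))) !tevalE; apply: mulrA.
  rewrite E2 DeltaFE (lin_of_tsum (f := fun c : k^o => c * h x)); last by flin.
  by apply: eq_tsum => y1 y2; rewrite tevalE mulrAC.
have E3 (T : tdual) : teval (contr (tmap \1 (DeltaF A) T) z : tdual) y x =
    \tsum_(x1, x2 <- Delta x) (teval T z x1 * lam (S x2 * y) : k^o).
  apply: (tens_ext (f := fun T : tdual =>
      teval (contr (tmap \1 (DeltaF A) T) z : tdual) y x)
    (g := fun T : tdual => \tsum_(x1, x2 <- Delta x) (teval T z x1 * lam (S x2 * y) : k^o)))
    T => [||g h].
  - by flin.
  - by flin.
  rewrite tmapE id_lfunE contrE (linZ _ _ (lin_teval _ _ (@lin_id _ _))) DeltaFE.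
  rewrite (lin_of_tsum (f := fun c : k^o => g z *: c)); last by flin.
  by apply: eq_tsum => x1 x2; rewrite tevalE; apply: mulrA.
rewrite E1 E3.
transitivity (\tsum_(x1, x' <- Delta x) \tsum_(x2, x3 <- Delta x')
  ((f : dual A) x1 * (lam (S x3 * y) * lam (S x2 * z)) : k^o)); last first.
  rewrite -(coassoc3 (T := fun x1 x2 x3 =>
    ((f : dual A) x1 * (lam (S x3 * y) * lam (S x2 * z)) : k^o))); last by flin.
  apply: eq_tsum => x' x3; rewrite DeltaFE.
  rewrite (lin_of_tsum (f := fun c : k^o => c * lam (S x3 * y))); last by flin.
  by apply: eq_tsum => x1 x2; rewrite mulrA mulrAC.
transitivity (\tsum_(x1, x' <- Delta x) \tsum_(y1, y2 <- Delta y)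
  ((f : dual A) x1 * (lam (S x' * y1) * lam (S y2 * z)) : k^o)).
  rewrite exchange_tsum; apply: eq_tsum => y1 y2; rewrite DeltaFE.
  rewrite (lin_of_tsum (f := fun c : k^o => c * lam (S y2 * z))); last by flin.
  by apply: eq_tsum => x1 x2; rewrite mulrA.
apply: eq_tsum => x1 x'.
have := congr1 (fun w => f x1 * lam (S w * z) : k^o) (cointegral_slide x' y).
rewrite !(lin_of_tsum (f := fun w => f x1 * lam (S w * z) : k^o)); try by flin.
move=> e; transitivity (\tsum_(y1, y2 <- Delta y)
    (f x1 * lam (S ((lam (S x' * y1) : k) *: y2) * z) : k^o)).
  by apply: eq_tsum => y1 y2; rewrite linearZ /= -scalerAl linearZ.
by rewrite e; apply: eq_tsum => x2 x3; rewrite linearZ /= -scalerAl linearZ.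
Qed.

(** The value at y is f(L_1) lam(S(L_2) y), which is f(y) by dual bases. *)
Lemma DeltaF_counitr : tmap \1 (epsF A) \o DeltaF A = Defs.unitrV F.
Proof.
have E (T : tdual) y : contr (tmap \1 (epsF A) T) y = teval T y L.
  apply: (tens_ext (f := fun T : tdual => contr (tmap \1 (epsF A) T) y)
    (g := fun T : tdual => teval T y L)) T => [||g h].
  - by flin.
  - by flin.
  by rewrite tmapE id_lfunE contrE tevalE /epsF linfunE' //; flin.
apply/lfunP => f; rewrite comp_lfunE unitrVE; apply: contr_inj => y.
rewrite E contrE DeltaFE.
transitivity ((f : dual A) y); last by rewrite [RHS]mulr1.
rewrite -{2}(integral_dualr y) hom_tsum.
by apply: eq_tsum => l1 l2; rewrite linearZ; apply: mulrC.
Qed.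

Lemma DeltaF_counitl : tmap (epsF A) \1 \o DeltaF A = unitlV F.
Proof.
have E (T : tdual) : unitl F (tmap (epsF A) \1 T) = contr T L.
  apply: (tens_ext (f := fun T : tdual => unitl F (tmap (epsF A) \1 T))
    (g := fun T : tdual => contr T L)) T => [||g h].
  - by flin.
  - by flin.
  by rewrite tmapE id_lfunE unitlE contrE /epsF linfunE' //; flin.
have unitlK (t : tens k^o F) : unitlV F (unitl F t) = t.
  apply: (tens_ext (f := fun t => unitlV F (unitl F t)) (g := id)) t => [||c f].
  - by flin.
  - by flin.
  rewrite unitlE unitlVE (linZ _ _ (lin_purer _ (@lin_id _ _))).
  rewrite -(linZ _ _ (lin_purel _ (@lin_id _ _))); congr (_ \ox _).
  exact: mulr1.
apply/lfunP => f; rewrite comp_lfunE -[LHS]unitlK; congr (unitlV F _).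
rewrite E; apply/lfunP => x; rewrite -tevalC DeltaFE.
rewrite -[RHS](cour_sum (f := fun y => (f : dual A) y)); last by flin.
apply: eq_tsum => x1 x2; rewrite (integral_l (fr_int A)) linearZ /=.
rewrite (coint_int (fr_int A)) cou_anti mulrC; congr (_ * _); exact: mulr1.
Qed.
End Frobenius.

(** * The morphism chi and its invariance under S_K, T_K, Q^K and O_K *)

Section Character.
Variables (k : fieldType) (A : frHopf k).
Local Notation Delta := (copr A).
Local Notation S := (anti A).
Local Notation Si := (antiV A).
Local Notation R := (rmx A).
Local Notation Ri := (rmxV A).
Local Notation Q := (monodromy R).
Local Notation Qi := (monodromyV Ri).
Local Notation v := (ribbon A).
Local Notation L := (integral A).
Local Notation lam := (cointegral A).
Local Notation F := (F A).
Local Notation K := (K A).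
Local Notation tdual := (tens (dual A) (dual A)).
Implicit Types (a b h x y z : A) (W : vectType k) (X Y : bimod A).

Lemma handle_pairing_slide W (G : A -> A -> W) x : bilin G ->
  \tsum_(x1, x2 <- Delta x) \tsum_(p1, p2 <- Qi) \tsum_(q1, q2 <- Q)
    ((lam (S x1 * (S p2 * (x2 * Si q2))) : k) *: G p1 q1) =
  \tsum_(x1, x2 <- Delta x) \tsum_(l1, l2 <- Delta L)
    G (l1 * Si x1) (S l2 * x2).
Proof.
move=> bG; rewrite handle_pairing //; apply: eq_tsum => x1 x2.
rewrite -(integral_sliderV (F := fun a b => G a (S b * x2))); last by mlin.
by apply: eq_tsum => l1 l2; rewrite antiM mulrA.
Qed.

(* In the paper's notation, [x |-> lam (S(x_1) S(a) x_2 S^-1(b))] with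
   [a = f(p_1) p_2] and [b = g(q_1) q_2]. *)
Definition chi : 'Hom(K, F) :=
  linfun (fun t : tdual => linfun (fun x : A =>
    \tsum_(x1, x2 <- Delta x) \tsum_(l1, l2 <- Delta L)
       teval t (l1 * Si x1) (S l2 * x2)) : dual A).

Lemma chiE (t : K) x : (chi t : dual A) x =
  \tsum_(x1, x2 <- Delta x) \tsum_(l1, l2 <- Delta L)
     teval (t : tdual) (l1 * Si x1) (S l2 * x2).
Proof.
have l (t' : tdual) : linear (fun x => \tsum_(x1, x2 <- Delta x)
  \tsum_(l1, l2 <- Delta L) teval t' (l1 * Si x1) (S l2 * x2)) by flin.
rewrite /chi linfunE'; first by rewrite linfunE'.
move=> c t1 t2; apply/lfunP => z; rewrite add_lfunE scale_lfunE !linfunE' //.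
have l2 : linear (fun t : tdual => \tsum_(x1, x2 <- Delta z)
  \tsum_(l1, l2 <- Delta L) teval t (l1 * Si x1) (S l2 * x2)) by flin.
exact: l2.
Qed.

Lemma lfun_tsum (U V X' Y' : vectType k) (t : tens X' Y') (b : X' -> Y' -> 'Hom(U, V)) (x : U) :
  tsum t b x = \tsum_(p, q <- t) (b p q x).
Proof. by apply: (lin_of_tsum (f := fun h : 'Hom(U, V) => h x)); lin. Qed.

Lemma QKE Y (f g : dual A) (y : Y) : QK Y ((f \ox g) \ox y) =
  \tsum_(p1, p2 <- Qi) \tsum_(q1, q2 <- Q)
    ((pmr p1 f \ox pml q1 g) \ox lact Y p2 (ract Y q2 y)).
Proof.
rewrite /QK comp_lfunE !lfun_tsum; apply: eq_tsum => p1 p2.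
rewrite hom_tsum; apply: eq_tsum => q1 q2.
by rewrite !tmapE !id_lfunE.
Qed.

Lemma OKE (f g f' g' : dual A) : OK A ((f \ox g) \ox (f' \ox g')) =
  \tsum_(p1, p2 <- Qi) \tsum_(q1, q2 <- Q)
    ((pmr p1 f \ox pml q1 g) \ox (pml (S p2) f' \ox pmr (Si q2) g')).
Proof.
rewrite /OK comp_lfunE !lfun_tsum; apply: eq_tsum => p1 p2.
rewrite hom_tsum; apply: eq_tsum => q1 q2.
by rewrite !tmapE !id_lfunE.
Qed.

Lemma F_lactE a (f : F) x : (lact F a f : dual A) x = (f : dual A) (S a * x).
Proof. by rewrite trE comp_lfunE amullE. Qed.
Lemma F_ractE a (f : F) x : (ract F a f : dual A) x = (f : dual A) (x * Si a).
Proof. by rewrite trE comp_lfunE amulrE. Qed.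

Lemma pmrE a (f : dual A) x : pmr a f x = f (x * a).
Proof. by rewrite trE comp_lfunE amulrE. Qed.
Lemma pmlE a (f : dual A) x : pml a f x = f (a * x).
Proof. by rewrite trE comp_lfunE amullE. Qed.

Lemma rhoKE (f g : dual A) (phi : F) x :
  (rhoK F ((f \ox g) \ox phi) : dual A) x =
  \tsum_(p1, p2 <- Qi) \tsum_(q1, q2 <- Q)
    (f p1 * g q1 * (phi : dual A) (S p2 * x * Si q2) : k^o).
Proof.
rewrite /rhoK 2!comp_lfunE QKE !hom_tsum lfun_tsum; apply: eq_tsum => p1 p2.
rewrite !hom_tsum lfun_tsum; apply: eq_tsum => q1 q2.
rewrite tmapE unitlE id_lfunE scale_lfunE F_lactE F_ractE.
congr (_ * _); rewrite /epsK tliftE tsumE; last by flin.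
by rewrite pmrE pmlE mul1r mulr1.
Qed.

(** Coassociativity splits off phi(x_1); what remains is lam(S(x_2) S(p_2) x_3 S^-1(q_2)) f(p_1)
    g(q_1), which [handle_pairing_slide] turns into the formula of [chi]. *)
Lemma handle_chi : handle A = mF A \o tmap chi \1.
Proof.
have E (f g : dual A) (T : tdual) x :
    (mF A (tmap (rhoK F) \1 (assocV K F F ((f \ox g) \ox T))) : dual A) x =
    \tsum_(x1, x2 <- Delta x) \tsum_(p1, p2 <- Qi) \tsum_(q1, q2 <- Q)
      (f p1 * g q1 * teval T (S p2 * x2 * Si q2) x1 : k^o).
  apply: (tens_ext (f := fun T : tdual =>
     (mF A (tmap (rhoK F) \1 (assocV K F F ((f \ox g) \ox T))) : dual A) x)
    (g := fun T : tdual => \tsum_(x1, x2 <- Delta x) \tsum_(p1, p2 <- Qi)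
      \tsum_(q1, q2 <- Q) (f p1 * g q1 * teval T (S p2 * x2 * Si q2) x1 : k^o))) T
      => [||h1 h2].
  - by flin.
  - by flin.
  rewrite assocVE tmapE id_lfunE mFE; apply: eq_tsum => x1 x2.
  rewrite rhoKE (lin_of_tsum (f := fun c : k^o => c * h2 x1)); last by flin.
  apply: eq_tsum => p1 p2.
  rewrite (lin_of_tsum (f := fun c : k^o => c * h2 x1)); last by flin.
  by apply: eq_tsum => q1 q2; rewrite tevalE !mulrA.
apply: hom_tens_ext => fg phi; move: fg; apply: tens_ext; try by flin.
move=> f g; rewrite !comp_lfunE !tmapE !id_lfunE; apply/lfunP => x.
rewrite E mFE.
transitivity (\tsum_(a, x' <- Delta x) \tsum_(b, c <- Delta x')
    \tsum_(p1, p2 <- Qi) \tsum_(q1, q2 <- Q)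
    ((lam (S b * (S p2 * (c * Si q2))) : k) *: ((phi : dual A) a * (f p1 * g q1) : k^o))).
  rewrite -(coassoc3 (T := fun a b c => \tsum_(p1, p2 <- Qi) \tsum_(q1, q2 <- Q)
    ((lam (S b * (S p2 * (c * Si q2))) : k) *: ((phi : dual A) a * (f p1 * g q1) : k^o))));
    last by flin.
  apply: eq_tsum => y c; rewrite [RHS]exchange_tsum; apply: eq_tsum => p1 p2.
  rewrite [RHS]exchange_tsum; apply: eq_tsum => q1 q2; rewrite DeltaFE.
  rewrite (lin_of_tsum (f := fun c : k^o => f p1 * g q1 * c)); last by flin.
  apply: eq_tsum => a b; rewrite mulrCA mulrA mulrC.
  by rewrite (mulrA (S p2)).
apply: eq_tsum => a x'.
rewrite (handle_pairing_slide (G := fun p q => (phi : dual A) a * (f p * g q) : k^o));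
  last by flin.
rewrite chiE (lin_of_tsum (f := fun c : k^o => c * (phi : dual A) a)); last by flin.
apply: eq_tsum => x1 x2.
rewrite (lin_of_tsum (f := fun c : k^o => c * (phi : dual A) a)); last by flin.
by apply: eq_tsum => l1 l2; rewrite tevalE mulrC.
Qed.

(** The cointegral on the first leg of S_K meets L_1, and the dual-basis property eliminates L. This
    leaves lam(S(x_1) S(p_2) x_2 S^-1(q_2)) f(p_1) g(q_1), again chi by [handle_pairing_slide]. *)
Lemma chi_SK : chi \o SK A = chi.
Proof.
apply: hom_tens_ext => f g; rewrite comp_lfunE; apply/lfunP => x.
rewrite !chiE.
transitivity (\tsum_(x1, x2 <- Delta x) \tsum_(p1, p2 <- Qi) \tsum_(q1, q2 <- Q)
    ((lam (S x1 * (S p2 * (x2 * Si q2))) : k) *: (f p1 * g q1 : k^o))); last first.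
  rewrite (handle_pairing_slide (G := fun p q => f p * g q : k^o)); last by flin.
  by do 2!apply: eq_tsum => ? ?; rewrite tevalE.
apply: eq_tsum => x1 x2.
transitivity (\tsum_(l1, l2 <- Delta L) \tsum_(p1, p2 <- Qi) \tsum_(q1, q2 <- Q)
   (f p1 * g q1 * (lam (S p2 * (l1 * Si x1)) * lam (S l2 * x2 * Si q2)) : k^o)).
  apply: eq_tsum => l1 l2; rewrite SKE.
  rewrite (lin_of_tsum (f := fun c : k^o => c *
     \tsum_(q1, q2 <- Q) (g q1 * lam (S l2 * x2 * Si q2) : k^o))); last by flin.
  apply: eq_tsum => p1 p2.
  rewrite (lin_of_tsum (f := fun c : k^o => f p1 * lam (S p2 * (l1 * Si x1)) * c));
    last by flin.
  by apply: eq_tsum => q1 q2; rewrite mulrACA.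
rewrite exchange_tsum; apply: eq_tsum => p1 p2.
rewrite exchange_tsum; apply: eq_tsum => q1 q2.
rewrite -(integral_sliderV (F := fun a b =>
   (f p1 * g q1 * (lam (S p2 * a) * lam (S b * x2 * Si q2)) : k^o))); last by flin.
have e := integral_dual (Si (S p2)); rewrite antiVK in e.
have := congr1 (fun z => f p1 * g q1 * lam (S x1 * (S z * (x2 * Si q2))) : k^o) e.
rewrite !(lin_of_tsum (f := fun z => f p1 * g q1 * lam (S x1 * (S z * (x2 * Si q2))) : k^o));
  last by flin.
rewrite antiVK => e'.
transitivity (f p1 * g q1 * lam (S x1 * (S p2 * (x2 * Si q2)))); last by apply: mulrC.
rewrite -e'; apply: eq_tsum => l1 l2.
have lz : linear (fun z => lam (S x1 * (S z * (x2 * Si q2))) : k^o) by flin.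
by rewrite (linZ _ _ lz) antiM -!(mulrA (S x1)) -(mulrA (S l2)).
Qed.

(** v slides from L_1 to L_2 as S^-1(v); the antipode on L_2 restores v, which is central and meets
    v^-1. *)
Lemma chi_TK : chi \o TK A = chi.
Proof.
have [vU vC Sv _ _] := fr_ribbon A.
apply/lfunP => t; rewrite comp_lfunE; apply/lfunP => x; rewrite !chiE.
apply: eq_tsum => x1 x2.
transitivity (\tsum_(l1, l2 <- Delta L)
   teval (t : tdual) (v * l1 * Si x1) (S l2 * x2 * v^-1%R)).
  by apply: eq_tsum => l1 l2; rewrite teval_tr amullE amulrE mulrA.
rewrite (integral_slidel (F := fun a b =>
   teval (t : tdual) (a * Si x1) (S b * x2 * v^-1%R))); last by flin.
apply: eq_tsum => l1 l2.
by rewrite antiM antiVK -(mulrA (S l2)) vC mulrA mulrK.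
Qed.

(** q_1 slides through L to the first leg, where it becomes S^-2(q_1) and [monodromy_cancel]
    applies. The generic [T] serves Q^K and O_K alike. *)
Lemma monodromy_cancel_integral W (T : A -> A -> A -> W) x : trilin T ->
  \tsum_(x1, x' <- Delta x) \tsum_(a, b <- Delta x')
  \tsum_(p1, p2 <- Qi) \tsum_(q1, q2 <- Q) \tsum_(l1, l2 <- Delta L)
    T (l1 * Si a * p1) (q1 * (S l2 * b)) (S p2 * x1 * Si q2) =
  \tsum_(x1, x' <- Delta x) \tsum_(a, b <- Delta x') \tsum_(l1, l2 <- Delta L)
    T (l1 * Si a) (S l2 * b) x1.
Proof.
move=> tT.
rewrite -(coassoc3 (T := fun x1 a b => \tsum_(p1, p2 <- Qi) \tsum_(q1, q2 <- Q)
  \tsum_(l1, l2 <- Delta L)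
    T (l1 * Si a * p1) (q1 * (S l2 * b)) (S p2 * x1 * Si q2))); last by mlin.
rewrite -(coassoc3 (T := fun x1 a b => \tsum_(l1, l2 <- Delta L)
    T (l1 * Si a) (S l2 * b) x1)); last by mlin.
apply: eq_tsum => y b.
rewrite -(monodromy_cancel (F := fun u w => \tsum_(l1, l2 <- Delta L)
    T (l1 * u) (S l2 * b) w)); last by mlin.
apply: eq_tsum => x1 a; apply: eq_tsum => p1 p2; apply: eq_tsum => q1 q2.
transitivity (\tsum_(l1, l2 <- Delta L)
    T (l1 * (Si a * p1)) (S (l2 * Si q1) * b) (S p2 * x1 * Si q2)).
  by apply: eq_tsum => l1 l2; rewrite antiM antiVK !mulrA.
rewrite (integral_sliderV (F := fun l1 l2 =>
    T (l1 * (Si a * p1)) (S l2 * b) (S p2 * x1 * Si q2))); last by mlin.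
by apply: eq_tsum => l1 l2; rewrite !mulrA.
Qed.

Lemma chi_QK : mF A \o tmap chi \1 \o QK F = mF A \o tmap chi \1.
Proof.
apply: hom_tens_ext => fg phi; move: fg; apply: tens_ext; try by flin.
move=> f g; rewrite 3!comp_lfunE QKE tmapE id_lfunE; apply/lfunP => x.
rewrite !hom_tsum lfun_tsum.
transitivity (\tsum_(x1, x' <- Delta x) \tsum_(a, b <- Delta x')
  \tsum_(p1, p2 <- Qi) \tsum_(q1, q2 <- Q) \tsum_(l1, l2 <- Delta L)
    (f (l1 * Si a * p1) * g (q1 * (S l2 * b)) *
     (phi : dual A) (S p2 * x1 * Si q2) : k^o)).
  transitivity (\tsum_(p1, p2 <- Qi) \tsum_(q1, q2 <- Q)
    \tsum_(x1, x' <- Delta x) \tsum_(a, b <- Delta x') \tsum_(l1, l2 <- Delta L)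
    (f (l1 * Si a * p1) * g (q1 * (S l2 * b)) *
     (phi : dual A) (S p2 * x1 * Si q2) : k^o)).
    apply: eq_tsum => p1 p2; rewrite !hom_tsum lfun_tsum; apply: eq_tsum => q1 q2.
    rewrite tmapE id_lfunE mFE; apply: eq_tsum => x1 x'.
    rewrite chiE F_lactE F_ractE.
    rewrite (lin_of_tsum (f := fun c : k^o => c * (phi : dual A) (S p2 * x1 * Si q2)));
      last by flin.
    apply: eq_tsum => a b.
    rewrite (lin_of_tsum (f := fun c : k^o => c * (phi : dual A) (S p2 * x1 * Si q2)));
      last by flin.
    by apply: eq_tsum => l1 l2; rewrite tevalE pmrE pmlE.
  transitivity (\tsum_(p1, p2 <- Qi)
    \tsum_(x1, x' <- Delta x) \tsum_(a, b <- Delta x') \tsum_(q1, q2 <- Q) \tsum_(l1, l2 <- Delta L)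
    (f (l1 * Si a * p1) * g (q1 * (S l2 * b)) *
     (phi : dual A) (S p2 * x1 * Si q2) : k^o)).
    apply: eq_tsum => p1 p2; rewrite exchange_tsum; apply: eq_tsum => x1 x'.
    by rewrite exchange_tsum.
  rewrite exchange_tsum; apply: eq_tsum => x1 x'.
  by rewrite exchange_tsum.
rewrite (monodromy_cancel_integral (T := fun a b c => f a * g b * (phi : dual A) c : k^o));
  last by flin.
rewrite mFE; apply: eq_tsum => x1 x'; rewrite chiE.
rewrite (lin_of_tsum (f := fun c : k^o => c * (phi : dual A) x1)); last by flin.
apply: eq_tsum => a b.
rewrite (lin_of_tsum (f := fun c : k^o => c * (phi : dual A) x1)); last by flin.
by apply: eq_tsum => l1 l2; rewrite tevalE.
Qed.

Lemma chi_OK : mF A \o tmap chi chi \o OK A = mF A \o tmap chi chi.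
Proof.
apply: hom_tens_ext => fg fg'; move: fg; apply: tens_ext; try by flin.
move=> f g; move: fg'; apply: tens_ext; try by flin.
move=> f' g'; rewrite 3!comp_lfunE OKE tmapE; apply/lfunP => x.
rewrite !hom_tsum lfun_tsum.
(* The second handle is part of [T]: [c] is the component of x that Q leaves alone, [w] the one on
   which it acts. *)
pose T c u u' w : k^o := f u * g u' *
  \tsum_(m1, m2 <- Delta L) (f' (m1 * Si c) * g' (S m2 * w) : k^o).
have T3 c : trilin (T c) by rewrite /T; flin.
transitivity (\tsum_(x1, x2 <- Delta x) \tsum_(c, d <- Delta x1) \tsum_(a, b <- Delta x2)
  \tsum_(p1, p2 <- Qi) \tsum_(q1, q2 <- Q) \tsum_(l1, l2 <- Delta L)
  T c (l1 * Si a * p1) (q1 * (S l2 * b)) (S p2 * d * Si q2)).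
  transitivity (\tsum_(p1, p2 <- Qi) \tsum_(q1, q2 <- Q)
    \tsum_(x1, x2 <- Delta x) \tsum_(c, d <- Delta x1) \tsum_(a, b <- Delta x2)
    \tsum_(l1, l2 <- Delta L)
    T c (l1 * Si a * p1) (q1 * (S l2 * b)) (S p2 * d * Si q2)).
    apply: eq_tsum => p1 p2; rewrite !hom_tsum lfun_tsum; apply: eq_tsum => q1 q2.
    rewrite tmapE mFE; apply: eq_tsum => x1 x2; rewrite exchange_tsum !chiE.
    rewrite (lin_of_tsum (f := fun z : k^o => z * _)); last by flin.
    apply: eq_tsum => a b; rewrite [RHS]exchange_tsum.
    rewrite (lin_of_tsum (f := fun z : k^o => z * _)); last by flin.
    apply: eq_tsum => l1 l2; rewrite tevalE pmrE pmlE.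
    rewrite (lin_of_tsum (f := fun z : k^o => f (l1 * Si a * p1) * g (q1 * (S l2 * b)) * z));
      last by flin.
    apply: eq_tsum => c d; rewrite /T; congr (_ * _).
    (* S(p_2) slides through the second integral, so that the second handle sees p_2 and q_2 only
       through S(p_2) d S^-1(q_2), as [phi] does in [chi_QK]. *)
    transitivity (\tsum_(m1, m2 <- Delta L)
      (f' (S p2 * m1 * Si c) * g' (S m2 * d * Si q2) : k^o)).
      by apply: eq_tsum => m1 m2; rewrite tevalE pmlE pmrE mulrA.
    rewrite (integral_slidel (F := fun m1 m2 =>
      (f' (m1 * Si c) * g' (S m2 * d * Si q2) : k^o))); last by flin.
    by apply: eq_tsum => m1 m2; rewrite antiM antiVK !mulrA.
  under eq_tsum => p1 p2.
    rewrite exchange_tsum; under eq_tsum => x1 x2.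
      rewrite exchange_tsum; under eq_tsum => c d do rewrite exchange_tsum.
      over.
    over.
  rewrite exchange_tsum; apply: eq_tsum => x1 x2.
  rewrite exchange_tsum; apply: eq_tsum => c d.
  by rewrite exchange_tsum.
rewrite (coassoc3 (T := fun c d x2 => \tsum_(a, b <- Delta x2)
  \tsum_(p1, p2 <- Qi) \tsum_(q1, q2 <- Q) \tsum_(l1, l2 <- Delta L)
  T c (l1 * Si a * p1) (q1 * (S l2 * b)) (S p2 * d * Si q2))); last by rewrite /T; flin.
transitivity (\tsum_(c, y <- Delta x) \tsum_(d, x2 <- Delta y) \tsum_(a, b <- Delta x2)
  \tsum_(l1, l2 <- Delta L) T c (l1 * Si a) (S l2 * b) d).
  by apply: eq_tsum => c y; apply: monodromy_cancel_integral.
rewrite -(coassoc3 (T := fun c d x2 => \tsum_(a, b <- Delta x2)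
  \tsum_(l1, l2 <- Delta L) T c (l1 * Si a) (S l2 * b) d)); last by rewrite /T; flin.
rewrite mFE; apply: eq_tsum => x1 x2.
rewrite exchange_tsum !chiE.
rewrite (lin_of_tsum (f := fun z : k^o => z * _)); last by flin.
apply: eq_tsum => a b; rewrite [LHS]exchange_tsum.
rewrite (lin_of_tsum (f := fun z : k^o => z * _)); last by flin.
apply: eq_tsum => l1 l2; rewrite tevalE.
rewrite (lin_of_tsum (f := fun z : k^o => f (l1 * Si a) * g (S l2 * b) * z)); last by flin.
by apply: eq_tsum => c d; congr (_ * _); apply: eq_tsum => m1 m2; rewrite tevalE.
Qed.
End Character.

(** * Invertibility of S_K, cocommutativity of F, and bimodule morphisms *)

Section Morphisms.
Variables (k : fieldType) (A : frHopf k).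
Local Notation Delta := (copr A).
Local Notation eps := (cou A).
Local Notation S := (anti A).
Local Notation Si := (antiV A).
Local Notation R := (rmx A).
Local Notation Ri := (rmxV A).
Local Notation Q := (monodromy R).
Local Notation Qi := (monodromyV Ri).
Local Notation L := (integral A).
Local Notation lam := (cointegral A).
Local Notation F := (F A).
Local Notation K := (K A).
Local Notation tdual := (tens (dual A) (dual A)).
Implicit Types (a b h x y z : A) (W : vectType k) (X Y Z : bimod A).

Lemma SK_teval (t : K) y z : teval (SK A t : tdual) y z =
  \tsum_(p1, p2 <- Qi) \tsum_(q1, q2 <- Q)
    (lam (S p2 * y) * (lam (z * Si q2) * teval (t : tdual) p1 q1) : k^o).
Proof.
apply: (tens_ext (f := fun t : tdual => teval (SK A t : tdual) y z)
  (g := fun t : tdual => \tsum_(p1, p2 <- Qi) \tsum_(q1, q2 <- Q)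
    (lam (S p2 * y) * (lam (z * Si q2) * teval t p1 q1) : k^o))) t => [||f g].
- by flin.
- by flin.
rewrite SKE (lin_of_tsum (f := fun c : k^o => c * _)); last by flin.
apply: eq_tsum => p1 p2.
rewrite (lin_of_tsum (f := fun c : k^o => f p1 * lam (S p2 * y) * c)); last by flin.
by apply: eq_tsum => q1 q2; rewrite tevalE mulrACA [RHS]mulrA [RHS]mulrC.
Qed.

(** [t] is recovered from its image. Both arguments are expanded in dual bases, [monodromy_pairing]
    replaces each of the two copies of L, and the resulting values of lam recombine to those of S_K.
    Injectivity makes [(SK A)^-1] a genuine inverse. *)
Lemma SK_inj : injective (SK A).
Proof.
have inv (t : K) y z : teval (t : tdual) y z =
    \tsum_(b1, b2 <- Qi) \tsum_(a1, a2 <- Q)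
      (lam (a1 * y) * lam (z * b1) * teval (SK A t : tdual) (Si a2) (S b2) : k^o).
  transitivity (\tsum_(l1, l2 <- Delta L) \tsum_(m1, m2 <- Delta L)
     (lam (S l2 * y) * lam (z * m1) * teval (t : tdual) l1 (S m2) : k^o)).
    rewrite -{1}(integral_dualr y).
    rewrite (lin_of_tsum (f := fun y => teval (t : tdual) y z)); last by flin.
    apply: eq_tsum => l1 l2.
    rewrite (linZ _ _ (f := fun y => teval (t : tdual) y z)); last by flin.
    have e := integral_dual (Si z); rewrite antiVK in e.
    rewrite -[in LHS](antiVK z) -e.
    rewrite (lin_of_tsum (f := fun u => lam (S l2 * y) *: teval (t : tdual) l1 (S u)));
      last by flin.
    apply: eq_tsum => m1 m2; rewrite linearZ /=.
    rewrite (linZ _ _ (f := fun z => teval (t : tdual) l1 z)); last by flin.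
    exact: mulrA.
  transitivity (\tsum_(m1, m2 <- Delta L) \tsum_(p1, p2 <- Qi) \tsum_(a1, a2 <- Q)
     ((lam (S p2 * Si a2) : k) *:
       (lam (a1 * y) * lam (z * m1) * teval (t : tdual) p1 (S m2) : k^o))).
    rewrite exchange_tsum; apply: eq_tsum => m1 m2.
    by rewrite (monodromy_pairing (F := fun a b =>
      (lam (b * y) * lam (z * m1) * teval (t : tdual) a (S m2) : k^o))) //; flin.
  transitivity (\tsum_(p1, p2 <- Qi) \tsum_(a1, a2 <- Q) \tsum_(b1, b2 <- Qi)
     \tsum_(q1, q2 <- Q) ((lam (S b2 * Si q2) : k) *: ((lam (S p2 * Si a2) : k) *:
       (lam (a1 * y) * lam (z * b1) * teval (t : tdual) p1 q1 : k^o)))).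
    rewrite exchange_tsum; apply: eq_tsum => p1 p2.
    rewrite exchange_tsum; apply: eq_tsum => a1 a2.
    by rewrite (monodromy_pairing (F := fun a b => ((lam (S p2 * Si a2) : k) *:
      (lam (a1 * y) * lam (z * a) * teval (t : tdual) p1 b : k^o)))) //; flin.
  transitivity (\tsum_(b1, b2 <- Qi) \tsum_(a1, a2 <- Q) \tsum_(p1, p2 <- Qi)
     \tsum_(q1, q2 <- Q) ((lam (S b2 * Si q2) : k) *: ((lam (S p2 * Si a2) : k) *:
       (lam (a1 * y) * lam (z * b1) * teval (t : tdual) p1 q1 : k^o)))).
    transitivity (\tsum_(p1, p2 <- Qi) \tsum_(b1, b2 <- Qi) \tsum_(a1, a2 <- Q)
     \tsum_(q1, q2 <- Q) ((lam (S b2 * Si q2) : k) *: ((lam (S p2 * Si a2) : k) *: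
       (lam (a1 * y) * lam (z * b1) * teval (t : tdual) p1 q1 : k^o)))).
      by apply: eq_tsum => p1 p2; rewrite exchange_tsum.
    by rewrite exchange_tsum; apply: eq_tsum => b1 b2; rewrite exchange_tsum.
  apply: eq_tsum => b1 b2; apply: eq_tsum => a1 a2; rewrite SK_teval.
  rewrite (lin_of_tsum (f := fun c : k^o => lam (a1 * y) * lam (z * b1) * c));
    last by flin.
  apply: eq_tsum => p1 p2.
  rewrite (lin_of_tsum (f := fun c : k^o => lam (a1 * y) * lam (z * b1) * c));
    last by flin.
  apply: eq_tsum => q1 q2.
  rewrite [in RHS](mulrCA (lam (S p2 * Si a2))) [RHS]mulrCA; congr (_ * _).
  by rewrite [RHS]mulrCA.
by move=> s t e; apply: teval_inj => y z; rewrite inv e -inv.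
Qed.

Lemma SK_invr : SK A \o (SK A)^-1 = \1.
Proof.
by apply/lfunP => t; rewrite comp_lfunE id_lfunE lker0_lfunVK //; apply/lker0P; apply: SK_inj.
Qed.

Lemma lact2_teval (s : tens A A) (t : btens F F) y x :
  teval (lact2 F F s t : tdual) y x =
  \tsum_(a, b <- s) teval (t : tdual) (S a * y) (S b * x).
Proof.
rewrite /lact2 lfun_tsum (lin_of_tsum (f := fun u : tdual => teval u y x)); last by flin.
by apply: eq_tsum => a b; rewrite teval_tr !amullE.
Qed.

Lemma ract2_teval (s : tens A A) (t : btens F F) y x :
  teval (ract2 F F s t : tdual) y x =
  \tsum_(a, b <- s) teval (t : tdual) (y * Si a) (x * Si b).
Proof.
rewrite /ract2 lfun_tsum (lin_of_tsum (f := fun u : tdual => teval u y x)); last by flin.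
by apply: eq_tsum => a b; rewrite teval_tr !amulrE.
Qed.

Lemma tflip_teval (t : btens F F) y x :
  teval (tflip F F t : tdual) y x = teval (t : tdual) x y.
Proof.
apply: (tens_ext (f := fun t : tdual => teval (tflip F F t : tdual) y x)
  (g := fun t : tdual => teval t x y)) t => [||f g].
- by flin.
- by flin.
by rewrite tflipE !tevalE mulrC.
Qed.

(** The actions on F enter through S and S^-1, which R absorbs when they hit both legs; the rest is
    f applied to [cointegral_cocomm]. *)
Lemma DeltaF_cocomm : braid F F \o DeltaF A = DeltaF A.
Proof.
apply/lfunP => f; apply: teval_inj => y x.
rewrite comp_lfunE /braid 2!comp_lfunE lact2_teval DeltaFE.
transitivity (\tsum_(s, t <- R) \tsum_(s', t' <- R)
    \tsum_(y1, y2 <- Delta (S s * y * s'))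
    ((f : dual A) y1 * lam (S y2 * (t * x * t')) : k^o)).
  rewrite tsum_rmxV_l; last by rewrite /=; flin.
  rewrite -[RHS](tsum_rmx_anti (F := fun s t => \tsum_(s', t' <- R)
    \tsum_(y1, y2 <- Delta (S s * y * s'))
    ((f : dual A) y1 * lam (S y2 * (t * x * t')) : k^o))); last by flin.
  apply: eq_tsum => s t; rewrite ract2_teval.
  rewrite -[RHS](tsum_rmx_antiV (F := fun s' t' =>
    \tsum_(y1, y2 <- Delta (S (S s) * y * s'))
    ((f : dual A) y1 * lam (S y2 * (S t * x * t')) : k^o))); last by flin.
  by apply: eq_tsum => s' t'; rewrite tflip_teval DeltaFE.
have := congr1 (f : dual A) (cointegral_cocomm x y).
rewrite !hom_tsum => e.
transitivity (\tsum_(x1, x2 <- Delta x) ((f : dual A) ((lam (S x2 * y) : k) *: x1))).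
  rewrite -e; apply: eq_tsum => s t; rewrite hom_tsum; apply: eq_tsum => s' t'.
  by rewrite hom_tsum; apply: eq_tsum => y1 y2; rewrite linearZ; apply: mulrC.
by apply: eq_tsum => x1 x2; rewrite linearZ; apply: mulrC.
Qed.

(** The left action multiplies by S(v) = v, the right one by S^-1(v^-1) = v^-1, and v is central. *)
Lemma twist_F : twist F = \1.
Proof.
have [vU vC Sv _ _] := fr_ribbon A.
apply/lfunP => f; rewrite /twist comp_lfunE id_lfunE; apply/lfunP => x.
by rewrite F_lactE F_ractE antiVv Sv vC mulrK.
Qed.

Lemma bimod_homP X Y (f : 'Hom(X, Y)) :
  (forall a u, f (lact X a u) = lact Y a (f u)) ->
  (forall a u, f (ract X a u) = ract Y a (f u)) -> bimod_hom f.
Proof. by move=> fl fr a; split; apply/lfunP => x; rewrite !comp_lfunE. Qed.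

Lemma bimod_hom_lact X Y (f : 'Hom(X, Y)) a u :
  bimod_hom f -> f (lact X a u) = lact Y a (f u).
Proof. by move=> /(_ a)[/lfunP/(_ u)]; rewrite !comp_lfunE. Qed.

Lemma bimod_hom_ract X Y (f : 'Hom(X, Y)) a u :
  bimod_hom f -> f (ract X a u) = ract Y a (f u).
Proof. by move=> /(_ a)[_ /lfunP/(_ u)]; rewrite !comp_lfunE. Qed.

Lemma bimod_hom_comp X Y Z (g : 'Hom(Y, Z)) (f : 'Hom(X, Y)) :
  bimod_hom g -> bimod_hom f -> bimod_hom (g \o f).
Proof.
move=> hg hf; apply: bimod_homP => a x; rewrite !comp_lfunE.
  by rewrite !bimod_hom_lact.
by rewrite !bimod_hom_ract.
Qed.

Lemma bimod_hom_id X : bimod_hom (\1 : 'End(X)).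
Proof. by move=> a; rewrite !comp_lfun1l !comp_lfun1r. Qed.

Lemma bimod_hom_tmap X Y X' Y' (f : 'Hom(X, X')) (g : 'Hom(Y, Y')) :
  bimod_hom f -> bimod_hom g ->
  bimod_hom (tmap f g : 'Hom(btens X Y, btens X' Y')).
Proof.
move=> hf hg a; split; apply: hom_tens_ext => x y; rewrite !comp_lfunE tmapE /=.
  rewrite /lact2 !lfun_tsum hom_tsum; apply: eq_tsum => b c.
  by rewrite !tmapE !bimod_hom_lact.
rewrite /ract2 !lfun_tsum hom_tsum; apply: eq_tsum => b c.
by rewrite !tmapE !bimod_hom_ract.
Qed.

Lemma mF_hom : bimod_hom (mF A).
Proof.
apply: bimod_homP => a t; apply/lfunP => x; rewrite mF_teval.
  rewrite F_lactE mF_teval coprM_sum; last by flin.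
  rewrite tsum_copr_anti; last by flin.
  rewrite exchange_tsum; apply: eq_tsum => x1 x2.
  by rewrite lact2_teval.
rewrite F_ractE mF_teval coprM_sum; last by flin.
apply: eq_tsum => x1 x2.
by rewrite ract2_teval tsum_copr_antiV //; flin.
Qed.

(** For either action an antipode identity is inserted next to [y]. The right action also needs the
    quantum trace property, to carry a factor around lam. *)
Lemma DeltaF_hom : bimod_hom (DeltaF A).
Proof.
apply: bimod_homP => a f; apply: teval_inj => y x; rewrite DeltaFE.
  rewrite lact2_teval.
  transitivity (\tsum_(a1, a2 <- Delta a) \tsum_(b, c <- Delta a2)
     \tsum_(x1, x2 <- Delta x)
     ((f : dual A) (S c * x1) * lam (S x2 * (S (a1 * S b) * y)) : k^o)); last first.
    apply: eq_tsum => a1 a2; rewrite DeltaFE coprM_sum; last by flin.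
    rewrite tsum_copr_anti; last by flin.
    by do 2!apply: eq_tsum => ? ?; rewrite !antiM !mulrA.
  rewrite -(coassoc3 (T := fun a1 b c => \tsum_(x1, x2 <- Delta x)
     ((f : dual A) (S c * x1) * lam (S x2 * (S (a1 * S b) * y)) : k^o))); last by flin.
  transitivity (\tsum_(x1, x2 <- Delta x) ((f : dual A) (S a * x1) * lam (S x2 * y) : k^o)).
    by apply: eq_tsum => x1 x2; rewrite F_lactE.
  rewrite -[LHS](coul_sum (f := fun a => \tsum_(x1, x2 <- Delta x)
     ((f : dual A) (S a * x1) * lam (S x2 * y) : k^o))); last by flin.
  apply: eq_tsum => a' c; rewrite [RHS]exchange_tsum.
  rewrite (lin_of_tsum _ _ (@lin_scaler _ _ _ _ id _)) //; apply: eq_tsum => x1 x2.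
  rewrite -[in LHS](mul1r y) -[in LHS](anti1 A).
  by rewrite -(antir_sum (f := fun z => (f : dual A) (S c * x1) * lam (S x2 * (S z * y)) : k^o)) //; flin.
rewrite ract2_teval.
transitivity (\tsum_(a1, a2 <- Delta a) \tsum_(b, c <- Delta a2)
   \tsum_(x1, x2 <- Delta x)
   ((f : dual A) (x1 * Si c) * lam (S x2 * (y * Si (Si b * a1))) : k^o)); last first.
  apply: eq_tsum => a1 a2; rewrite DeltaFE coprM_sum; last by flin.
  rewrite [RHS]exchange_tsum tsum_copr_antiV; last by flin.
  do 2!apply: eq_tsum => ? ?; congr (_ * _).
  by rewrite antiM antiVK -mulrA [RHS]cointegral_cycV !antiVM !mulrA.
rewrite -(coassoc3 (T := fun a1 b c => \tsum_(x1, x2 <- Delta x)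
   ((f : dual A) (x1 * Si c) * lam (S x2 * (y * Si (Si b * a1))) : k^o))); last by flin.
transitivity (\tsum_(x1, x2 <- Delta x) ((f : dual A) (x1 * Si a) * lam (S x2 * y) : k^o)).
  by apply: eq_tsum => x1 x2; rewrite F_ractE.
rewrite -[LHS](coul_sum (f := fun a => \tsum_(x1, x2 <- Delta x)
   ((f : dual A) (x1 * Si a) * lam (S x2 * y) : k^o))); last by flin.
apply: eq_tsum => a' c; rewrite [RHS]exchange_tsum.
rewrite (lin_of_tsum _ _ (@lin_scaler _ _ _ _ id _)) //; apply: eq_tsum => x1 x2.
rewrite -[in LHS](mulr1 y) -[in LHS](antiV1 A).
by rewrite -(antiVl_sum (f := fun z => (f : dual A) (x1 * Si c) * lam (S x2 * (y * Si z)) : k^o)) //; flin.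
Qed.

Lemma etaF_hom : bimod_hom (etaF A).
Proof.
have e a (c : k^o) : eps_act a c = eps a * c.
  by rewrite /eps_act scale_lfunE id_lfunE.
apply: bimod_homP => a c; apply/lfunP => x; rewrite /etaF !pointE /= e.
  rewrite -[tr _]/(lact F a) F_lactE !scale_lfunE couM cou_anti.
  by rewrite (mulrC (eps a)); symmetry; apply: mulrA.
rewrite -[tr _]/(ract F a) F_ractE !scale_lfunE couM cou_antiV.
change (eps a * c * eps x = c * (eps x * eps a) :> k).
by rewrite mulrAC mulrC (mulrC (eps x)).
Qed.

Lemma epsF_hom : bimod_hom (epsF A).
Proof.
have E (f : F) : epsF A f = (f : dual A) L by rewrite /epsF linfunE' //; flin.
apply: bimod_homP => a f; rewrite !E /= /eps_act scale_lfunE id_lfunE.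
  by rewrite F_lactE (integral_l (fr_int A)) linearZ cou_anti.
by rewrite F_ractE (integral_r (fr_int A)) linearZ cou_antiV.
Qed.

Lemma K_lact_teval a (t : K) y z : teval (lact K a t : tdual) y z =
  \tsum_(a1, a2 <- Delta a) teval (t : tdual) (S a1 * y * a2) z.
Proof.
rewrite /= /K_lact -(tr1 A) teval_tr adlE id_lfunE.
by rewrite (lin_of_tsum (f := fun y => teval (t : tdual) y z)) //; flin.
Qed.

Lemma K_ract_teval a (t : K) y z : teval (ract K a t : tdual) y z =
  \tsum_(a1, a2 <- Delta a) teval (t : tdual) y (a2 * z * Si a1).
Proof.
rewrite /= /K_ract -(tr1 A) teval_tr adrE id_lfunE.
by rewrite (lin_of_tsum (f := fun z => teval (t : tdual) y z)) //; flin.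
Qed.

(** K carries adjoint actions. Sliding one of the two factors from a through L brings both next to
    the components of x, where they complete the coproduct of S(a) x or of x S^-1(a). *)
Lemma chi_hom : bimod_hom (chi A).
Proof.
apply: bimod_homP => a t; apply/lfunP => x.
  rewrite F_lactE !chiE coprM_sum; last by flin.
  rewrite tsum_copr_anti; last by flin.
  rewrite [RHS]exchange_tsum; apply: eq_tsum => x1 x2.
  transitivity (\tsum_(a1, a2 <- Delta a) \tsum_(l1, l2 <- Delta L)
    teval (t : tdual) (S a1 * l1 * (Si x1 * a2)) (S l2 * x2)).
    rewrite exchange_tsum; apply: eq_tsum => l1 l2; rewrite K_lact_teval.
    by apply: eq_tsum => a1 a2; rewrite !mulrA.
  apply: eq_tsum => a1 a2.
  rewrite -(integral_slidelV (F := fun l1 l2 =>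
    teval (t : tdual) (l1 * (Si x1 * a2)) (S l2 * x2))); last by flin.
  by apply: eq_tsum => l1 l2; rewrite antiVM antiK antiM !mulrA.
rewrite F_ractE !chiE coprM_sum; last by flin.
apply: eq_tsum => x1 x2.
rewrite tsum_copr_antiV; last by flin.
transitivity (\tsum_(a1, a2 <- Delta a) \tsum_(l1, l2 <- Delta L)
  teval (t : tdual) (l1 * Si x1) (S (l2 * Si a2) * (x2 * Si a1))).
  rewrite exchange_tsum; apply: eq_tsum => l1 l2; rewrite K_ract_teval.
  by apply: eq_tsum => a1 a2; rewrite antiM antiVK !mulrA.
apply: eq_tsum => a1 a2.
rewrite (integral_sliderV (F := fun l1 l2 =>
  teval (t : tdual) (l1 * Si x1) (S l2 * (x2 * Si a1)))); last by flin.
by apply: eq_tsum => l1 l2; rewrite antiVM !mulrA.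
Qed.

Lemma QK_natural X Y (f : 'Hom(X, Y)) :
  bimod_hom f -> QK Y \o tmap \1 f = tmap \1 f \o QK X.
Proof.
move=> hf; apply: hom_tens_ext => fg x'; move: fg; apply: tens_ext; try by flin.
move=> f' g'; rewrite [LHS]comp_lfunE [RHS]comp_lfunE tmapE id_lfunE !QKE hom_tsum.
apply: eq_tsum => p1 p2; rewrite hom_tsum; apply: eq_tsum => q1 q2.
by rewrite tmapE id_lfunE (bimod_hom_lact _ _ hf) (bimod_hom_ract _ _ hf).
Qed.

Lemma twist_natural X Y (f : 'Hom(X, Y)) : bimod_hom f -> f \o twist X = twist Y \o f.
Proof.
move=> hf; apply/lfunP => x; rewrite /twist !comp_lfunE.
by rewrite bimod_hom_lact // bimod_hom_ract.
Qed.
End Morphisms.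

(** * Correlators as products of chi, and the action of the generators *)

Section Invariance.
Variables (k : fieldType) (A : frHopf k).
Local Notation S := (anti A).
Local Notation lam := (cointegral A).
Local Notation F := (F A).
Local Notation K := (K A).
Local Notation mF := (mF A).
Local Notation DeltaF := (DeltaF A).
Local Notation DeltaFn := (DeltaFn A).
Local Notation chi := (chi A).
Implicit Types (X Y Z W : bimod A).

Lemma assocK (U V W : vectType k) : assocV U V W \o assoc U V W = \1.
Proof.
apply: hom_tens_ext => uv w; move: uv; apply: tens_ext; try by lin.
by move=> u v; rewrite comp_lfunE assocE assocVE id_lfunE.
Qed.

Lemma assocVK (U V W : vectType k) : assoc U V W \o assocV U V W = \1.
Proof.
apply: hom_tens_ext => u vw; move: vw; apply: tens_ext; try by lin.
by move=> v w; rewrite comp_lfunE assocVE assocE id_lfunE.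
Qed.

Lemma assoc_natural (U V W U' V' W' : vectType k) (f : 'Hom(U, U')) (g : 'Hom(V, V'))
    (h : 'Hom(W, W')) :
  assoc U' V' W' \o tmap (tmap f g) h = tmap f (tmap g h) \o assoc U V W.
Proof.
apply: hom_tens_ext => uv w; move: uv; apply: tens_ext; try by lin.
by move=> u v; rewrite !comp_lfunE !tmapE !assocE !tmapE.
Qed.

Lemma unitlV_natural (U V : vectType k) (f : 'Hom(U, V)) :
  unitlV V \o f = tmap \1 f \o unitlV U.
Proof. by apply/lfunP => u; rewrite !comp_lfunE !unitlVE tmapE id_lfunE. Qed.

Lemma tmap_split (U V U' V' : vectType k) (f : 'Hom(U, U')) (g : 'Hom(V, V')) :
  tmap f g = tmap f \1 \o tmap \1 g.
Proof. by rewrite -tmap_comp comp_lfun1l comp_lfun1r. Qed.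

Lemma tmap_split' (U V U' V' : vectType k) (f : 'Hom(U, U')) (g : 'Hom(V, V')) :
  tmap f g = tmap \1 g \o tmap f \1.
Proof. by rewrite -tmap_comp comp_lfun1l comp_lfun1r. Qed.

Fixpoint prodchi g : 'Hom(tpow K g, F) :=
  if g is g'.+1 then mF \o tmap chi (prodchi g') else etaF A.

Lemma prodchi_hom g : bimod_hom (prodchi g).
Proof.
elim: g => [|g IH] /=; first exact: etaF_hom.
apply: (bimod_hom_comp (Y := btens F F)); first exact: mF_hom.
by apply: bimod_hom_tmap => //; apply: chi_hom.
Qed.

Lemma handles_etaF g :
  handles A g \o tmap \1 (etaF A) \o Defs.unitrV (tpow K g) = prodchi g.
Proof.
elim: g => [|g IH].
  apply/lfunP => c; rewrite !comp_lfunE unitrVE tmapE unitlE id_lfunE /= /etaF !pointE.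
  by rewrite scale1r.
apply: hom_tens_ext => x s.
have e : handles A g (s \ox etaF A (1 : k^o)) = prodchi g s.
  by rewrite -IH !comp_lfunE unitrVE tmapE id_lfunE.
rewrite -[handles A g.+1]/(handle A \o tmap \1 (handles A g) \o assoc K (tpow K g) F).
rewrite handle_chi 5!comp_lfunE unitrVE tmapE id_lfunE assocE !tmapE !id_lfunE e.
by rewrite comp_lfunE tmapE.
Qed.

(** [DeltaFn] treats one output separately; the right counit law makes the recursion hold there as
    well. *)
Lemma DeltaFnS n : DeltaFn n.+1 = tmap \1 (DeltaFn n) \o DeltaF.
Proof. by case: n => [|n] //=; rewrite DeltaF_counitr. Qed.

Lemma DeltaFn_hom n : bimod_hom (DeltaFn n).
Proof.
elim: n => [|n IH]; first exact: epsF_hom.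
rewrite DeltaFnS; apply: (bimod_hom_comp (Y := btens F F)); last exact: DeltaF_hom.
by apply: bimod_hom_tmap => //; apply: bimod_hom_id.
Qed.

Lemma CorE g n : Cor A g n = DeltaFn n \o prodchi g.
Proof. by rewrite /Cor -!comp_lfunA (comp_lfunA (handles A g)) handles_etaF. Qed.

Lemma DeltaFn_split (U V : vectType k) (f : 'Hom(F, U)) (g : 'Hom(F, V)) (W : vectType k)
    (h : 'Hom(F, W)) :
  tmap f (tmap g h \o DeltaF) \o DeltaF =
  assoc U V W \o tmap (tmap f g \o DeltaF) h \o DeltaF.
Proof.
have -> : tmap f (tmap g h \o DeltaF) = tmap f (tmap g h) \o tmap \1 DeltaF.
  by rewrite -tmap_comp comp_lfun1r.
have -> : tmap (tmap f g \o DeltaF) h = tmap (tmap f g) h \o tmap DeltaF \1.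
  by rewrite -tmap_comp comp_lfun1r.
rewrite (comp_lfunA (assoc U V W)) assoc_natural.
by rewrite -!comp_lfunA -DeltaF_coassoc -!comp_lfunA.
Qed.

(** The first two outputs come from a single [DeltaF], so that their braiding meets
    [DeltaF_cocomm]. *)
Lemma DeltaFnSS n :
  DeltaFn n.+2 = assoc F F (tpow F n) \o tmap DeltaF (DeltaFn n) \o DeltaF.
Proof. by rewrite DeltaFnS DeltaFnS DeltaFn_split tmap1 comp_lfun1l. Qed.

Lemma tsplit_DeltaFn j r :
  tsplit F j r \o DeltaFn (j + r) = tmap (DeltaFn j) (DeltaFn r) \o DeltaF.
Proof.
elim: j => [|j IH].
  rewrite -[LHS]/(unitlV (tpow F r) \o DeltaFn r) unitlV_natural -DeltaF_counitl.
  by rewrite comp_lfunA -tmap_comp comp_lfun1l comp_lfun1r.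
rewrite -[LHS]/(assocV F (tpow F j) (tpow F r) \o tmap \1 (tsplit F j r) \o
  DeltaFn (j + r).+1) !DeltaFnS -comp_lfunA (comp_lfunA (tmap _ _)) -tmap_comp comp_lfun1l IH.
by rewrite DeltaFn_split !comp_lfunA assocK comp_lfun1l.
Qed.

Lemma tsplitK X j r : tjoin X j r \o tsplit X j r = \1.
Proof.
elim: j => [|j IH] /=.
  by apply/lfunP => u; rewrite comp_lfunE unitlVE unitlE scale1r id_lfunE.
rewrite -!comp_lfunA (comp_lfunA (assoc _ _ _)) assocVK comp_lfun1l.
by rewrite -tmap_comp IH comp_lfun1l tmap1.
Qed.

Lemma padl_id X m r : padl m (\1 : 'End(tpow X r)) = \1.
Proof. by elim: m => [|m IH] //=; rewrite IH tmap1. Qed.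

Lemma padl_DeltaFn m r (z : 'End(tpow F r)) :
  z \o DeltaFn r = DeltaFn r -> padl m z \o DeltaFn (m + r) = DeltaFn (m + r).
Proof.
move=> e; elim: m => [|m IH] //.
by rewrite -[LHS]/(tmap \1 (padl m z) \o DeltaFn (m + r).+1) DeltaFnS comp_lfunA -tmap_comp comp_lfun1l IH.
Qed.

Lemma padl_prodchi m r (z : 'End(tpow K r)) :
  prodchi r \o z = prodchi r -> prodchi (m + r) \o padl m z = prodchi (m + r).
Proof.
move=> e; elim: m => [|m IH] //=.
by rewrite -comp_lfunA -tmap_comp comp_lfun1r IH.
Qed.

Lemma first2_DeltaFn r : first2 r (braid F F) \o DeltaFn r.+2 = DeltaFn r.+2.
Proof.
rewrite /first2 DeltaFnSS -!comp_lfunA (comp_lfunA (assocV _ _ _)) assocK comp_lfun1l.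
by rewrite (comp_lfunA (tmap (braid F F) _)) -tmap_comp DeltaF_cocomm comp_lfun1l.
Qed.

(** Naturality moves Q^K past [f] to the case of F itself, which is [chi_QK]. Any number of handles
    and outputs behind chi can thus be treated as one input. *)
Lemma encircle Y (f : 'Hom(Y, F)) : bimod_hom f ->
  mF \o tmap chi f \o QK Y = mF \o tmap chi f.
Proof.
move=> hf; rewrite tmap_split -!comp_lfunA -QK_natural //.
by rewrite (comp_lfunA (tmap _ _)) (comp_lfunA mF) (comp_lfunA mF) chi_QK !comp_lfunA.
Qed.

Lemma chi_twist Y (f : 'Hom(Y, F)) : bimod_hom f ->
  mF \o tmap chi f \o tmap (TK A) (twist Y) = mF \o tmap chi f.
Proof.
move=> hf; rewrite -comp_lfunA -tmap_comp chi_TK twist_natural //.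
by rewrite twist_F comp_lfun1l.
Qed.

(** Associativity of m_F isolates the product of the first two copies of chi. *)
Lemma prodchi_first2 r (z : 'End(btens K K)) :
  mF \o tmap chi chi \o z = mF \o tmap chi chi ->
  prodchi r.+2 \o first2 r z = prodchi r.+2.
Proof.
have e : prodchi r.+2 \o assoc K K (tpow K r) =
    mF \o tmap (mF \o tmap chi chi) (prodchi r).
  rewrite /= (_ : tmap chi (mF \o _) = tmap \1 mF \o tmap chi (tmap chi (prodchi r))).
    rewrite -!comp_lfunA -assoc_natural !comp_lfunA -mF_assoc -!comp_lfunA -tmap_comp.
    by rewrite comp_lfun1l.
  by rewrite -tmap_comp comp_lfun1l.
move=> ez; rewrite -[RHS]comp_lfun1r -(assocVK K K (tpow K r)) /first2 !comp_lfunA e.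
by rewrite -!comp_lfunA (comp_lfunA (tmap _ _)) -tmap_comp ez comp_lfun1r.
Qed.

Lemma prodchi_tmap r (z : 'End(K)) :
  chi \o z = chi -> prodchi r.+1 \o tmap z \1 = prodchi r.+1.
Proof. by move=> e; rewrite -comp_lfunA -tmap_comp e comp_lfun1r. Qed.

Lemma prodchi_QK r :
  prodchi r.+2 \o (tmap (TK A) (twist (tpow K r.+1)) \o QK (tpow K r.+1)) = prodchi r.+2.
Proof.
have hP := prodchi_hom r.+1.
rewrite -[prodchi r.+2]/(mF \o tmap chi (prodchi r.+1)).
move: (encircle hP) (chi_twist hP); move: (QK _) (tmap (TK A) _) => q t eq et.
by rewrite comp_lfunA et eq.
Qed.

Lemma chi_SKV : chi \o (SK A)^-1 = chi.
Proof. by rewrite -{1}(chi_SK A) -comp_lfunA SK_invr comp_lfun1r. Qed.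

(* Nondegeneracy of the Frobenius form turns the outputs [W] of a correlator
   into inputs from the left dual of [W]. *)
Definition frob (y : A) : F := linfun (fun x : A => lam (S x * y) : k^o).

Lemma frobE y x : (frob y : dual A) x = lam (S x * y).
Proof. by rewrite /frob linfunE' //; lin. Qed.

Lemma frob_lin : linear frob.
Proof.
move=> c y z; apply/lfunP => x; rewrite add_lfunE scale_lfunE !frobE.
by rewrite mulrDr -scalerAr linearP.
Qed.

(** The transpose of [f], with functionals on F pulled back along [frob] to functionals on A, that
    is, to elements of F. *)
Definition outdual W (f : 'Hom(F, W)) : 'Hom(ldual W, F) :=
  linfun (fun xi : dual W => linfun (fun y : A => xi (f (frob y))) : dual A).

Lemma outdualE W (f : 'Hom(F, W)) (xi : ldual W) y :
  (outdual f xi : dual A) y = (xi : dual W) (f (frob y)).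
Proof.
have lf (zeta : dual W) : linear (fun y => zeta (f (frob y))).
  by do 2!apply: lin_hom; apply: frob_lin.
rewrite /outdual linfunE'; first by rewrite linfunE'.
move=> c u w; apply/lfunP => z.
by rewrite linfunE' // !add_lfunE !scale_lfunE !linfunE'.
Qed.

(** The antipodes in the left dual are those under which [frob] turns the actions on F into
    multiplications of its argument; for the right action this is the quantum trace property. *)
Lemma outdual_hom W (f : 'Hom(F, W)) : bimod_hom f -> bimod_hom (outdual f).
Proof.
move=> hf; apply: bimod_homP => a xi; apply/lfunP => y.
  rewrite F_lactE !outdualE trE comp_lfunE -bimod_hom_lact //; congr (xi (f _)).
  apply/lfunP => x; rewrite F_lactE !frobE antiVK antiM.
  by rewrite mulrA.
rewrite F_ractE !outdualE trE comp_lfunE -bimod_hom_ract //; congr (xi (f _)).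
apply/lfunP => x; rewrite F_ractE !frobE antiK antiM -mulrA [LHS]cointegral_cycV.
by rewrite antiK mulrA.
Qed.

(** By the Frobenius relation, pairing the second leg of Delta_F(f') with a functional amounts to
    multiplying f' by the image of that functional under [outdual]. *)
Lemma lev_outdual (U : vectType k) W (d : 'Hom(F, U)) (f : 'Hom(F, W)) :
  Defs.unitr U \o tmap \1 (lev W) \o assoc U W (ldual W) \o tmap (tmap d f \o DeltaF) \1 =
  d \o mF \o tmap \1 (outdual f).
Proof.
have [phi phiE] : exists phi : ldual W -> tens (dual A) (dual A) -> dual A,
    forall xi T y, phi xi T y = (xi : dual W) (f (contr T y : F)).
  exists (fun xi T => linfun (fun y : A => (xi : dual W) (f (contr T y : F)))) => xi T y.
  by rewrite linfunE' //; apply: lin_hom; apply: lin_hom; apply: lin_contrr.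
have phi_lin xi : linear (phi xi).
  move=> c u w; apply/lfunP => y; rewrite add_lfunE scale_lfunE !phiE.
  by rewrite (lin_contr _ (@lin_id _ _)) !linearP.
have E (T : tens (dual A) (dual A)) (xi : ldual W) :
    Defs.unitr U (tmap \1 (lev W) (assoc U W (ldual W) (tmap d f T \ox xi))) =
    d (phi xi T).
  apply: (tens_ext
    (f := fun T => Defs.unitr U (tmap \1 (lev W) (assoc U W (ldual W) (tmap d f T \ox xi))))
    (g := fun T => d (phi xi T))) T => [||g h].
  - by lin.
  - exact: (lin_hom d (phi_lin xi)).
  rewrite tmapE assocE tmapE id_lfunE Defs.unitrE /lev tliftE tsumE; last by lin.
  rewrite -linearZ; congr (d _); apply/lfunP => y; rewrite phiE.
  by rewrite contrE !linearZ scale_lfunE; apply: mulrC.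
apply: hom_tens_ext => f' xi; rewrite !comp_lfunE !tmapE !id_lfunE comp_lfunE E.
congr (d _); apply/lfunP => y; rewrite phiE mFE.
(* [cointegral_slide] expresses Delta_F(f') through the coproduct of y, the one that also enters
   m_F. *)
have -> : contr (DeltaF f' : tens (dual A) (dual A)) y =
    \tsum_(y1, y2 <- copr A y) (((f' : dual A) y2 : k) *: frob y1).
  apply/lfunP => x; rewrite DeltaF_contr lfun_tsum.
  have := congr1 (f' : dual A) (cointegral_slide x y); rewrite !hom_tsum => e.
  transitivity (\tsum_(x1, x2 <- copr A x) (f' : dual A) ((lam (S x2 * y) : k) *: x1)).
    by apply: eq_tsum => x1 x2; rewrite linearZ; apply: mulrC.
  rewrite -e; apply: eq_tsum => y1 y2.
  by rewrite linearZ scale_lfunE frobE; apply: mulrC.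
rewrite !hom_tsum; apply: eq_tsum => y1 y2.
by rewrite outdualE !linearZ.
Qed.

(** Bending the last r outputs turns them into the input [outdual (DeltaFn r)], multiplied onto [P]
    in F; only this product has to be invariant under [z]. *)
Lemma Psi_Cor g j r (P : 'Hom(tpow K g, F))
    (z : 'End(btens (tpow K g) (ldual (tpow F r)))) :
  Psi (DeltaFn (j + r) \o P) z =
  DeltaFn j \o (mF \o tmap P (outdual (DeltaFn r)) \o z).
Proof.
rewrite /Psi comp_lfunA tsplit_DeltaFn.
have -> : tmap (tmap (DeltaFn j) (DeltaFn r) \o DeltaF \o P) \1 =
    tmap (tmap (DeltaFn j) (DeltaFn r) \o DeltaF) \1 \o tmap P \1
    :> 'Hom(tens (tpow K g) (ldual (tpow F r)), _).
  by rewrite -tmap_comp comp_lfun1r.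
rewrite comp_lfunA lev_outdual (tmap_split' P (outdual _)) !comp_lfunA.
by [].
Qed.

(** The zigzag identity for the left dual: with the identity in place of [z], bending the last
    outputs down and up again returns [phi]. *)
Lemma act_t_id g j r (phi : 'Hom(tpow K g, tpow F (j + r)))
    (z : 'End(btens (tpow K g) (ldual (tpow F r)))) :
  Psi phi z = Psi phi \1 -> act_t phi z = phi.
Proof.
rewrite /act_t => ->; apply/lfunP => x.
rewrite !comp_lfunE unitrVE tmapE id_lfunE /lcoev pointE scale1r.
have E (U V : vectType k) (W : bimod A) (f : 'Hom(U, tens V W)) (u : U) :
    tmap (Defs.unitr V \o tmap \1 (lev W) \o assoc V W (ldual W) \o tmap f \1) \1
      (assocV U (ldual W) W (u \ox \sum_i ebd i \ox eb i)) = f u.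
  have lsum (V1 V2 : vectType k) (h : V1 -> V2) (lh : linear h) n (G : 'I_n -> V1) :
      h (\sum_i G i) = \sum_i h (G i).
    by rewrite -(linfunE' lh) linear_sum; apply: eq_bigr => i _; rewrite /= linfunE'.
  rewrite (lsum _ _ _ (lin_purer u (@lin_id _ _))) !linear_sum.
  transitivity (\sum_i (Defs.unitr V (tmap \1 (lev W) (assoc V W (ldual W) (f u \ox ebd i))) \ox eb i)).
    by apply: eq_bigr => i _; rewrite /= assocVE tmapE !comp_lfunE tmapE !id_lfunE.
  move: (f u); apply: tens_ext => [|//|v w].
    move=> c s t; rewrite scaler_sumr -big_split; apply: eq_bigr => i _ /=.
    by rewrite (lin_purel _ (@lin_id _ _)) !linearP (lin_purel _ (@lin_id _ _)).
  rewrite [in RHS](eb_sum w) (lsum _ _ _ (lin_purer v (@lin_id _ _))).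
  apply: eq_bigr => i _; rewrite assocE tmapE id_lfunE /lev Defs.unitrE.
  rewrite tliftE tsumE ?ebdE; last by lin.
  by rewrite (linZ _ _ (lin_purel _ (@lin_id _ _))) (linZ _ _ (lin_purer _ (@lin_id _ _))).
rewrite /Psi comp_lfun1r E comp_lfunE -[tjoin _ _ _ _]comp_lfunE tsplitK.
by rewrite id_lfunE.
Qed.

Lemma prodchi_outdualS W (f : 'Hom(F, W)) g :
  mF \o tmap (prodchi g.+1) (outdual f) =
  mF \o tmap chi (mF \o tmap (prodchi g) (outdual f)) \o assoc K (tpow K g) (ldual W).
Proof.
transitivity (mF \o tmap mF \1 \o tmap (tmap chi (prodchi g)) (outdual f)).
  by rewrite -comp_lfunA -tmap_comp comp_lfun1l.
rewrite mF_assoc -!comp_lfunA assoc_natural !comp_lfunA; congr (_ \o _).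
by rewrite -comp_lfunA -tmap_comp comp_lfun1l.
Qed.

Lemma prodchi_outdual_padlr W (f : 'Hom(F, W)) m r
    (z : 'End(btens (tpow K r) (ldual W))) :
  mF \o tmap (prodchi r) (outdual f) \o z = mF \o tmap (prodchi r) (outdual f) ->
  mF \o tmap (prodchi (m + r)) (outdual f) \o padlr m z =
  mF \o tmap (prodchi (m + r)) (outdual f).
Proof.
move=> e; elim: m => [|m IH] //.
rewrite -[(m.+1 + r)%N]/(m + r).+1 prodchi_outdualS /= !comp_lfunA; congr (_ \o _).
rewrite -(comp_lfunA _ (assoc _ _ _)) assocVK comp_lfun1r -comp_lfunA -tmap_comp.
by rewrite comp_lfun1r IH.
Qed.

(** The handles behind the encircled one and the dual input together form one bimodule morphism [N]
    to F, to which [encircle] and [chi_twist] apply. *)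
Lemma prodchi_z_t W (f : 'Hom(F, W)) l : bimod_hom f ->
  mF \o tmap (prodchi l.+1) (outdual f) \o z_t l (ldual W) =
  mF \o tmap (prodchi l.+1) (outdual f).
Proof.
move=> hf; rewrite prodchi_outdualS /z_t.
set N := mF \o tmap (prodchi l) _.
have hN : bimod_hom (N : 'Hom(btens (tpow K l) (ldual W), F)).
  apply: (bimod_hom_comp (Y := btens F F)); first exact: mF_hom.
  by apply: bimod_hom_tmap; [apply: prodchi_hom | apply: outdual_hom].
move: (encircle hN) (chi_twist hN).
move: (QK _) (tmap (TK A) _) => q t eq et.
rewrite !comp_lfunA; congr (_ \o _).
by rewrite -(comp_lfunA _ (assoc _ _ _)) assocVK comp_lfun1r eq et.
Qed.
End Invariance.

Theorem theorem3p2 (k : closedFieldType) (char0 : [pchar k]%R =i pred0)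
    (A : frHopf k) (g n : nat) :
  bimod_hom (Cor A g n) /\
  forall gamma : mcg_gen g n, mcg_act gamma (Cor A g n) = Cor A g n.
Proof.
split.
  by rewrite CorE; apply: bimod_hom_comp; [apply: DeltaFn_hom | apply: prodchi_hom].
case=> {g n} [g i r|g i r|n m l|n m l|n m l|n m l|n m l|m l j r]; rewrite /mcg_act CorE.
- by rewrite comp_lfunA (padl_DeltaFn _ (first2_DeltaFn A r)).
- by rewrite twist_F tmap1 padl_id comp_lfun1l.
- by rewrite -comp_lfunA padl_prodchi // prodchi_tmap // chi_SK.
- by rewrite -comp_lfunA padl_prodchi // prodchi_tmap // chi_TK.
- rewrite -comp_lfunA padl_prodchi // prodchi_tmap //.
  rewrite (comp_lfunA (chi A) ((SK A)^-1 \o TK A) (SK A)).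
  by rewrite (comp_lfunA (chi A) (SK A)^-1 (TK A)) chi_SKV chi_TK chi_SK.
- rewrite -comp_lfunA padl_prodchi // prodchi_first2 // comp_lfunA chi_OK.
  by rewrite -comp_lfunA -tmap_comp chi_TK.
- by rewrite -comp_lfunA padl_prodchi // prodchi_QK.
apply: act_t_id; rewrite !Psi_Cor comp_lfun1r; congr (_ \o _).
apply: prodchi_outdual_padlr; apply: prodchi_z_t; exact: DeltaFn_hom.
Qed.
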